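(* Let $a,b\ge0$ and let $\nu$ be a measure on $\mathbb R^+$ with $\int_{\mathbb R^+}(x\wedge x^2)\,\nu(dx)<\infty$. Let $L=(L_t)_{t\ge0}$ be a spectrally positive Lévy process with characteristic exponent \[\Psi_L(\lambda)=ai\lambda+\tfrac12b^2\lambda^2-\int_0^\infty(e^{i\lambda x}-1-i\lambda x)\,\nu(dx),\] so that $\mathbb E[e^{i\lambda L_t}]=e^{-t\Psi_L(\lambda)}$. Let $(\sigma_t)_{t\ge0}$ be a (possibly killed) subordinator, not necessarily on the same probability space, with characteristic exponent \[\Psi_\sigma(\lambda)=a-b^2i\lambda-\int_0^\infty(e^{i\lambda x}-1)\,x\nu(dx)=-i\Psi_L'(\lambda).\] Assume (i) $\int_0^\infty(e^{ux}-1-ux)\,\nu(dx)<\infty$ for all $u\in\mathbb R$; and (ii) $\mathrm{Re}\,\Psi_L(\lambda)/|\lambda|\to\infty$ as $|\lambda|\to\infty$. Then $L_1$ has a density $p$, and the process $M_t=\exp(\int_0^t\sigma_s\,ds)\,p(-\sigma_t)\,\mathbf 1\{\sigma_t<\infty\}$ is a non-negative martingale in the natural filtration of $\sigma$.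
   Context: A killed subordinator is set to $+\infty$ at an independent exponential time (here of rate $a$); its characteristic exponent $\Psi_\sigma$ satisfies $\mathbb E[e^{i\lambda\sigma_t}\mathbf 1\{\sigma_t<\infty\}]=e^{-t\Psi_\sigma(\lambda)}$. *)

(* Defs.v *)
From HB Require Import structures.
From mathcomp Require Import all_boot all_order all_algebra.
From mathcomp Require Import all_classical all_reals all_analysis measurable_realfun.
Set Implicit Arguments.
Unset Strict Implicit.
Unset Printing Implicit Defensive.
Import Order.TTheory GRing.Theory Num.Theory.
Import numFieldNormedType.Exports.
Local Open Scope classical_set_scope.
Local Open Scope ring_scope.

Section Defs.
Context {R : realType}.

(** Real and imaginary parts of the characteristic exponents
    Psi_L(l) = a i l + b^2 l^2 / 2 - \int_0^oo (e^{i l x} - 1 - i l x) nu(dx)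
    Psi_s(l) = a - b^2 i l - \int_0^oo (e^{i l x} - 1) x nu(dx). *)
Definition PsiL_re (b : R) (nu : {measure set R -> \bar R}) (l : R) : R :=
  b ^+ 2 * l ^+ 2 / 2 - Rintegral nu `]0, +oo[ (fun x => cos (l * x) - 1).
Definition PsiL_im (a : R) (nu : {measure set R -> \bar R}) (l : R) : R :=
  a * l - Rintegral nu `]0, +oo[ (fun x => sin (l * x) - l * x).
Definition Psis_re (a : R) (nu : {measure set R -> \bar R}) (l : R) : R :=
  a - Rintegral nu `]0, +oo[ (fun x => (cos (l * x) - 1) * x).
Definition Psis_im (b : R) (nu : {measure set R -> \bar R}) (l : R) : R :=
  - (b ^+ 2 * l) - Rintegral nu `]0, +oo[ (fun x => sin (l * x) * x).

Context {d : measure_display} {T : measurableType d}.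

Definition levy_process (P : probability T R) (L : R -> T -> R) : Prop :=
  [/\ (forall t, measurable_fun setT (L t)),
      (forall w, L 0 w = 0),
      (forall (n : nat) (ts : nat -> R) (B : nat -> set R),
          0 <= ts 0%N -> (forall k, ts k <= ts k.+1) ->
          (forall k, measurable (B k)) ->
          P (\bigcap_(k < n) [set w | B k (L (ts k.+1) w - L (ts k) w)]) =
          \big[*%E/1%E]_(k < n) P [set w | B k (L (ts k.+1) w - L (ts k) w)]),
      (forall s t (B : set R), 0 <= s -> s <= t -> measurable B ->
          P [set w | B (L t w - L s w)] = P [set w | B (L (t - s) w)]) &
      (forall w t, 0 <= t ->
          ((fun s => L s w) @ t^'+ --> L t w) /\
          (0 < t -> cvg ((fun s => L s w) @ t^'-)))].

Definition subordinator (P : probability T R) (tau : R -> T -> R) : Prop :=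
  levy_process P tau /\
  (forall w s t, 0 <= s -> s <= t -> tau s w <= tau t w).

(** Killed subordinator with killing rate q: a subordinator tau sent to +oo
    at an independent exponential time e of rate q (e = +oo a.s. if q = 0). *)
Definition killed_subordinator (P : probability T R) (q : R)
    (sigma : R -> T -> \bar R) : Prop :=
  exists (tau : R -> T -> R) (e : T -> \bar R),
  [/\ subordinator P tau,
      measurable_fun setT e,
      (forall t : R, 0 <= t -> P [set w | (t%:E < e w)%E] = (expR (- (q * t)))%:E),
      (forall (n : nat) (ts : nat -> R) (B : nat -> set R) (C : set \bar R),
          (forall k, 0 <= ts k) -> (forall k, measurable (B k)) -> measurable C ->
          P ([set w | C (e w)] `&` \bigcap_(k < n) [set w | B k (tau (ts k) w)]) =
          (P [set w | C (e w)] * P (\bigcap_(k < n) [set w | B k (tau (ts k) w)]))%E) &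
      (forall (t : R) (w : T), 0 <= t ->
          sigma t w = if (t%:E < e w)%E then (tau t w)%:E else +oo%E)].

(** E[e^{i l X}] = e^{-(re + i im)}, written with real and imaginary parts. *)
Definition charfun_is (P : probability T R) (X : T -> R) (l re im : R) : Prop :=
  (\int[P]_(w in setT) (cos (l * X w))%:E = (expR (- re) * cos im)%:E)%E /\
  (\int[P]_(w in setT) (sin (l * X w))%:E = (- (expR (- re) * sin im))%:E)%E.

(** E[e^{i l X} 1{X < oo}] = e^{-(re + i im)} for an extended-valued X. *)
Definition charfun_killed_is (P : probability T R) (X : T -> \bar R)
    (l re im : R) : Prop :=
  (\int[P]_(w in [set w | X w \is a fin_num]) (cos (l * fine (X w)))%:E
     = (expR (- re) * cos im)%:E)%E /\
  (\int[P]_(w in [set w | X w \is a fin_num]) (sin (l * fine (X w)))%:E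
     = (- (expR (- re) * sin im))%:E)%E.

Definition density_of (P : probability T R) (X : T -> R) (p : R -> R) : Prop :=
  measurable_fun setT p /\ (forall x, 0 <= p x) /\
  forall B : set R, measurable B ->
    P (X @^-1` B) = (\int[lebesgue_measure]_(x in B) (p x)%:E)%E.

Definition natural_filtration (sigma : R -> T -> \bar R) (s : R) : set (set T) :=
  <<s [set A | exists u (B : set \bar R),
                 [/\ 0 <= u, u <= s, measurable B & A = sigma u @^-1` B]] >>.

Definition martingale (P : probability T R) (F : R -> set (set T))
    (M : R -> T -> R) : Prop :=
  [/\ (forall t (B : set R), 0 <= t -> measurable B -> F t (M t @^-1` B)),
      (forall t, 0 <= t -> P.-integrable setT (EFin \o M t)) &
      (forall s t (A : set T), 0 <= s -> s <= t -> F s A ->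
          (\int[P]_(w in A) (M t w)%:E = \int[P]_(w in A) (M s w)%:E)%E)].

End Defs.

Definition Mproc {R : realType} {d : measure_display} {T : measurableType d}
    (sigma : R -> T -> \bar R) (p : R -> R) (t : R) (w : T) : R :=
  if sigma t w \is a fin_num then
    expR (Rintegral lebesgue_measure `[0, t] (fun s => fine (sigma s w)))
      * p (- fine (sigma t w))
  else 0.

(* Main.v *)
Require Import Defs.
From HB Require Import structures.
From mathcomp Require Import all_boot all_order all_algebra.
From mathcomp Require Import all_classical all_reals all_analysis measurable_realfun.
From mathcomp Require Import ring lra.
Import Order.TTheory GRing.Theory Num.Theory.
Import numFieldNormedType.Exports.
Local Open Scope classical_set_scope.
Local Open Scope ring_scope.

(* The density of [L_1] is [p(-x) = pi^{-1} Re \int_0^oo e^{- Psi_L(l) + i l x} dl].  By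
   assumption (i) the exponents are entire, and by (ii) the integrand decays fast enough
   to shift the contour, so that multiplying by [e^{u x}] replaces [l] by [l + i u].
   Conditioning on the past of [sigma] turns [e^{i l sigma_{t+s}} 1{alive}] into
   [e^{- s Psi_sigma(l)} e^{i l sigma_t} 1{alive}].  Combining both, one time step of length
   [s] maps the exponent [- Psi_L(z)] to [- Psi_L(z + i s) - s Psi_sigma(z)], which differs
   from [- Psi_L(z)] by [O(s^2)] because [Psi_sigma = - i Psi_L'].  Over [n] steps of
   length [(t - r) / n] the errors add up to [O(1/n)], while the Riemann sums of the
   nondecreasing path of [sigma] converge to its integral; since
   [M_t <= e^{t sigma_t} p(- sigma_t)] is bounded, dominated convergence gives the
   martingale property.  Working over the half line, and treating the real and the
   imaginary part of the exponent separately, avoids complex-valued integrals. *)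

(** * Elementary real analysis *)

(** The weight [e^{\int sigma}] is not a function of [sigma_t], so no single Fourier identity
    handles it. On a grid it is a product of factors [e^{s sigma}], removed from the last to the
    first; each raises the contour by [s], so that a contour at height [r] ends at height [t]. The
    errors are estimated at height [r] because the weight of the past is only bounded by
    [e^{r sigma_r}]. The step identity is first known on events of the past. Weights enter through
    the layer cake formula, which needs nonnegative integrands. The intermediate transforms are no
    longer the density of [L_1], so their sign has to be propagated: it is read off the step
    identity started at time 0, where [sigma = 0]. Over the half line the contour shift leaves a
    vertical segment from 0 to [i u]. The exponent is real there and [dz] is imaginary, so the real
    part does not see it. Finally [M] evaluates [p] along [- sigma_t], whose law can have atoms (at
    [t = 0] it is one), so a density given almost everywhere would not do: continuity selects the
    version. *)

Lemma is_derive_addf (R : realType) (f g : R -> R) (x a b : R) :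
  is_derive x 1 f a -> is_derive x 1 g b ->
  is_derive x 1 (fun y => f y + g y) (a + b).
Proof. by move=> df dg; exact: is_deriveD. Qed.

Lemma is_derive_subf (R : realType) (f g : R -> R) (x a b : R) :
  is_derive x 1 f a -> is_derive x 1 g b ->
  is_derive x 1 (fun y => f y - g y) (a - b).
Proof. by move=> df dg; exact: is_deriveB. Qed.

Lemma is_derive_mulf (R : realType) (f g : R -> R) (x a b : R) :
  is_derive x 1 f a -> is_derive x 1 g b ->
  is_derive x 1 (fun y => f y * g y) (a * g x + f x * b).
Proof.
move=> df dg; apply: (is_derive_eq (is_deriveM df dg)).
by rewrite addrC /GRing.scale/= (mulrC a).
Qed.

Lemma is_derive_compf (R : realType) (f g : R -> R) (x a b : R) :
  is_derive x 1 f a -> is_derive (f x) 1 g b ->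
  is_derive x 1 (fun y => g (f y)) (a * b).
Proof.
move=> df dg; apply: (is_derive_eq (is_derive1_comp dg df)).
by rewrite mulrC.
Qed.

Lemma is_derive_continuous (R : realType) (f : R -> R) (f' : R -> R) :
  (forall x : R, is_derive x 1 f (f' x)) -> continuous f.
Proof.
move=> df x; apply: differentiable_continuous.
by apply/derivable1_diffP; have [] := df x.
Qed.

Lemma deriv1_bound (R : realType) (f f' : R -> R) (C x y : R) : x <= y ->
  (forall z : R, is_derive z 1 f (f' z)) ->
  (forall z, x <= z <= y -> `|f' z| <= C) -> `|f y - f x| <= C * (y - x).
Proof.
rewrite le_eqVlt => /predU1P[<-|xy] df fC; first by rewrite !subrr normr0 mulr0.
have cf : {within `[x, y], continuous f}.
  by apply: continuous_subspaceT; exact: is_derive_continuous df.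
have [c cxy ->] := MVT xy (fun z _ => df z) cf.
rewrite normrM (gtr0_norm (x := y - x)) ?subr_gt0//.
rewrite ler_wpM2r ?subr_ge0 ?(ltW xy)//; apply: fC.
by move: cxy; rewrite in_itv/= => /andP[/ltW -> /ltW ->].
Qed.

Lemma sin_le_norm (R : realType) (x : R) : `|sin x| <= `|x|.
Proof.
wlog x0 : x / 0 <= x.
  move=> H; have [/H//|/ltW x0] := leP 0 x.
  by have := H (- x); rewrite sinN !normrN; apply; rewrite oppr_ge0.
have := @deriv1_bound R sin cos 1 0 x x0 (fun z => is_derive_sin z).
rewrite sin0 !subr0 mul1r (ger0_norm x0); apply => z _; exact: cos_max.
Qed.

Lemma cosB1_le_norm (R : realType) (x : R) : `|cos x - 1| <= `|x|.
Proof.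
wlog x0 : x / 0 <= x.
  move=> H; have [/H//|/ltW x0] := leP 0 x.
  by have := H (- x); rewrite cosN !normrN; apply; rewrite oppr_ge0.
have := @deriv1_bound R cos (fun z => - sin z) 1 0 x x0 (fun z => is_derive_cos z).
by rewrite cos0 subr0 mul1r (ger0_norm x0); apply => z _; rewrite normrN sin_max.
Qed.

Lemma cosB1_le_sqr (R : realType) (x : R) : `|cos x - 1| <= x ^+ 2.
Proof.
(* Half-angle formula: [1 - cos x = 2 sin^2 (x / 2)]. *)
have -> : x = (x / 2) *+ 2 by rewrite -mulr_natr; field.
rewrite cos_mulr2n cos2sin2.
have -> : (1 - sin (x / 2) ^+ 2) *+ 2 - 1 - 1 = - (2 * sin (x / 2) ^+ 2).
  by ring.
rewrite normrN ger0_norm; last by rewrite mulr_ge0// sqr_ge0.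
have := sin_le_norm _ (x / 2); rewrite -ler_sqr ?nnegrE ?normr_ge0//.
rewrite !real_normK ?num_real// => h; rewrite -(mulr_natr (x / 2)) exprMn.
have := sqr_ge0 (x / 2); move: h; set a := sin _ ^+ 2; set b := _ ^+ 2.
lra.
Qed.

Lemma sinBid_le_sqr (R : realType) (x : R) : `|sin x - x| <= x ^+ 2.
Proof.
wlog x0 : x / 0 <= x.
  move=> H; have [/H//|/ltW x0] := leP 0 x.
  have := H (- x); rewrite sinN -opprD normrN sqrrN; apply.
  by rewrite oppr_ge0.
have := @deriv1_bound R (fun z => sin z - z) (fun z => cos z - 1) x 0 x x0.
rewrite sin0 !subr0 expr2; apply.
move=> z /andP[z0 zx]; apply: (le_trans (cosB1_le_norm _ _)).
  by rewrite ger0_norm.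
Qed.

Lemma expRB1_le (R : realType) (x : R) : `|expR x - 1| <= `|x| * expR `|x|.
Proof.
have [x0|x0] := leP 0 x.
  rewrite (ger0_norm x0) ger0_norm; last first.
    by rewrite subr_ge0 -expR0 ler_expR.
  have := expR_ge1Dx (- x); rewrite expRN => h.
  have := expR_gt0 x; set e := expR x => e0.
  have : (1 - x) * e <= e^-1 * e by rewrite ler_wpM2r// ltW.
  rewrite mulVf ?gt_eqF//; lra.
have ex1 : expR x <= 1 by rewrite expR_le1 ltW.
rewrite ler0_norm ?subr_le0// (ltr0_norm x0) opprB.
have := expR_ge1Dx x => h.
have : 1 <= expR (- x) by rewrite -[leLHS]expR0 ler_expR oppr_ge0 ltW.
move: (expR _) => e; nra.
Qed.

Lemma expRB1D_le (R : realType) (x : R) :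
  `|expR x - 1 - x| <= x ^+ 2 * expR `|x|.
Proof.
have exh z : `|z| <= `|x| -> `|expR z - 1| <= `|x| * expR `|x|.
  move=> zx; apply: (le_trans (expRB1_le _ _)).
  apply: ler_pM => //.
  by rewrite ler_expR.
have [x0|x0] := leP 0 x.
  have := @deriv1_bound R (fun z => expR z - z) (fun z => expR z - 1)
    (`|x| * expR `|x|) 0 x x0.
  rewrite expR0 !subr0 (ger0_norm x0) => h.
  have -> : expR x - 1 - x = expR x - x - 1 by ring.
  rewrite (_ : x ^+ 2 * _ = x * expR x * x); last by ring.
  apply: h => z /andP[z0 zx].
  by have := exh z; rewrite (ger0_norm x0) (ger0_norm z0); exact.
have := @deriv1_bound R (fun z => expR z - z) (fun z => expR z - 1)
    (`|x| * expR `|x|) x 0 (ltW x0).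
rewrite expR0 !subr0 (ltr0_norm x0) sub0r => h.
have -> : `|expR x - 1 - x| = `|1 - (expR x - x)|.
  by rewrite distrC; congr `|_|; ring.
rewrite (_ : x ^+ 2 * _ = - x * expR (- x) * - x); last by ring.
apply: h => z /andP[zx z0].
have := exh z; rewrite (ltr0_norm x0) (ler0_norm z0); apply; lra.
Qed.

(* With [w = u x / 2]: [e^{4w} - 1 - 4w >= (e^{2w} - 1)^2 = (e^w - 1)^2 (e^w + 1)^2
   >= w^2 e^{2w}]. *)
Lemma sqr_expR_le (R : realType) (u x : R) : 0 < u -> 0 <= x ->
  x ^+ 2 * expR (u * x) <=
    4 / u ^+ 2 * (expR ((2 * u) * x) - 1 - (2 * u) * x).
Proof.
move=> u0 x0; pose w := u * x / 2.
have w0 : 0 <= w by rewrite /w mulr_ge0// mulr_ge0// ltW.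
have -> : u * x = w + w by rewrite /w; field.
have -> : (2 * u) * x = w + w + (w + w) by rewrite /w; field.
have -> : x = 2 * w / u by rewrite /w; field; rewrite gt_eqF.
rewrite 3!expRD; have := expR_ge1Dx w; move: (expR w) => e he.
rewrite (_ : _ ^+ 2 * _ = 4 / u ^+ 2 * (w ^+ 2 * (e * e))); last first.
  by field; rewrite gt_eqF.
apply: ler_wpM2l; first by rewrite divr_ge0// sqr_ge0.
have e1 : 1 <= e by lra.
have h1 : w ^+ 2 * (e * e) <= ((e - 1) * e) ^+ 2.
  rewrite (_ : w ^+ 2 * (e * e) = (w * e) ^+ 2); last by ring.
  rewrite ler_sqr ?nnegrE; [|by apply: mulr_ge0; lra|by apply: mulr_ge0; lra].
  by apply: ler_wpM2r; lra.
have h2 : ((e - 1) * e) ^+ 2 <= ((e - 1) * (e + 1)) ^+ 2.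
  rewrite ler_sqr ?nnegrE; [|by apply: mulr_ge0; lra|by apply: mulr_ge0; lra].
  by apply: ler_wpM2l; lra.
have h3 : ((e - 1) * (e + 1)) ^+ 2 <= e * e * (e * e) - 1 - (w + w + (w + w)).
  have -> : ((e - 1) * (e + 1)) ^+ 2 = e * e * (e * e) - 2 * (e * e) + 1 by ring.
  have : (1 + w) * (1 + w) <= e * e by apply: ler_pM; lra.
  nra.
lra.
Qed.

Ltac cont_step := first
  [ exact: cvg_cst | exact: cvg_id | assumption
  | match goal with H : continuous ?f |- _ => exact: H end
  | apply: cvgD | apply: cvgB | apply: cvgN | apply: cvgM
  | apply: (continuous_comp (g := expR)); [|exact: continuous_expR]
  | apply: (continuous_comp (g := cos)); [|exact: continuous_cos]
  | apply: (continuous_comp (g := sin)); [|exact: continuous_sin]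
  | apply: (continuous_comp (g := fun y => y ^+ _)); [|exact: exprn_continuous] ].
Ltac cont := let x := fresh "x" in move=> x; rewrite /continuous_at/=; repeat cont_step.

(** * Integrals against the jump measure *)

Section exponential_moments.
Context {R : realType} (nu : {measure set R -> \bar R}).
Hypothesis nu_exp : forall u : R,
  (\int[nu]_(x in `](0%R : R), +oo[) (expR (u * x) - 1 - u * x)%R%:E < +oo)%E.
Let D : set R := `](0 : R), +oo[.

(** One dominating function serves all integrals against [nu]: [x^2] controls the small jumps and
    [e^{U x}] the large ones, uniformly for [|Im z| <= U]. For [U > 0] its integrability is
    assumption (i) with [u = 2 U]. *)
Definition sqr_exp (U x : R) : R := x ^+ 2 * expR (U * x).

Lemma continuous_sqr_exp U : continuous (sqr_exp U).
Proof. by rewrite /sqr_exp; cont. Qed.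

Lemma measurable_continuous (f : R -> R) (A : set R) :
  continuous f -> measurable_fun A f.
Proof.
move=> cf; apply: measurable_funTS.
exact: continuous_measurable_fun.
Qed.

Lemma integrable_sqr_exp U : 0 < U -> nu.-integrable D (EFin \o sqr_exp U).
Proof.
move=> U0; pose g x := expR ((2 * U) * x) - 1 - (2 * U) * x.
have cg : continuous g by rewrite /g; cont.
have g0 x : 0 <= g x.
  by rewrite /g; have := expR_ge1Dx (2 * U * x); lra.
have ig : nu.-integrable D (EFin \o g).
  apply/integrableP; split.
    by apply/measurable_EFinP; exact: measurable_continuous.
  rewrite (eq_integral (EFin \o g)); first exact: nu_exp.
  by move=> x _ /=; rewrite ger0_norm.
have /= := integrableZl (measurable_itv _) (4 / U ^+ 2) ig.
apply: le_integrable => //.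
  by apply/measurable_EFinP; apply: measurable_continuous; exact: continuous_sqr_exp.
move=> x; rewrite /D/= in_itv/= andbT => x0.
rewrite lee_fin !ger0_norm.
- exact: (sqr_expR_le _ U x U0 (ltW x0)).
- by rewrite mulr_ge0// ?divr_ge0 ?sqr_ge0.
- by rewrite mulr_ge0 ?sqr_ge0 ?expR_ge0.
Qed.

Lemma integrable_sqr_expP (f : R -> R) (C U : R) : 0 < U -> continuous f ->
  (forall x, 0 < x -> `|f x| <= C * sqr_exp U x) ->
  nu.-integrable D (EFin \o f).
Proof.
move=> U0 cf fC.
have /= := integrableZl (measurable_itv _) C (integrable_sqr_exp _ U0).
apply: le_integrable => //.
  by apply/measurable_EFinP; exact: measurable_continuous.
move=> x; rewrite /D/= in_itv/= andbT => x0.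
rewrite lee_fin; apply: (le_trans (fC _ x0)).
exact: ler_norm.
Qed.

Lemma Rintegral_sqr_exp_bound (f : R -> R) (C U : R) : 0 < U -> continuous f ->
  (forall x, 0 < x -> `|f x| <= C * sqr_exp U x) ->
  `|Rintegral nu D f| <= C * Rintegral nu D (sqr_exp U).
Proof.
move=> U0 cf fC.
have intf := integrable_sqr_expP _ _ _ U0 cf fC.
have intW := integrable_sqr_exp _ U0.
apply: (le_trans (le_normr_Rintegral _ intf)); first exact: measurable_itv.
have <- : Rintegral nu D (fun x => C * sqr_exp U x) = C * Rintegral nu D (sqr_exp U).
  by rewrite RintegralZl//; exact: measurable_itv.
apply: le_Rintegral => //.
- exact: measurable_itv.
- exact: integrable_norm.
- by have /= := integrableZl (measurable_itv _) C intW.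
- by move=> x; rewrite /D/= in_itv/= andbT => /fC.
Qed.

(** The bound is asked only near [s0], because the constants of the kernel bounds below grow with
    the parameter. *)
Lemma is_derive_Rintegral (f f' : R -> R -> R) (C U s0 : R) : 0 < U ->
  (forall s, nu.-integrable D (EFin \o f s)) ->
  (forall s x : R, is_derive s 1 (f ^~ x) (f' s x)) ->
  (forall s x, `|s - s0| < 1 -> 0 < x -> `|f' s x| <= C * sqr_exp U x) ->
  is_derive s0 1 (fun s => Rintegral nu D (f s)) (Rintegral nu D (f' s0)).
Proof.
move=> U0 intf df fC.
(* No sign is assumed for [C], while the dominating function has to be nonnegative at every [x]. *)
pose G x := `|C| * sqr_exp U x.
have G0 x : 0 <= G x.
  by rewrite /G/sqr_exp; do 2?apply: mulr_ge0; rewrite ?sqr_ge0 ?expR_ge0.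
have dE s x : partial1of2 f s x = f' s x.
  by rewrite partial1of2E; have [_ ->] := df s x.
have Is0 : `](s0 - 1), (s0 + 1)[%classic s0 by rewrite /= in_itv/=; apply/andP; split; lra.
have mD : measurable D by exact: measurable_itv.
have df1 s x : `](s0 - 1), (s0 + 1)[%classic s -> D x -> derivable (f ^~ x) s 1.
  by move=> _ _; have [] := df s x.
have iG : nu.-integrable D (EFin \o G).
  by have /= := integrableZl (measurable_itv _) `|C| (integrable_sqr_exp _ U0).
have Gub s x : `](s0 - 1), (s0 + 1)[%classic s -> D x -> `|partial1of2 f s x| <= G x.
  rewrite /= in_itv/= => /andP[s1 s2]; rewrite /D /= in_itv/= andbT => x0.
  rewrite dE; apply: (le_trans (fC s x _ x0)).
    by rewrite ltr_norml; apply/andP; split; lra.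
  by rewrite ler_wpM2r ?ler_norm// /sqr_exp mulr_ge0 ?sqr_ge0 ?expR_ge0.
have := @differentiation_under_integral R _ _ nu f D mD s0 _ _ Is0
  (fun s _ => intf s) df1 G G0 iG Gub.
have := @derivable_under_integral R _ _ nu f D mD s0 _ _ Is0
  (fun s _ => intf s) df1 G G0 iG Gub.
move=> /derivableP h; rewrite derive1E => e.
apply: (is_derive_eq h); rewrite e; apply: eq_Rintegral => x _.
exact: dE.
Qed.

Lemma continuous_Rintegral (f : R -> R -> R) (C U : R) : 0 < U ->
  (forall s, continuous (f s)) -> (forall x, continuous (f ^~ x)) ->
  (forall s x, 0 < x -> `|f s x| <= C * sqr_exp U x) ->
  continuous (fun s => Rintegral nu D (f s)).
Proof.
move=> U0 cf cf' fC s0.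
have Is0 : s0 \in (`](s0 - 1), (s0 + 1)[%classic : set R) by rewrite inE/= in_itv/=; apply/andP; split; lra.
have mD : measurable D by exact: measurable_itv.
apply: (@continuity_under_integral R _ _ nu f D mD (s0 - 1) (s0 + 1) _ _
  (fun x => C * sqr_exp U x)) => //.
- by move=> s _; exact: (integrable_sqr_expP _ _ _ U0 (cf s) (fC s)).
- by apply: aeW => y _ s _; exact: cf'.
- by have /= := integrableZl (measurable_itv _) C (integrable_sqr_exp _ U0).
- move=> s _; apply: aeW => x; rewrite /D /= in_itv/= andbT.
  exact: fC.
Qed.

End exponential_moments.

(** Each rule is applied with [eapply], so the derivative is computed into an existential variable;
    [deriv] then leaves the equation between this value and the announced one. *)
Ltac deriv_step := match goal with
  | |- is_derive _ _ (fun _ => ?c) _ => eapply is_derive_cst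
  | |- is_derive _ _ (fun y => y) _ => eapply is_derive_id
  | H : forall z, is_derive z _ ?f _ |- is_derive _ _ (fun y => ?f y) _ => eapply H
  | H : is_derive ?z _ ?f _ |- is_derive ?z _ (fun y => ?f y) _ => eapply H
  | H : forall z, is_derive z _ ?f _ |- is_derive _ _ (fun y => ?f (@?g y)) _ => eapply (is_derive_compf _ g f); [|eapply H]
  | |- is_derive _ _ (fun y => @?f y - @?g y) _ => eapply (is_derive_subf _ f g)
  | |- is_derive _ _ (fun y => @?f y + @?g y) _ => eapply (is_derive_addf _ f g)
  | |- is_derive _ _ (fun y => - @?f y) _ => eapply (@is_deriveN _ _ _ f)
  | |- is_derive _ _ (fun y => @?f y * @?g y) _ => eapply (is_derive_mulf _ f g)
  | |- is_derive _ _ (fun y => expR (@?f y)) _ =>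
      eapply (is_derive_compf _ f expR); [|eapply is_derive_expR]
  | |- is_derive _ _ (fun y => cos (@?f y)) _ =>
      eapply (is_derive_compf _ f cos); [|eapply is_derive_cos]
  | |- is_derive _ _ (fun y => sin (@?f y)) _ =>
      eapply (is_derive_compf _ f sin); [|eapply is_derive_sin]
  | |- is_derive _ _ (fun y => atan (@?f y)) _ =>
      eapply (is_derive_compf _ f atan); [|eapply is_derive1_atan]
  end.
Ltac deriv := eapply is_derive_eq; [cbv beta; repeat deriv_step|cbv beta].

Lemma is_derive_cts (R : realType) (f : R -> R) (x f' : R) :
  is_derive x 1 f f' -> {for x, continuous f}.
Proof.
by move=> [df _]; apply: differentiable_continuous; exact/derivable1_diffP.
Qed.
(** Continuity is obtained from differentiability, so that the rules above are reused and the
    derivative found is discarded. *)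
Ltac dcont := let x := fresh "x" in move=> x; eapply is_derive_cts; cbv beta; repeat deriv_step.

(** * Real and imaginary parts of the complex kernels *)

Section kernels.
Context {R : realType}.
Implicit Types l u x U : R.

(** With [z = l + i u], the pairs are [F = e^{i z x} - 1 - i z x], [G = (e^{i z x} - 1) x] and
    [K = x^2 e^{i z x}]. In [z] they satisfy [F' = i G] and [G' = i K], which is what the eight
    derivative lemmas express. *)
Definition Fre l u x := expR (- (u * x)) * cos (l * x) - 1 + u * x.
Definition Fim l u x := expR (- (u * x)) * sin (l * x) - l * x.
Definition Gre l u x := (expR (- (u * x)) * cos (l * x) - 1) * x.
Definition Gim l u x := expR (- (u * x)) * sin (l * x) * x.
Definition Kre l u x := expR (- (u * x)) * cos (l * x) * (x * x).
Definition Kim l u x := expR (- (u * x)) * sin (l * x) * (x * x).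

Lemma is_derive_Fre_l l u x : is_derive l 1 (fun l => Fre l u x) (- Gim l u x).
Proof. by rewrite /Fre /Gim; deriv; rewrite /=; ring. Qed.
Lemma is_derive_Fre_u l u x : is_derive u 1 (fun u => Fre l u x) (- Gre l u x).
Proof. by rewrite /Fre /Gre; deriv; rewrite /=; ring. Qed.
Lemma is_derive_Fim_l l u x : is_derive l 1 (fun l => Fim l u x) (Gre l u x).
Proof. by rewrite /Fim /Gre; deriv; rewrite /=; ring. Qed.
Lemma is_derive_Fim_u l u x : is_derive u 1 (fun u => Fim l u x) (- Gim l u x).
Proof. by rewrite /Fim /Gim; deriv; rewrite /=; ring. Qed.
Lemma is_derive_Gre_l l u x : is_derive l 1 (fun l => Gre l u x) (- Kim l u x).
Proof. by rewrite /Gre /Kim; deriv; rewrite /=; ring. Qed.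
Lemma is_derive_Gre_u l u x : is_derive u 1 (fun u => Gre l u x) (- Kre l u x).
Proof. by rewrite /Gre /Kre; deriv; rewrite /=; ring. Qed.
Lemma is_derive_Gim_l l u x : is_derive l 1 (fun l => Gim l u x) (Kre l u x).
Proof. by rewrite /Gim /Kre; deriv; rewrite /=; ring. Qed.
Lemma is_derive_Gim_u l u x : is_derive u 1 (fun u => Gim l u x) (- Kim l u x).
Proof. by rewrite /Gim /Kim; deriv; rewrite /=; ring. Qed.

Lemma expRN_le_sqr_exp u U x : `|u| <= U -> 0 < x -> expR (- (u * x)) <= expR (U * x).
Proof.
move=> uU x0; rewrite ler_expR -mulNr ler_wpM2r ?(ltW x0)//.
by apply: le_trans uU; rewrite -normrN ler_norm.
Qed.

Lemma norm_expRN_le u U x : `|u| <= U -> 0 < x ->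
  `|expR (- (u * x)) - 1| <= `|u| * x * expR (U * x).
Proof.
move=> uU x0; apply: (le_trans (expRB1_le _ _)).
rewrite normrN normrM (gtr0_norm x0) ler_wpM2l//.
  by rewrite mulr_ge0// ltW.
by rewrite ler_expR ler_wpM2r// ltW.
Qed.

Lemma Kre_bound l u U x : `|u| <= U -> 0 < x -> `|Kre l u x| <= 1 * sqr_exp U x.
Proof.
move=> uU x0; rewrite /Kre/sqr_exp mul1r mulrC !normrM -expr2 real_normK ?num_real//.
rewrite ler_wpM2l ?sqr_ge0// ger0_norm ?expR_ge0//.
rewrite -[leRHS]mulr1 ler_pM ?expR_ge0// ?cos_max//.
exact: expRN_le_sqr_exp.
Qed.

Lemma Kim_bound l u U x : `|u| <= U -> 0 < x -> `|Kim l u x| <= 1 * sqr_exp U x.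
Proof.
move=> uU x0; rewrite /Kim/sqr_exp mul1r mulrC !normrM -expr2 real_normK ?num_real//.
rewrite ler_wpM2l ?sqr_ge0// ger0_norm ?expR_ge0//.
rewrite -[leRHS]mulr1 ler_pM ?expR_ge0// ?sin_max//.
exact: expRN_le_sqr_exp.
Qed.

Lemma Gim_bound l u U x : `|u| <= U -> 0 < x -> `|Gim l u x| <= `|l| * sqr_exp U x.
Proof.
move=> uU x0; rewrite /Gim/sqr_exp !normrM (gtr0_norm x0) (ger0_norm (expR_ge0 _)).
rewrite (_ : `|l| * _ = expR (U * x) * (`|l| * x) * x); last by ring.
rewrite ler_wpM2r ?(ltW x0)// ler_pM ?expR_ge0//.
  exact: expRN_le_sqr_exp.
by apply: (le_trans (sin_le_norm _ _)); rewrite normrM (gtr0_norm x0).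
Qed.

(** Splitting [e^{-ux} cos (lx) - 1] into [e^{-ux} (cos (lx) - 1)] and [e^{-ux} - 1] separates
    oscillation from growth; each piece gives one factor [x]. *)
Lemma Gre_bound l u U x : `|u| <= U -> 0 < x ->
  `|Gre l u x| <= (`|l| + `|u|) * sqr_exp U x.
Proof.
move=> uU x0; rewrite /Gre/sqr_exp normrM (gtr0_norm x0).
rewrite (_ : (`|l| + `|u|) * _ =
  (expR (U * x) * (`|l| * x) + `|u| * x * expR (U * x)) * x); last by ring.
rewrite ler_wpM2r ?(ltW x0)//.
rewrite (_ : expR _ * _ - 1 = expR (- (u * x)) * (cos (l * x) - 1) +
  (expR (- (u * x)) - 1)); last by ring.
apply: (le_trans (ler_normD _ _)); apply: lerD; last exact: norm_expRN_le.
rewrite normrM (ger0_norm (expR_ge0 _)) ler_pM ?expR_ge0//.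
  exact: expRN_le_sqr_exp.
by apply: (le_trans (cosB1_le_norm _ _)); rewrite normrM (gtr0_norm x0).
Qed.

Lemma Fim_bound l u U x : `|u| <= U -> 0 < x ->
  `|Fim l u x| <= (`|l| * `|u| + l ^+ 2) * sqr_exp U x.
Proof.
move=> uU x0; rewrite /Fim/sqr_exp.
have U0 : 0 <= U by exact: le_trans uU.
rewrite (_ : (_ + _) * _ =
  (`|u| * x * expR (U * x)) * (`|l| * x) + (l * x) ^+ 2 * expR (U * x)); last by ring.
rewrite (_ : _ - l * x = (expR (- (u * x)) - 1) * sin (l * x) +
  (sin (l * x) - l * x)); last by ring.
apply: (le_trans (ler_normD _ _)); apply: lerD.
  rewrite normrM ler_pM//; first exact: norm_expRN_le.
  by apply: (le_trans (sin_le_norm _ _)); rewrite normrM (gtr0_norm x0).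
apply: (le_trans (sinBid_le_sqr _ _)); rewrite ler_peMr ?sqr_ge0//.
by rewrite -expR0 ler_expR mulr_ge0// ltW.
Qed.

(** The same splitting, with [u x] joined to the second piece so that both pieces vanish to second
    order at [x = 0]. *)
Lemma Fre_bound l u U x : `|u| <= U -> 0 < x ->
  `|Fre l u x| <= (l ^+ 2 + u ^+ 2) * sqr_exp U x.
Proof.
move=> uU x0; rewrite /Fre/sqr_exp.
rewrite (_ : (_ + _) * _ =
  expR (U * x) * (l * x) ^+ 2 + (- (u * x)) ^+ 2 * expR (U * x)); last by ring.
rewrite (_ : _ + u * x = expR (- (u * x)) * (cos (l * x) - 1) +
  (expR (- (u * x)) - 1 - (- (u * x)))); last by ring.
apply: (le_trans (ler_normD _ _)); apply: lerD.
  rewrite normrM (ger0_norm (expR_ge0 _)) ler_pM ?expR_ge0//.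
    exact: expRN_le_sqr_exp.
  exact: cosB1_le_sqr.
apply: (le_trans (expRB1D_le _ _)); rewrite ler_wpM2l ?sqr_ge0//.
by rewrite ler_expR normrN normrM (gtr0_norm x0) ler_wpM2r// ltW.
Qed.

Lemma continuous_Fre l u : continuous (Fre l u).
Proof. by rewrite /Fre; dcont. Qed.
Lemma continuous_Fim l u : continuous (Fim l u).
Proof. by rewrite /Fim; dcont. Qed.
Lemma continuous_Gre l u : continuous (Gre l u).
Proof. by rewrite /Gre; dcont. Qed.
Lemma continuous_Gim l u : continuous (Gim l u).
Proof. by rewrite /Gim; dcont. Qed.
Lemma continuous_Kre l u : continuous (Kre l u).
Proof. by rewrite /Kre; dcont. Qed.
Lemma continuous_Kim l u : continuous (Kim l u).
Proof. by rewrite /Kim; dcont. Qed.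

End kernels.

(* [A + i B], as a function of [l + i u], is holomorphic with derivative
   [P + i Q]; [B 0 u = 0] encodes the symmetry under [z -> - conj z], which lets
   Fourier integrals be taken over the half line. *)
Record holo_exp {R : realType} (A B P Q : R -> R -> R) : Prop := HoloExp {
  holo_Al : forall l u : R, is_derive l 1 (fun l => A l u) (P l u) ;
  holo_Bl : forall l u : R, is_derive l 1 (fun l => B l u) (Q l u) ;
  holo_Au : forall l u : R, is_derive u 1 (fun u => A l u) (- Q l u) ;
  holo_Bu : forall l u : R, is_derive u 1 (fun u => B l u) (P l u) ;
  holo_cP : forall u, continuous (fun l => P l u) ;
  holo_cQ : forall u, continuous (fun l => Q l u) ;
  holo_B0 : forall u, B 0 u = 0 ;
  holo_growth : forall U : R, exists C : R, 0 <= C /\ forall l u : R, 0 <= l -> `|u| <= U ->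
    `|P l u| <= C * (1 + l) /\ `|Q l u| <= C * (1 + l) }.

(* Under assumption (ii) the real part of [- Psi_L] decays faster than [- 2 l]; the
   constant [2] leaves room for one derivative in [l]. *)
Definition decays {R : realType} (A : R -> R -> R) : Prop :=
  forall U : R, exists C : R, forall l u : R, 0 <= l -> `|u| <= U -> A l u <= C - 2 * l.

Lemma continuousD_fun (R : realType) (f g : R -> R) :
  continuous f -> continuous g -> continuous (fun x => f x + g x).
Proof. by move=> cf cg x; apply: cvgD; [exact: cf|exact: cg]. Qed.

Lemma continuousM_fun (R : realType) (f g : R -> R) :
  continuous f -> continuous g -> continuous (fun x => f x * g x).
Proof. by move=> cf cg x; apply: cvgM; [exact: cf|exact: cg]. Qed.

Lemma continuousN_fun (R : realType) (f : R -> R) :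
  continuous f -> continuous (fun x => - f x).
Proof. by move=> cf x; apply: cvgN; exact: cf. Qed.

Lemma holo_shift {R : realType} (A B P Q : R -> R -> R) (c : R) :
  holo_exp A B P Q ->
  holo_exp (fun l u => A l (u + c)) (fun l u => B l (u + c))
           (fun l u => P l (u + c)) (fun l u => Q l (u + c)).
Proof.
move=> [Al Bl Au Bu cP cQ B0 gr].
have shu (f f' : R -> R) (u : R) : (forall u : R, is_derive u 1 f (f' u)) ->
    is_derive u 1 (fun u => f (u + c)) (f' (u + c)).
  by move=> df; deriv; rewrite addr0 mul1r.
split => //.
- by move=> l u; exact: (shu (fun u => A l u) (fun u => - Q l u)).
- by move=> l u; exact: (shu (fun u => B l u) (fun u => P l u)).
- move=> U; have [C [C0 HC]] := gr (U + `|c|); exists C; split => // l u l0 uU.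
  apply: HC => //; apply: (le_trans (ler_normD _ _)); exact: lerD.
Qed.

(** Together with [holo_shift] this makes the class stable under one time step, which shifts the
    exponent by [i s] and adds [- s Psi_sigma]. *)
Lemma holo_addZ {R : realType} (A B P Q A' B' P' Q' : R -> R -> R) (s : R) :
  holo_exp A B P Q -> holo_exp A' B' P' Q' ->
  holo_exp (fun l u => A l u + s * A' l u) (fun l u => B l u + s * B' l u)
           (fun l u => P l u + s * P' l u) (fun l u => Q l u + s * Q' l u).
Proof.
move=> [Al Bl Au Bu cP cQ B0 gr] [Al' Bl' Au' Bu' cP' cQ' B0' gr'].
have add (f f1 : R -> R) (x d d1 : R) : is_derive x 1 f d -> is_derive x 1 f1 d1 ->
    is_derive x 1 (fun u => f u + s * f1 u) (d + s * d1).
  by move=> df df1; deriv; rewrite mul0r add0r.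
split.
- by move=> l u; exact: add.
- by move=> l u; exact: add.
- by move=> l u; rewrite opprD -mulrN; exact: add.
- by move=> l u; exact: add.
- by move=> u; apply: continuousD_fun => //; apply: continuousM_fun => // x; exact: cvg_cst.
- by move=> u; apply: continuousD_fun => //; apply: continuousM_fun => // x; exact: cvg_cst.
- by move=> u; rewrite B0 B0' mulr0 addr0.
- move=> U; have [C [C0 HC]] := gr U; have [C' [C0' HC']] := gr' U.
  exists (C + `|s| * C'); split; first by rewrite addr_ge0// mulr_ge0.
  move=> l u l0 uU; have [h1 h2] := HC l u l0 uU; have [h3 h4] := HC' l u l0 uU.
  by split; apply: (le_trans (ler_normD _ _)); rewrite mulrDl lerD// normrM -mulrA ler_wpM2l.
Qed.

Lemma decays_shift {R : realType} (A : R -> R -> R) (c : R) :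
  decays A -> decays (fun l u => A l (u + c)).
Proof.
move=> dA U; have [C HC] := dA (U + `|c|); exists C => l u l0 uU.
by apply: HC => //; apply: (le_trans (ler_normD _ _)); exact: lerD.
Qed.

(** * The characteristic exponents in the complex plane *)

Section exponents.
Context {R : realType} (nu : {measure set R -> \bar R}).
Hypothesis nu_exp : forall u : R,
  (\int[nu]_(x in `](0%R : R), +oo[) (expR (u * x) - 1 - u * x)%R%:E < +oo)%E.
Variables (a b : R).
Hypothesis a0 : 0 <= a.
Let D : set R := `](0 : R), +oo[.
Let I (f : R -> R) : R := Rintegral nu `](0 : R), +oo[ f.

(* [GLA + i GLB], [GSA + i GSB] and [SA + i SB] are [- Psi_L], [- Psi_sigma] and
   [Psi_L''] at the point [l + i u]. *)
Definition GLA (l u : R) : R := a * u - b ^+ 2 / 2 * (l * l - u * u) + I (Fre l u).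
Definition GLB (l u : R) : R := - (a * l) - b ^+ 2 * (l * u) + I (Fim l u).
Definition GSA (l u : R) : R := - a - b ^+ 2 * u + I (Gre l u).
Definition GSB (l u : R) : R := b ^+ 2 * l + I (Gim l u).
Definition SA (l u : R) : R := b ^+ 2 + I (Kre l u).
Definition SB (l u : R) : R := I (Kim l u).

Let norm_lt1 (u v : R) : `|u - v| < 1 -> `|u| <= `|v| + 1.
Proof.
move=> uv; rewrite (_ : u = v + (u - v)); last by ring.
by apply: (le_trans (ler_normD _ _)); rewrite lerD2l ltW.
Qed.

(** Taking [|v| + 1] as width of the strip gives a positive exponent even at [v = 0], and leaves
    room for a neighbourhood of radius 1 around [v]. *)
Let n1 (v : R) : 0 < `|v| + 1. Proof. by rewrite ltr_wpDl. Qed.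
Let v_le (v : R) : `|v| <= `|v| + 1. Proof. by rewrite lerDl. Qed.

Lemma integrable_Fre l u : nu.-integrable D (EFin \o Fre l u).
Proof.
apply: (integrable_sqr_expP _ nu_exp _ _ _ (n1 u) (continuous_Fre l u)) => x x0.
exact: (Fre_bound _ _ _ _ (v_le u) x0).
Qed.
Lemma integrable_Fim l u : nu.-integrable D (EFin \o Fim l u).
Proof.
apply: (integrable_sqr_expP _ nu_exp _ _ _ (n1 u) (continuous_Fim l u)) => x x0.
exact: (Fim_bound _ _ _ _ (v_le u) x0).
Qed.
Lemma integrable_Gre l u : nu.-integrable D (EFin \o Gre l u).
Proof.
apply: (integrable_sqr_expP _ nu_exp _ _ _ (n1 u) (continuous_Gre l u)) => x x0.
exact: (Gre_bound _ _ _ _ (v_le u) x0).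
Qed.
Lemma integrable_Gim l u : nu.-integrable D (EFin \o Gim l u).
Proof.
apply: (integrable_sqr_expP _ nu_exp _ _ _ (n1 u) (continuous_Gim l u)) => x x0.
exact: (Gim_bound _ _ _ _ (v_le u) x0).
Qed.

Let IN (f : R -> R) : nu.-integrable D (EFin \o f) -> I (fun x => - f x) = - I f.
Proof.
move=> intf; rewrite -mulN1r -RintegralZl//.
by apply: eq_Rintegral => x _; rewrite mulN1r.
Qed.

Let integrable_Kre l u : nu.-integrable D (EFin \o Kre l u).
Proof.
apply: (integrable_sqr_expP _ nu_exp _ _ _ (n1 u) (continuous_Kre l u)) => x x0.
exact: (Kre_bound _ _ _ _ (v_le u) x0).
Qed.
Let integrable_Kim l u : nu.-integrable D (EFin \o Kim l u).
Proof.
apply: (integrable_sqr_expP _ nu_exp _ _ _ (n1 u) (continuous_Kim l u)) => x x0.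
exact: (Kim_bound _ _ _ _ (v_le u) x0).
Qed.

Let dFre_l (l u : R) : is_derive l 1 (fun l => I (Fre l u)) (- I (Gim l u)).
Proof.
rewrite -IN; last exact: integrable_Gim.
apply: (is_derive_Rintegral _ nu_exp (fun l x => Fre l u x) (fun l x => - Gim l u x)
  (`|l| + 1) (`|u| + 1)) => //.
- by move=> s; exact: integrable_Fre.
- by move=> s x; exact: is_derive_Fre_l.
- move=> s x sl x0; rewrite normrN; apply: (le_trans (Gim_bound _ _ _ _ (v_le u) x0)).
  by rewrite ler_wpM2r ?norm_lt1// mulr_ge0 ?sqr_ge0 ?expR_ge0.
Qed.

Let dFre_u (l u : R) : is_derive u 1 (fun u => I (Fre l u)) (- I (Gre l u)).
Proof.
rewrite -IN; last exact: integrable_Gre.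
apply: (is_derive_Rintegral _ nu_exp (fun u x => Fre l u x) (fun u x => - Gre l u x)
  (`|l| + (`|u| + 1)) (`|u| + 1)) => //.
- by move=> s; exact: integrable_Fre.
- by move=> s x; exact: is_derive_Fre_u.
- move=> s x /norm_lt1 sl x0; rewrite normrN; apply: (le_trans (Gre_bound _ _ _ _ sl x0)).
  by rewrite ler_wpM2r ?lerD2l// mulr_ge0 ?sqr_ge0 ?expR_ge0.
Qed.

Let dFim_l (l u : R) : is_derive l 1 (fun l => I (Fim l u)) (I (Gre l u)).
Proof.
apply: (is_derive_Rintegral _ nu_exp (fun l x => Fim l u x) (fun l x => Gre l u x)
  (`|l| + 1 + `|u|) (`|u| + 1)) => //.
- by move=> s; exact: integrable_Fim.
- by move=> s x; exact: is_derive_Fim_l.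
- move=> s x sl x0; apply: (le_trans (Gre_bound _ _ _ _ (v_le u) x0)).
  by rewrite ler_wpM2r ?lerD2r ?norm_lt1// mulr_ge0 ?sqr_ge0 ?expR_ge0.
Qed.

Let dFim_u (l u : R) : is_derive u 1 (fun u => I (Fim l u)) (- I (Gim l u)).
Proof.
rewrite -IN; last exact: integrable_Gim.
apply: (is_derive_Rintegral _ nu_exp (fun u x => Fim l u x) (fun u x => - Gim l u x)
  `|l| (`|u| + 1)) => //.
- by move=> s; exact: integrable_Fim.
- by move=> s x; exact: is_derive_Fim_u.
- move=> s x /norm_lt1 sl x0; rewrite normrN; exact: (Gim_bound _ _ _ _ sl x0).
Qed.

Let dGre_l (l u : R) : is_derive l 1 (fun l => I (Gre l u)) (- I (Kim l u)).
Proof.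
rewrite -IN; last exact: integrable_Kim.
apply: (is_derive_Rintegral _ nu_exp (fun l x => Gre l u x) (fun l x => - Kim l u x)
  1 (`|u| + 1)) => //.
- by move=> s; exact: integrable_Gre.
- by move=> s x; exact: is_derive_Gre_l.
- move=> s x _ x0; rewrite normrN; exact: (Kim_bound _ _ _ _ (v_le u) x0).
Qed.

Let dGre_u (l u : R) : is_derive u 1 (fun u => I (Gre l u)) (- I (Kre l u)).
Proof.
rewrite -IN; last exact: integrable_Kre.
apply: (is_derive_Rintegral _ nu_exp (fun u x => Gre l u x) (fun u x => - Kre l u x)
  1 (`|u| + 1)) => //.
- by move=> s; exact: integrable_Gre.
- by move=> s x; exact: is_derive_Gre_u.
- move=> s x /norm_lt1 sl x0; rewrite normrN; exact: (Kre_bound _ _ _ _ sl x0).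
Qed.

Let dGim_l (l u : R) : is_derive l 1 (fun l => I (Gim l u)) (I (Kre l u)).
Proof.
apply: (is_derive_Rintegral _ nu_exp (fun l x => Gim l u x) (fun l x => Kre l u x)
  1 (`|u| + 1)) => //.
- by move=> s; exact: integrable_Gim.
- by move=> s x; exact: is_derive_Gim_l.
- move=> s x _ x0; exact: (Kre_bound _ _ _ _ (v_le u) x0).
Qed.

Let dGim_u (l u : R) : is_derive u 1 (fun u => I (Gim l u)) (- I (Kim l u)).
Proof.
rewrite -IN; last exact: integrable_Kim.
apply: (is_derive_Rintegral _ nu_exp (fun u x => Gim l u x) (fun u x => - Kim l u x)
  1 (`|u| + 1)) => //.
- by move=> s; exact: integrable_Gim.
- by move=> s x; exact: is_derive_Gim_u.
- move=> s x /norm_lt1 sl x0; rewrite normrN; exact: (Kim_bound _ _ _ _ sl x0).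
Qed.

Let int0 (f : R -> R) : (forall x, f x = 0) -> I f = 0.
Proof.
move=> f0; have -> : f = fun=> 0 by apply/funext.
by rewrite /I /Rintegral integral0.
Qed.

(** Since [|x^2 e^{i z x}| = x^2 e^{-ux}] does not depend on [l], the second derivative of [Psi_L]
    is bounded on every horizontal strip. This is the source of the quadratic error of a time
    step. *)
Lemma S_bound (U : R) : exists C : R, 0 <= C /\ forall l u : R, `|u| <= U ->
  `|SA l u| <= C /\ `|SB l u| <= C.
Proof.
pose W := 1 * I (sqr_exp (`|U| + 1)).
have HW (f : R -> R -> R -> R) (l u : R) : (forall l u, continuous (f l u)) ->
    (forall l u U x : R, `|u| <= U -> 0 < x -> `|f l u x| <= 1 * sqr_exp U x) ->
    `|u| <= U -> `|I (f l u)| <= W.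
  move=> cf fb uU.
  apply: (Rintegral_sqr_exp_bound _ nu_exp _ _ _ (n1 U) (cf l u)) => x x0.
  apply: fb => //; apply: (le_trans uU); apply: (le_trans (ler_norm _)); exact: v_le.
exists (b ^+ 2 + `|W|); split; first by rewrite addr_ge0 ?sqr_ge0.
move=> l u uU; have hA := HW _ l u continuous_Kre Kre_bound uU.
have hB := HW _ l u continuous_Kim Kim_bound uU.
have b20 := sqr_ge0 b; have WW := ler_norm W; split.
  apply: (le_trans (ler_normD _ _)); rewrite (ger0_norm b20) lerD2l.
  exact: (le_trans hA).
by apply: (le_trans hB); apply: (le_trans WW); rewrite lerDr.
Qed.

(** The derivative of [- Psi_sigma] is [i Psi_L'']; being bounded on strips, it grows at most
    linearly. *)
Lemma holo_GS : holo_exp GSA GSB (fun l u => - SB l u) SA.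
Proof.
split.
- move=> l u; rewrite /GSA; deriv; first exact: dGre_l.
  by rewrite /SB; ring.
- move=> l u; rewrite /GSB; deriv; first exact: dGim_l.
  by rewrite /SA; ring.
- move=> l u; rewrite /GSA; deriv; first exact: dGre_u.
  by rewrite /SA; ring.
- move=> l u; rewrite /GSB; deriv; first exact: dGim_u.
  by rewrite /SB; ring.
- move=> u; apply: continuousN_fun.
  apply: (continuous_Rintegral _ nu_exp (fun l => Kim l u) 1 (`|u| + 1)) => //.
  + by move=> s; exact: continuous_Kim.
  + by move=> x; rewrite /Kim; dcont.
  + by move=> l x x0; exact: (Kim_bound _ _ _ _ (v_le u) x0).
- move=> u; apply: continuousD_fun; first by move=> x; exact: cvg_cst.
  apply: (continuous_Rintegral _ nu_exp (fun l => Kre l u) 1 (`|u| + 1)) => //.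
  + by move=> s; exact: continuous_Kre.
  + by move=> x; rewrite /Kre; dcont.
  + by move=> l x x0; exact: (Kre_bound _ _ _ _ (v_le u) x0).
- move=> u; rewrite /GSB mulr0 add0r int0// => x.
  by rewrite /Gim mul0r sin0 mulr0 mul0r.
- move=> U; have [C [C0 HC]] := S_bound U; exists C; split => // l u l0 uU.
  have [hA hB] := HC l u uU; rewrite normrN; have hC : C <= C * (1 + l).
    by rewrite ler_peMr// lerDl.
  by split; exact: le_trans hC.
Qed.

(** This is where [Psi_sigma = - i Psi_L'] enters: the derivative of [- Psi_L] is [i] times
    [- Psi_sigma]. The linear growth comes from [|e^{i z x} - 1| <= |z| x e^{U x}], in the form of
    the kernel bounds for [G]. *)
Lemma holo_GL : holo_exp GLA GLB (fun l u => - GSB l u) GSA.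
Proof.
split.
- move=> l u; rewrite /GLA; deriv; first exact: dFre_l.
  by rewrite /GSB; field.
- move=> l u; rewrite /GLB; deriv; first exact: dFim_l.
  by rewrite /GSA; ring.
- move=> l u; rewrite /GLA; deriv; first exact: dFre_u.
  by rewrite /GSA; field.
- move=> l u; rewrite /GLB; deriv; first exact: dFim_u.
  by rewrite /GSB; ring.
- move=> u; apply: continuousN_fun.
  exact: (@is_derive_continuous _ _ (fun l => SA l u) (fun l => holo_Bl _ _ _ _ holo_GS l u)).
- move=> u.
  exact: (@is_derive_continuous _ _ (fun l => - SB l u) (fun l => holo_Al _ _ _ _ holo_GS l u)).
- move=> u; rewrite /GLB int0 => [|x]; first by ring.
  by rewrite /Fim mul0r sin0 mulr0 subr0.
- move=> U; pose W : R := `|I (sqr_exp (`|U| + 1))|.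
  have W0 : 0 <= W by exact: normr_ge0.
  have WW : I (sqr_exp (`|U| + 1)) <= W by exact: ler_norm.
  clearbody W.
  have b20 := sqr_ge0 b.
  exists (a + b ^+ 2 + b ^+ 2 * `|U| + W + `|U| * W); split.
    by rewrite !addr_ge0// mulr_ge0.
  move=> l u l0 uU.
  have uU1 : `|u| <= `|U| + 1.
    by apply: (le_trans uU); apply: (le_trans (ler_norm _)); exact: v_le.
  have uU' : `|u| <= `|U| by apply: (le_trans uU); exact: ler_norm.
  have hi : `|I (Gim l u)| <= `|l| * I (sqr_exp (`|U| + 1)).
    apply: (Rintegral_sqr_exp_bound _ nu_exp _ _ _ (n1 U) (continuous_Gim l u)) => x x0.
    exact: (Gim_bound _ _ _ _ uU1 x0).
  have hr : `|I (Gre l u)| <= (`|l| + `|u|) * I (sqr_exp (`|U| + 1)).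
    apply: (Rintegral_sqr_exp_bound _ nu_exp _ _ _ (n1 U) (continuous_Gre l u)) => x x0.
    exact: (Gre_bound _ _ _ _ uU1 x0).
  rewrite (ger0_norm l0) in hi hr.
  have hi' : `|I (Gim l u)| <= l * W by apply: (le_trans hi); rewrite ler_wpM2l.
  have hr' : `|I (Gre l u)| <= (l + `|U|) * W.
    apply: (le_trans hr); apply: (@le_trans _ _ ((l + `|u|) * W)).
      by rewrite ler_wpM2l// addr_ge0.
    by rewrite ler_wpM2r// lerD2l.
  have U0 : 0 <= `|U| by [].
  have bU : 0 <= b ^+ 2 * `|U| by rewrite mulr_ge0.
  have UW : 0 <= `|U| * W by rewrite mulr_ge0.
  rewrite normrN /GSB /GSA; split.
    apply: (le_trans (ler_normD _ _)); rewrite normrM (ger0_norm b20) (ger0_norm l0).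
    rewrite mulrDr mulr1; apply: (@le_trans _ _ (b ^+ 2 * l + l * W)).
      by rewrite lerD2l.
    rewrite -[leLHS]add0r; apply: lerD; first by rewrite !addr_ge0.
    rewrite (mulrC l) -mulrDl ler_wpM2r// -subr_ge0.
    rewrite (_ : _ - _ = a + b ^+ 2 * `|U| + `|U| * W); last by ring.
    by rewrite !addr_ge0.
  apply: (le_trans (ler_normD _ _)); rewrite -opprD normrN.
  apply: (@le_trans _ _ (a + b ^+ 2 * `|U| + (l + `|U|) * W)).
    apply: lerD hr'; apply: (le_trans (ler_normD _ _)); rewrite (ger0_norm a0) lerD2l.
    by rewrite normrM (ger0_norm b20) ler_wpM2l.
  rewrite -subr_ge0 (_ : _ - _ = b ^+ 2 + W + (a + b ^+ 2 + b ^+ 2 * `|U| + `|U| * W) * l).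
    by rewrite !addr_ge0// mulr_ge0// !addr_ge0.
  by ring.
Qed.

(** Only an upper bound that is uniform in [l] is wanted: it lets [decays] survive the addition of a
    nonnegative multiple of [GSA]. *)
Lemma GSA_le (U : R) : exists C : R, forall l u : R, `|u| <= U -> GSA l u <= C.
Proof.
exists (- a + b ^+ 2 * `|U| + `|U| * I (sqr_exp (`|U| + 1))) => l u uU.
have uU1 : `|u| <= `|U| + 1.
  by apply: (le_trans uU); apply: (le_trans (ler_norm _)); exact: v_le.
have uU' : `|u| <= `|U| by apply: (le_trans uU); exact: ler_norm.
rewrite /GSA; apply: lerD.
  rewrite lerD2l -mulrN ler_wpM2l ?sqr_ge0//.
  by apply: le_trans uU'; rewrite -normrN ler_norm.
have <- : I (fun x => `|U| * sqr_exp (`|U| + 1) x) = `|U| * I (sqr_exp (`|U| + 1)).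
  by rewrite /I RintegralZl//; exact: (integrable_sqr_exp _ nu_exp _ (n1 U)).
apply: le_Rintegral => //.
- exact: integrable_Gre.
- exact: (integrableZl (measurable_itv _) `|U| (integrable_sqr_exp _ nu_exp _ (n1 U))).
move=> x; rewrite /= in_itv/= andbT => x0; rewrite /Gre /sqr_exp.
rewrite (_ : `|U| * (x ^+ 2 * _) = `|U| * x * expR ((`|U| + 1) * x) * x); last by ring.
rewrite ler_wpM2r ?(ltW x0)//.
(* Here [cos (l x) <= 1] removes the dependence on [l]. *)
apply: (@le_trans _ _ (expR (- (u * x)) - 1)).
  by rewrite lerD2r -[leRHS]mulr1 ler_wpM2l ?expR_ge0 ?cos_le1.
apply: (le_trans (ler_norm _)); apply: (le_trans (norm_expRN_le _ _ _ uU1 x0)).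
by rewrite ler_wpM2r ?expR_ge0// ler_wpM2r// ltW.
Qed.

Lemma decays_addGS (A : R -> R -> R) (s : R) : 0 <= s -> decays A ->
  decays (fun l u => A l u + s * GSA l u).
Proof.
move=> s0 dA U; have [C HC] := dA U; have [K HK] := GSA_le U.
exists (C + s * K) => l u l0 uU; rewrite addrAC lerD ?HC//.
by rewrite ler_wpM2l// HK.
Qed.

Lemma PsiL_reE l : PsiL_re b nu l = - GLA l 0.
Proof.
rewrite /PsiL_re /GLA (_ : I (Fre l 0) = Rintegral nu `]0, +oo[ (fun x => cos (l * x) - 1)).
  by field.
by apply: eq_Rintegral => x _; rewrite /Fre mul0r oppr0 expR0; ring.
Qed.

Lemma PsiL_imE l : PsiL_im a nu l = - GLB l 0.
Proof.
rewrite /PsiL_im /GLB (_ : I (Fim l 0) = Rintegral nu `]0, +oo[ (fun x => sin (l * x) - l * x)).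
  by ring.
by apply: eq_Rintegral => x _; rewrite /Fim mul0r oppr0 expR0; ring.
Qed.

Lemma Psis_reE l : Psis_re a nu l = - GSA l 0.
Proof.
rewrite /Psis_re /GSA (_ : I (Gre l 0) = Rintegral nu `]0, +oo[ (fun x => (cos (l * x) - 1) * x)).
  by ring.
by apply: eq_Rintegral => x _; rewrite /Gre mul0r oppr0 expR0; ring.
Qed.

Lemma Psis_imE l : Psis_im b nu l = - GSB l 0.
Proof.
rewrite /Psis_im /GSB (_ : I (Gim l 0) = Rintegral nu `]0, +oo[ (fun x => sin (l * x) * x)).
  by ring.
by apply: eq_Rintegral => x _; rewrite /Gim mul0r oppr0 expR0; ring.
Qed.

(* The jumps of size at most [1] dominate: there [e^{-ux} >= e^{-U}], and the
   others contribute a bounded amount. *)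
Lemma GLA_le (U : R) : exists C : R, forall l u : R, `|u| <= U ->
  GLA l u <= C - expR (- U) * PsiL_re b nu l.
Proof.
pose w := sqr_exp (`|U| + 1).
have iw : nu.-integrable D (EFin \o w) by exact: (integrable_sqr_exp _ nu_exp _ (n1 U)).
exists (a * `|U| + b ^+ 2 / 2 * `|U| ^+ 2 + (`|U| ^+ 2 + 2) * I w) => l u uU.
have U0 : 0 <= U by exact: le_trans uU.
have eU : expR (- U) <= 1 by rewrite expR_le1 oppr_le0.
have eU0 := expR_ge0 (- U).
have icos : nu.-integrable D (EFin \o (fun x => cos (l * x) - 1)).
  apply: eq_integrable (integrable_Fre l 0); [exact: measurable_itv|move=> x _ /=].
  by rewrite /Fre mul0r oppr0 expR0; congr EFin; ring.
have key : I (Fre l u) <= expR (- U) * I (fun x => cos (l * x) - 1) + (`|U| ^+ 2 + 2) * I w.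
  have e1 : I (fun x => expR (- U) * (cos (l * x) - 1)) = expR (- U) * I (fun x => cos (l * x) - 1).
    by rewrite /I RintegralZl.
  have e2 : I (fun x => (`|U| ^+ 2 + 2) * w x) = (`|U| ^+ 2 + 2) * I w by rewrite /I RintegralZl.
  have i1 : nu.-integrable D (EFin \o (fun x => expR (- U) * (cos (l * x) - 1))).
    exact: (integrableZl (measurable_itv _) (expR (- U)) icos).
  have i2 : nu.-integrable D (EFin \o (fun x => (`|U| ^+ 2 + 2) * w x)).
    exact: (integrableZl (measurable_itv _) (`|U| ^+ 2 + 2) iw).
  rewrite -e1 -e2 /I -RintegralD//; apply: le_Rintegral => //.
  - exact: integrable_Fre.
  - have mD : measurable D by exact: measurable_itv.
    exact: (integrableD mD i1 i2).
  move=> x; rewrite /= in_itv/= andbT => x0; rewrite /Fre.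
  rewrite (_ : _ + u * x = expR (- (u * x)) * (cos (l * x) - 1) +
    (expR (- (u * x)) - 1 - (- (u * x)))); last by ring.
  have uU1 : `|u| <= `|U| + 1.
    by apply: (le_trans uU); apply: (le_trans (ler_norm _)); exact: v_le.
  have uU' : `|u| <= `|U| by apply: (le_trans uU); exact: ler_norm.
  have h1 : expR (- (u * x)) - 1 - (- (u * x)) <= `|U| ^+ 2 * w x.
    apply: (le_trans (ler_norm _)); apply: (le_trans (expRB1D_le _ _)).
    rewrite /w /sqr_exp sqrrN exprMn -mulrA ler_pM ?sqr_ge0//.
    - by rewrite mulr_ge0 ?sqr_ge0 ?expR_ge0.
    - by rewrite -(real_normK (num_real u)) ler_sqr.
    rewrite ler_wpM2l ?sqr_ge0// ler_expR normrN normrM (gtr0_norm x0).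
    by rewrite ler_wpM2r// ltW.
  have h2 : expR (- (u * x)) * (cos (l * x) - 1) <=
            expR (- U) * (cos (l * x) - 1) + 2 * w x.
    have c1 := cos_le1 (l * x); have c2 := cos_geN1 (l * x).
    have w0 : 0 <= w x by rewrite /w/sqr_exp mulr_ge0 ?sqr_ge0 ?expR_ge0.
    have [x1|x1] := leP x 1.
      have : expR (- U) <= expR (- (u * x)).
        rewrite ler_expR lerN2; apply: (@le_trans _ _ (`|u| * x)).
          by rewrite ler_wpM2r ?ler_norm// ltW.
        by apply: le_trans uU; rewrite ler_piMr.
      move: (expR (- (u * x))) (expR (- U)) => e e'; nra.
    (* For [x > 1] the left side is nonpositive, and the right side is at least
       [- 2 e^{-U} + 2 >= 0]. *)
    have w1 : 1 <= w x.
      rewrite /w/sqr_exp -[leLHS]mulr1 ler_pM//.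
        by rewrite expr_ge1// ltW.
      by rewrite -expR0 ler_expR mulr_ge0 ?ltW.
    have e0 := expR_ge0 (- (u * x)).
    move: (expR (- (u * x))) e0 (expR (- U)) eU eU0 => e e0 e' e1' e0'; nra.
  lra.
rewrite /GLA /PsiL_re.
apply: (le_trans (lerD (lexx _) key)).
have h1 : a * u <= a * `|U|.
  by rewrite ler_wpM2l//; apply: (le_trans (ler_norm _)); apply: (le_trans uU); exact: ler_norm.
have h2 : u * u <= `|U| ^+ 2.
  rewrite -expr2 -(real_normK (num_real u)) ler_sqr//.
  by apply: (le_trans uU); exact: ler_norm.
have b20 : 0 <= b ^+ 2 / 2 by rewrite divr_ge0// sqr_ge0.
have h3 : b ^+ 2 / 2 * (u * u) <= b ^+ 2 / 2 * `|U| ^+ 2 by rewrite ler_wpM2l.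
have h4 : expR (- U) * (b ^+ 2 * l ^+ 2 / 2) <= b ^+ 2 / 2 * (l * l).
  rewrite (_ : b ^+ 2 * l ^+ 2 / 2 = b ^+ 2 / 2 * (l * l)); last by rewrite expr2; field.
  by rewrite ler_piMl// mulr_ge0// -expr2 sqr_ge0.
rewrite -/(I (fun x => cos (l * x) - 1)).
move: (I (fun x => _)) (I w) (expR (- U)) h1 h3 h4 => J J' e h1 h3 h4.
by lra.
Qed.

Lemma decays_GL : (forall M : R, exists K : R, forall l : R,
     K < `|l| -> M < PsiL_re b nu l / `|l|) -> decays GLA.
Proof.
(* The factor [e^U] makes up for the [e^{-U}] lost in [GLA_le]; what remains is the slope 2 required
   by [decays]. *)
move=> hre U; have [C HC] := GLA_le U; have [K HK] := hre (2 * expR U).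
have e1 : expR (- U) * expR U = 1 by rewrite mulrC expRxMexpNx_1.
have eU := expR_gt0 (- U).
exists (C + 2 * `|K|) => l u l0 uU; apply: (le_trans (HC l u uU)).
suff : 2 * l - 2 * `|K| <= expR (- U) * PsiL_re b nu l by lra.
have K0 : 0 <= `|K| by [].
(* Below the threshold [PsiL_re >= 0] is enough, the additive constant [2 |K|] absorbing [2 l]. *)
have [lK|Kl] := leP l `|K|.
  apply: (@le_trans _ _ 0); first by lra.
  rewrite mulr_ge0 ?expR_ge0// /PsiL_re subr_ge0; apply: (@le_trans _ _ 0).
    rewrite -oppr_ge0 -IN.
      by apply: Rintegral_ge0 => x _; have := cos_le1 (l * x); lra.
    apply: eq_integrable (integrable_Fre l 0); [exact: measurable_itv|move=> x _ /=].
    by rewrite /Fre mul0r oppr0 expR0; congr EFin; ring.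
  by rewrite divr_ge0// mulr_ge0// sqr_ge0.
have lpos : 0 < l by exact: le_lt_trans Kl.
have : K < `|l| by rewrite (ger0_norm l0); apply: le_lt_trans Kl; exact: ler_norm.
move=> /HK; rewrite (ger0_norm l0) ltr_pdivlMr// => h.
have : expR (- U) * (2 * expR U * l) < expR (- U) * PsiL_re b nu l by rewrite ltr_pM2l.
rewrite (_ : expR (- U) * (2 * expR U * l) = expR (- U) * expR U * (2 * l)); last by ring.
rewrite e1; lra.
Qed.

(** A second-order Taylor estimate in the imaginary direction, where the derivative of [- Psi_L] is
    [Psi_sigma] and the second derivative is bounded by [S_bound]. Two mean value estimates give
    [C s^2]. *)
Lemma GL_increment (U : R) : exists C : R, 0 <= C /\ forall l u s : R, 0 <= u -> 0 <= s ->
  u + s <= U ->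
  `|GLA l (u + s) - GLA l u + s * GSA l u| <= C * s ^+ 2 /\ `|GLB l (u + s) - GLB l u + s * GSB l u| <= C * s ^+ 2.
Proof.
have [C [C0 HC]] := S_bound U; exists C; split => // l u s u0 s0 usU.
have main (F G S : R -> R) : (forall v : R, is_derive v 1 F (- G v)) ->
    (forall v : R, is_derive v 1 G (S v)) -> (forall v, `|v| <= U -> `|S v| <= C) ->
    `|F (u + s) - F u + s * G u| <= C * s ^+ 2.
  move=> dF dG bS.
  have dH (v : R) : is_derive v 1 (fun v => F v + v * G u) (- G v + G u).
    by deriv; ring.
  have us : u <= u + s by rewrite lerDl.
  have /= := deriv1_bound _ _ _ (C * s) _ _ us dH.
  rewrite [u + s - u]addrAC subrr add0r -mulrA -expr2.
  rewrite (_ : F (u + s) + _ - _ = F (u + s) - F u + s * G u); last by ring.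
  apply => v /andP[uv vus].
  rewrite addrC -normrN opprB.
  apply: (@le_trans _ _ (C * (v - u))); last by rewrite ler_wpM2l//; lra.
  apply: (deriv1_bound _ _ _ _ _ _ uv dG) => z /andP[uz zv].
  by apply: bS; rewrite ger0_norm; lra.
split.
  apply: (main (GLA l) (GSA l) (fun u => - SA l u)).
  - exact: (holo_Au _ _ _ _ holo_GL l).
  - exact: (holo_Au _ _ _ _ holo_GS l).
  - by move=> v vU; rewrite normrN; have [] := HC l v vU.
apply: (main (GLB l) (GSB l) (fun u => - SB l u)).
- exact: (holo_Bu _ _ _ _ holo_GL l).
- exact: (holo_Bu _ _ _ _ holo_GS l).
- by move=> v vU; rewrite normrN; have [] := HC l v vU.
Qed.

End exponents.

(** * Half-line Fourier integrals *)

Section half_line.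
Context {R : realType}.
Notation mu := (@lebesgue_measure R).
Let H : set R := `[(0 : R), +oo[.
Let mH : measurable (H : set (measurableTypeR R)). Proof. exact: measurable_itv. Qed.

Lemma cvgy_expRN (c : R) : 0 < c -> expR (- (c * x)) @[x --> +oo] --> (0 : R).
Proof.
move=> c0; apply: (cvg_comp (fun x : R => c * x) (fun x => expR (- x))).
  2: exact: cvgr_expR.
by apply: (gt0_cvgMry c0); exact: cvg_id.
Qed.

Lemma cvg_expRNn (c : R) : 0 < c -> (fun n : nat => expR (- (c * n%:R))) @ \oo --> (0 : R).
Proof. by move=> c0; exact: (cvg_comp _ _ cvgr_idn (cvgy_expRN _ c0)). Qed.

Lemma integrable_expRN (c : R) : 0 < c -> mu.-integrable H (EFin \o (fun l : R => expR (- (c * l)))).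
Proof.
move=> c0; apply/integrableP; split.
  apply/measurable_EFinP; apply: measurable_continuous; dcont.
under eq_integral do rewrite [(_ \o _) _]/= abse_EFin (ger0_norm (expR_ge0 _)).
have dF (x : R) : is_derive x 1 (fun l => - c^-1 * expR (- (c * l))) (expR (- (c * x))).
  by deriv; field; rewrite gt_eqF.
have cF := is_derive_continuous _ _ _ dF.
rewrite (@ge0_continuous_FTC2y R (fun l => expR (- (c * l)))
  (fun l => - c^-1 * expR (- (c * l))) 0 0) ?ltry//.
- by apply: continuous_subspaceT; dcont.
- rewrite -[X in _ --> X](mulr0 (- c^-1)); apply: cvgM; first exact: cvg_cst.
  exact: cvgy_expRN.
- apply: cvg_at_right_filter; exact: cF.
- by move=> x _; rewrite derive1E; have [_ ->] := dF x.
Qed.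

Lemma FTC_half_line (F f : R -> R) : (forall x : R, is_derive x 1 F (f x)) ->
  continuous f -> mu.-integrable H (EFin \o f) ->
  (fun n : nat => F n%:R) @ \oo --> 0 ->
  Rintegral mu H f = - F 0.
Proof.
move=> dF cf intf F0.
have cF := is_derive_continuous _ _ _ dF.
(* The interval ends at [n.+1] so that it is never degenerate, as the fundamental theorem
   requires. *)
have FTC n : (\int[mu]_(x in `[0%R : R, n.+1%:R%R]) (f x)%:E = (F n.+1%:R - F 0)%R%:E)%E.
  rewrite (@continuous_FTC2 R f F)//.
  - by apply: continuous_subspaceT.
  - split.
    + by move=> x _; have [] := dF x.
    + by apply: cvg_at_right_filter; exact: cF.
    + by apply: cvg_at_left_filter; exact: cF.
  - by move=> x _; rewrite derive1E; have [_ ->] := dF x.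
pose g n := ((EFin \o f) \_ (`[(0:R), n.+1%:R]%classic)) : R -> \bar R.
have gE n : (\int[mu]_(x in H) g n x = (F n.+1%:R - F 0)%R%:E)%E.
  rewrite -FTC /g -integral_mkcondr; congr (integral mu _ _).
  by rewrite setIidr// => x; rewrite /H/= !in_itv/= andbT => /andP[].
have cv : (fun n => \int[mu]_(x in H) g n x)%E @ \oo --> (\int[mu]_(x in H) (f x)%:E)%E.
  apply: (@dominated_cvg _ _ _ mu H mH g (EFin \o f) (fun x => `|f x|%:E)).
  - move=> n; apply: measurable_funTS; apply/measurable_restrict => //.
    apply: measurableT_comp => //; exact: measurable_continuous.
  - move=> x; rewrite /H /= in_itv/= andbT => x0.
    apply: cvg_near_cst; near=> n.
    rewrite /g patchE mem_set//= in_itv/= x0/=.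
    apply: (@le_trans _ _ n%:R); last by rewrite ler_nat.
    near: n; exact: nbhs_infty_ger.
  - by [].
  - exact: integrable_norm.
  - move=> n x _; rewrite /g patchE; case: ifP => _ /=; by rewrite ?normr0 ?abse0 ?lee_fin//.
have cv2 : (fun n : nat => (F n.+1%:R - F 0)%:E) @ \oo --> (- F 0)%:E.
  apply: cvg_EFin; first by near=> n.
  rewrite -[X in _ --> X]add0r; apply: cvgB; last exact: cvg_cst.
  by move: F0; rewrite -cvg_shiftS.
have eqg : (fun n => \int[mu]_(x in H) g n x)%E = (fun n : nat => (F n.+1%:R - F 0)%:E).
  exact/funext.
rewrite eqg in cv; rewrite /Rintegral.
by have -> := cvg_unique (@ereal_hausdorff R) cv cv2.
Unshelve. all: end_near. Qed.

Lemma integrable_expRN_le (f : R -> R) (C c : R) : 0 < c -> continuous f ->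
  (forall l, 0 <= l -> `|f l| <= C * expR (- (c * l))) ->
  mu.-integrable H (EFin \o f).
Proof.
move=> c0 cf fC.
have /= := integrableZl mH C (integrable_expRN _ c0).
apply: le_integrable => //.
  by apply/measurable_EFinP; exact: measurable_continuous.
move=> x; rewrite /H/= in_itv/= andbT => x0.
rewrite lee_fin; apply: (le_trans (fC _ x0)).
exact: ler_norm.
Qed.

Lemma Rintegral_expRN_le (f : R -> R) (C c : R) : 0 < c -> continuous f ->
  (forall l, 0 <= l -> `|f l| <= C * expR (- (c * l))) ->
  `|Rintegral mu H f| <= C * Rintegral mu H (fun l => expR (- (c * l))).
Proof.
move=> c0 cf fC.
have intf := integrable_expRN_le _ _ _ c0 cf fC.
have intW := integrable_expRN _ c0.
apply: (le_trans (le_normr_Rintegral mH intf)).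
have <- : Rintegral mu H (fun l => C * expR (- (c * l))) =
          C * Rintegral mu H (fun l => expR (- (c * l))).
  by rewrite RintegralZl.
apply: le_Rintegral => //.
- exact: integrable_norm.
- by have /= := integrableZl mH C intW.
- by move=> x; rewrite /H/= in_itv/= andbT => /fC.
Qed.

Lemma cvg0_expRN_le (F : R -> R) (C c : R) : 0 < c ->
  (forall l, 0 <= l -> `|F l| <= C * expR (- (c * l))) ->
  (fun n : nat => F n%:R) @ \oo --> 0.
Proof.
move=> c0 FC; apply: norm_cvg0.
apply: (@squeeze_cvgr _ _ _ _ (fun=> 0) (fun n : nat => C * expR (- (c * n%:R)))).
- by near=> n; rewrite normr_ge0/= FC.
- exact: cvg_cst.
- by rewrite -[X in _ --> X](mulr0 C); apply: cvgM; [exact: cvg_cst|exact: cvg_expRNn].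
Unshelve. all: end_near. Qed.

(** The damped cosine integrates to a Cauchy kernel, the positive approximate identity used for
    Fourier inversion. *)
Lemma Rintegral_cauchy_kernel (c y : R) : 0 < c ->
  Rintegral mu H (fun l => expR (- (c * l)) * cos (l * y)) = c / (c ^+ 2 + y ^+ 2).
Proof.
move=> c0; pose k := (c ^+ 2 + y ^+ 2)^-1.
have k0 : c ^+ 2 + y ^+ 2 != 0 by rewrite gt_eqF// ltr_wpDr ?sqr_ge0// exprn_gt0.
(* The real part of [e^{(-c + i y) l} / (-c + i y)]. *)
pose F l := expR (- (c * l)) * (y * sin (l * y) - c * cos (l * y)) * k.
have dF (x : R) : is_derive x 1 F (expR (- (c * x)) * cos (x * y)).
  rewrite /F; deriv; rewrite /k; field; exact: k0.
rewrite (FTC_half_line F _ dF).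
- by rewrite /F !mul0r mulr0 sin0 cos0 oppr0 expR0 -/k; ring.
- by dcont.
- apply: (integrable_expRN_le _ 1 _ c0); first by dcont.
  move=> l _; rewrite mul1r normrM ger0_norm ?expR_ge0//.
  by rewrite ler_piMr ?expR_ge0// cos_max.
- apply: (cvg0_expRN_le _ ((`|y| + c) * `|k|) _ c0) => l _; rewrite /F.
  rewrite 2!normrM (ger0_norm (expR_ge0 _)) [leRHS]mulrC -mulrA ler_wpM2l ?expR_ge0//.
  rewrite ler_wpM2r//; apply: (le_trans (ler_normB _ _)).
  rewrite !normrM (gtr0_norm c0); apply: lerD.
    by rewrite ler_piMr ?sin_max.
  by rewrite ler_piMr ?cos_max// ltW.
Qed.

Lemma exp_cos_decay (A B P Q : R -> R -> R) (U : R) : holo_exp A B P Q -> decays A ->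
  exists C, 0 <= C /\ forall l u, 0 <= l -> `|u| <= U ->
    expR (A l u) <= C * expR (- (2 * l)) /\
    expR (A l u) * (`|P l u| + `|Q l u|) <= C * expR (- (1 * l)).
Proof.
move=> hol dA; have [C HC] := dA U; have [K [K0 HK]] := holo_growth _ _ _ _ hol U.
exists (expR C + expR C * (2 * K)); split.
  by rewrite addr_ge0 ?mulr_ge0 ?expR_ge0.
move=> l u l0 uU.
have e1 : expR (A l u) <= expR C * expR (- (2 * l)).
  by rewrite -expRD ler_expR HC.
have e2 : 0 <= expR C * (2 * K) * expR (- (2 * l)) by rewrite !mulr_ge0 ?expR_ge0.
split; first by rewrite mulrDl; lra.
have [h1 h2] := HK l u l0 uU.
(* The linear growth of the derivative is paid with half of the decay rate, by [1 + l <= e^l]. *)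
have e3 : expR (- (2 * l)) * (1 + l) <= expR (- (1 * l)).
  rewrite (_ : - (1 * l) = - (2 * l) + l); last by ring.
  by rewrite expRD ler_wpM2l ?expR_ge0 ?expR_ge1Dx.
apply: (@le_trans _ _ (expR C * expR (- (2 * l)) * (2 * K * (1 + l)))).
  by apply: ler_pM; rewrite ?expR_ge0 ?addr_ge0//; lra.
rewrite (_ : _ * _ = expR C * (2 * K) * (expR (- (2 * l)) * (1 + l))); last by ring.
apply: (@le_trans _ _ (expR C * (2 * K) * expR (- (1 * l)))).
  by rewrite ler_wpM2l// !mulr_ge0 ?expR_ge0.
by rewrite ler_wpM2r ?expR_ge0// lerDr expR_ge0.
Qed.

Definition Jfour (A B : R -> R -> R) (u : R) : R :=
  Rintegral mu H (fun l => expR (A l u) * cos (B l u)).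

Lemma continuous_holo (A B P Q : R -> R -> R) (u : R) : holo_exp A B P Q ->
  continuous (fun l => A l u) /\ continuous (fun l => B l u).
Proof.
move=> [Al Bl _ _ _ _ _ _]; split.
  exact: (@is_derive_continuous _ _ (fun l => P l u) (fun l => Al l u)).
exact: (@is_derive_continuous _ _ (fun l => Q l u) (fun l => Bl l u)).
Qed.

Lemma continuous_expcos (f g : R -> R) : continuous f -> continuous g ->
  continuous (fun l => expR (f l) * cos (g l)).
Proof.
move=> cf cg; apply: continuousM_fun => x.
  by apply: (continuous_comp (g := expR)); [exact: cf|exact: continuous_expR].
by apply: (continuous_comp (g := cos)); [exact: cg|exact: continuous_cos].
Qed.

(* The Cauchy-Riemann equations turn the [u]-derivative of [e^A cos B] into
   [- d/dl (e^A sin B)], whose integral is the boundary value [e^A sin B = 0] at [l = 0]. *)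
Lemma Jfour_cst (A B P Q : R -> R -> R) (u v : R) : holo_exp A B P Q -> decays A ->
  Jfour A B u = Jfour A B v.
Proof.
move=> hol dA; apply: is_derive_0_is_cst => {u v} u0.
pose f u l := expR (A l u) * cos (B l u).
have [C [C0 HC]] := exp_cos_decay _ _ _ _ (`|u0| + 1) hol dA.
have df (u l : R) : is_derive u 1 (f ^~ l)
    (expR (A l u) * - (P l u * sin (B l u) + Q l u * cos (B l u))).
  have h1 := holo_Au _ _ _ _ hol l; have h2 := holo_Bu _ _ _ _ hol l.
  by rewrite /f; deriv; ring.
have dE u l : partial1of2 f u l =
    expR (A l u) * - (P l u * sin (B l u) + Q l u * cos (B l u)).
  by rewrite partial1of2E; have [_ ->] := df u l.
have intf u : mu.-integrable H (EFin \o f u).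
  have [C' [C0' HC']] := exp_cos_decay _ _ _ _ `|u| hol dA.
  have [cA cB] := continuous_holo _ _ _ _ u hol.
  apply: (integrable_expRN_le _ C' 2) => //; first exact: continuous_expcos.
  move=> l l0; have [h _] := HC' l u l0 (lexx _); apply: le_trans h.
  rewrite normrM ger0_norm ?expR_ge0//.
  by rewrite ler_piMr ?expR_ge0// cos_max.
have Is0 : `](u0 - 1), (u0 + 1)[%classic u0.
  by rewrite /= in_itv/=; apply/andP; split; lra.
have bnd u l : 0 <= l -> `|u| <= `|u0| + 1 ->
    `|expR (A l u) * - (P l u * sin (B l u) + Q l u * cos (B l u))| <=
    C * expR (- (1 * l)).
  move=> l0 uu; have [_ h] := HC l u l0 uu; apply: le_trans h.
  rewrite normrM (ger0_norm (expR_ge0 _)) normrN ler_wpM2l ?expR_ge0//.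
  apply: (le_trans (ler_normD _ _)); rewrite !normrM; apply: lerD.
    by rewrite ler_piMr ?sin_max.
  by rewrite ler_piMr ?cos_max.
pose G l := C * expR (- (1 * l)).
have G0 l : 0 <= G l by rewrite /G mulr_ge0 ?expR_ge0.
have iG : mu.-integrable H (EFin \o G).
  by have /= := integrableZl mH C (integrable_expRN 1 ltr01).
have df1 u l : `](u0 - 1), (u0 + 1)[%classic u -> H l -> derivable (f ^~ l) u 1.
  by move=> _ _; have [] := df u l.
have Gub u l : `](u0 - 1), (u0 + 1)[%classic u -> H l -> `|partial1of2 f u l| <= G l.
  rewrite /= in_itv/= => /andP[u1 u2]; rewrite /H /= in_itv/= andbT => l0.
  rewrite dE; apply: bnd => //.
  have h : `|u - u0| <= 1 by rewrite ler_norml; apply/andP; split; lra.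
  rewrite (_ : u = u0 + (u - u0)); last by ring.
  by apply: (le_trans (ler_normD _ _)); rewrite lerD2l.
have e := @differentiation_under_integral R _ _ mu f H mH u0 _ _ Is0
  (fun s _ => intf s) df1 G G0 iG Gub.
have := @derivable_under_integral R _ _ mu f H mH u0 _ _ Is0
  (fun s _ => intf s) df1 G G0 iG Gub.
move=> /derivableP h; apply: (is_derive_eq h); rewrite -derive1E e.
have [cA cB] := continuous_holo _ _ _ _ u0 hol.
pose g l := expR (A l u0) * - (P l u0 * sin (B l u0) + Q l u0 * cos (B l u0)).
transitivity (Rintegral mu H g).
  by apply: eq_Rintegral => l _; rewrite /= dE.
have dg (l : R) : is_derive l 1 (fun l => - (expR (A l u0) * sin (B l u0))) (g l).
  have dS (F1 F2 : R -> R) (d1 d2 : R) : is_derive l 1 F1 d1 -> is_derive l 1 F2 d2 ->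
      is_derive l 1 (fun l => - (expR (F1 l) * sin (F2 l)))
        (expR (F1 l) * - (d1 * sin (F2 l) + d2 * cos (F2 l))).
    by move=> dF1 dF2; deriv; ring.
  exact: (dS _ _ _ _ (holo_Al _ _ _ _ hol l u0) (holo_Bl _ _ _ _ hol l u0)).
have cg : continuous g.
  apply: continuousM_fun.
    move=> x; apply: (continuous_comp (g := expR)); [exact: cA|exact: continuous_expR].
  apply: continuousN_fun; apply: continuousD_fun; apply: continuousM_fun.
  - exact: (holo_cP _ _ _ _ hol).
  - move=> x; apply: (continuous_comp (g := sin)); [exact: cB|exact: continuous_sin].
  - exact: (holo_cQ _ _ _ _ hol).
  - move=> x; apply: (continuous_comp (g := cos)); [exact: cB|exact: continuous_cos].
have uu : `|u0| <= `|u0| + 1 by lra.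
have ig : mu.-integrable H (EFin \o g).
  by apply: (integrable_expRN_le _ C 1) => // l l0; exact: bnd.
have F0 : (fun n : nat => - (expR (A n%:R u0) * sin (B n%:R u0))) @ \oo --> 0.
  apply: (cvg0_expRN_le (fun l => - (expR (A l u0) * sin (B l u0))) C 2) => // l l0.
  have [h1 _] := HC l u0 l0 uu; apply: le_trans h1.
  by rewrite normrN normrM ger0_norm ?expR_ge0// ler_piMr ?expR_ge0// sin_max.
rewrite (FTC_half_line _ _ dg cg ig F0).
by rewrite (holo_B0 _ _ _ _ hol) sin0 mulr0 !oppr0.
Qed.

(* For [A + i B = - Psi_L] this is [pi p(-x)], by Fourier inversion over a half line. *)
Definition hfour (A B : R -> R -> R) (x : R) : R :=
  Rintegral mu H (fun l => expR (A l 0) * cos (B l 0 + l * x)).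

(** This is [z -> i z]. Adding [x] times it puts the Fourier factor [e^{i z x}] into the exponent,
    to which [Jfour_cst] then applies. *)
Lemma holo_linear : holo_exp (fun _ u : R => - u) (fun l _ : R => l) (fun _ _ => 0) (fun _ _ => 1).
Proof.
split.
- by move=> l u; exact: is_derive_cst.
- by move=> l u; exact: is_derive_id.
- by move=> l u; deriv.
- by move=> l u; exact: is_derive_cst.
- by move=> u l; exact: cvg_cst.
- by move=> u l; exact: cvg_cst.
- by [].
- move=> U; exists 1; split=> // l u l0 _.
  by rewrite normr0 normr1 mul1r; split; lra.
Qed.

(** Moving the contour of [e^{F(z) + i z x}] from height 0 to height [u] releases a factor
    [e^{-ux}], which is brought to the left side. *)
Lemma hfour_shift (A B P Q : R -> R -> R) (u x : R) : holo_exp A B P Q -> decays A ->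
  expR (u * x) * hfour A B x = hfour (fun l v => A l (v + u)) (fun l v => B l (v + u)) x.
Proof.
move=> hol dA.
have hol' := holo_addZ _ _ _ _ _ _ _ _ x hol holo_linear.
have dA' : decays (fun l u => A l u + x * - u).
  move=> U; have [C HC] := dA U; exists (C + `|x| * `|U|) => l v l0 vU.
  have h : x * - v <= `|x| * `|U|.
    apply: (le_trans (ler_norm _)); rewrite normrM normrN ler_wpM2l//.
    by apply: (le_trans vU); exact: ler_norm.
  have := HC l v l0 vU; lra.
have e := Jfour_cst _ _ _ _ 0 u hol' dA'.
have eJ : Jfour (fun l u => A l u + x * - u) (fun l v => B l v + x * l) 0 = hfour A B x.
  by apply: eq_Rintegral => l _; rewrite oppr0 mulr0 addr0 (mulrC x).
rewrite -eJ e /Jfour /hfour.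
have [cA cB] := continuous_holo _ _ _ _ u hol'.
rewrite -RintegralZl//.
  apply: eq_Rintegral => l _; rewrite add0r (mulrC x l) mulrA -expRD.
  by congr (expR _ * _); ring.
have [C [C0 HC]] := exp_cos_decay _ _ _ _ `|u| hol' dA'.
apply: (integrable_expRN_le _ C 2) => //; first exact: continuous_expcos.
move=> l l0; have [h _] := HC l u l0 (lexx _); apply: le_trans h.
rewrite normrM ger0_norm ?expR_ge0//.
by rewrite ler_piMr ?expR_ge0// cos_max.
Qed.

End half_line.

(** * Exchanging expectations and Fourier integrals *)

Lemma integral_indicM d (T : measurableType d) (R : realType)
    (m : {measure set T -> \bar R}) (A : set T) (g : T -> R) :
  (\int[m]_x (\1_A x * g x)%:E = \int[m]_(x in A) (g x)%:E)%E.
Proof.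
rewrite [RHS]integral_mkcond; apply: eq_integral => x _.
by rewrite patchE indicE; case: (x \in A); rewrite ?mul1r ?mul0r.
Qed.

Lemma Rintegral_indicM d (T : measurableType d) (R : realType)
    (m : {measure set T -> \bar R}) (A : set T) (g : T -> R) :
  Rintegral m setT (fun x => \1_A x * g x) = Rintegral m A g.
Proof. by rewrite /Rintegral integral_indicM. Qed.

Lemma RintegralE d (T : measurableType d) (R : realType)
    (m : {measure set T -> \bar R}) (A : set T) (g : T -> R) :
  measurable A -> m.-integrable A (EFin \o g) ->
  (\int[m]_(x in A) (g x)%:E = (Rintegral m A g)%:E)%E.
Proof. by move=> mA ig; rewrite /Rintegral fineK//; exact: integrable_fin_num. Qed.

Lemma bounded_integrable d (T : measurableType d) (R : realType)
    (P : probability T R) (A : set T) (g : T -> R) (C : R) :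
  measurable A -> measurable_fun A g -> (forall x, A x -> `|g x| <= C) ->
  P.-integrable A (EFin \o g).
Proof.
move=> mA mg gC; apply: (le_integrable mA (g := EFin \o cst C)).
- exact/measurable_EFinP.
- by move=> x Ax /=; rewrite lee_fin (le_trans (gC _ Ax))// ler_norm.
- apply: finite_measure_integrable_cst => //.
Qed.

Lemma Rintegral_cos_le1 d (T : measurableType d) (R : realType)
    (P : probability T R) (A : set T) (g : T -> R) :
  measurable A -> measurable_fun setT g ->
  `|Rintegral P A (fun w => cos (g w))| <= 1.
Proof.
move=> mA mg.
have mc : measurable_fun A (fun w => cos (g w)).
  apply: measurable_funTS; apply: (measurableT_comp (f := cos)) => //.
  exact: (measurable_continuous _ _ (@continuous_cos R)).
have ic : P.-integrable A (EFin \o (fun w => cos (g w))).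
  by apply: (bounded_integrable _ _ _ _ _ _ 1) => // x _; exact: cos_max.
have i1 : P.-integrable A (EFin \o (fun=> 1)).
  by apply: (bounded_integrable _ _ _ _ _ _ 1) => // x _; rewrite normr1.
apply: (le_trans (le_normr_Rintegral mA ic)).
apply: (@le_trans _ _ (Rintegral P A (fun=> 1))).
  apply: le_Rintegral => //; first exact: integrable_norm.
  by move=> x _; exact: cos_max.
rewrite Rintegral_cst// mul1r -lee_fin fineK; first exact: probability_le1.
exact: fin_num_measure.
Qed.

Section fubini_trig.
Context {R : realType} d {T : measurableType d} (P : probability T R).
Notation mu := (@lebesgue_measure R).
Let H : set R := `[(0 : R), +oo[.
Let mH : measurable (H : set (measurableTypeR R)). Proof. exact: measurable_itv. Qed.

(** The domain [D] will be an event of the past intersected with survival, and the phase [be]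
    carries the imaginary part of the exponent. *)
Lemma Fubini_fourier (X : T -> R) (D : set T) (al be : R -> R) (C c : R) :
  measurable_fun setT X -> measurable D ->
  continuous al -> continuous be -> 0 < c ->
  (forall l, 0 <= l -> expR (al l) <= C * expR (- (c * l))) ->
  (\int[P]_(w in D) (Rintegral mu H (fun l => expR (al l) * cos (be l + l * X w)))%:E =
   (Rintegral mu H (fun l => expR (al l) * Rintegral P D (fun w => cos (be l + l * X w))))%:E)%E.
Proof.
move=> mX mD cal cbe c0 hC.
(* Both domains are turned into indicators so that Fubini can be used on the whole product space. *)
pose f (z : T * measurableTypeR R) : \bar R :=
  (\1_D z.1 * (\1_H z.2 * (expR (al z.2) * cos (be z.2 + z.2 * X z.1))))%:E.
have mal : measurable_fun setT al by exact: measurable_continuous.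
have mbe : measurable_fun setT be by exact: measurable_continuous.
have mf : measurable_fun setT f.
  apply/measurable_EFinP; apply: measurable_funM.
    have m1 : measurable_fun setT (\1_D : T -> R) by exact: measurable_indic.
    exact: (measurableT_comp m1 measurable_fst).
  apply: measurable_funM.
    have m1 : measurable_fun setT (\1_H : measurableTypeR R -> R) by exact: measurable_indic.
    exact: (measurableT_comp m1 measurable_snd).
  apply: measurable_funM.
    apply: (measurableT_comp (f := expR)) => //.
    exact: (measurableT_comp mal).
  apply: (measurableT_comp (f := cos)); first exact: (measurable_continuous _ _ (@continuous_cos R)).
  apply: measurable_funD; first exact: (measurableT_comp mbe).
  by apply: measurable_funM => //; exact: (measurableT_comp mX).
have intl (w : T) : mu.-integrable H (EFin \o (fun l => expR (al l) * cos (be l + l * X w))).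
  apply: (integrable_expRN_le _ C _ c0).
    apply: continuous_expcos => //; apply: continuousD_fun => //.
    by apply: continuousM_fun => x; [exact: cvg_id|exact: cvg_cst].
  move=> l l0; apply: le_trans (hC _ l0); rewrite normrM ger0_norm ?expR_ge0//.
  by rewrite ler_piMr ?expR_ge0// cos_max.
have iD l : P.-integrable D (EFin \o (fun w => cos (be l + l * X w))).
  apply: (bounded_integrable _ _ _ _ _ _ 1) => //; last by move=> x _; exact: cos_max.
  apply: measurable_funTS; apply: (measurableT_comp (f := cos)).
    exact: (measurable_continuous _ _ (@continuous_cos R)).
  by apply: measurable_funD => //; exact: measurable_funM.
have inf : (P \x mu)%E.-integrable setT f.
  apply/(integrable12ltyP P mu mf).
  (* [K] bounds the inner integral of [|f|] for every [w], and [P] has mass one. *)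
  pose K := (\int[mu]_(l in H) (expR (al l))%:E)%E.
  have Ky : (K < +oo)%E.
    have iK : mu.-integrable H (EFin \o (fun l => expR (al l))).
      apply: (integrable_expRN_le _ C _ c0).
        by move=> x; apply: (continuous_comp (g := expR)); [exact: cal|exact: continuous_expR].
      by move=> l l0; rewrite ger0_norm ?expR_ge0// hC.
    by rewrite /K RintegralE// ltry.
  apply: (@le_lt_trans _ _ (\int[P]_w K)%E).
    apply: ge0_le_integral => //.
    - by move=> w _; exact: integral_ge0.
    - apply: (measurable_fun_fubini_tonelli_F (abse \o f)) => //.
        exact: measurableT_comp.
      by move=> w; exact: (abse_ge0 (f w)).
    - move=> w _; rewrite /K [leRHS]integral_mkcond; apply: ge0_le_integral => //.
      + apply: measurableT_comp => //.
        exact: (measurableT_comp mf (measurable_pair1 w)).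
      + apply/(measurable_restrictT _ mH); apply/measurable_EFinP; apply: measurable_funTS.
        exact: (measurableT_comp (f := expR)).
      + move=> l _; rewrite /f /= patchE indicE indicE; case: (l \in H); last first.
          by rewrite mul0r mulr0 normr0.
        rewrite mul1r lee_fin normrM normrM (ger0_norm (expR_ge0 _)).
        rewrite -[leRHS]mul1r ler_pM ?mulr_ge0 ?expR_ge0//.
          by case: (w \in D); rewrite ?normr1 ?normr0.
        by rewrite ler_piMr ?expR_ge0// cos_max.
  by rewrite integral_cst//= [P setT]probability_setT mule1.
have iG := measurable_fubini_G inf.
have := Fubini inf; move: iG; rewrite /fubini_G /f /=.
have -> : (fun x : T => \int[mu]_y (\1_D x * (\1_H y * (expR (al y) * cos (be y + y * X x))))%:E)%E
   = (fun x => (\1_D x * Rintegral mu H (fun l => expR (al l) * cos (be l + l * X x)))%:E).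
  apply/funext => w; rewrite indicE; case: (w \in D).
    under eq_integral do rewrite mul1r.
    by rewrite mul1r integral_indicM RintegralE.
  under eq_integral do rewrite mul0r.
  by rewrite integral0 mul0r.
rewrite integral_indicM.
have -> : (fun y : measurableTypeR R => \int[P]_x (\1_D x * (\1_H y * (expR (al y) * cos (be y + y * X x))))%:E)%E
   = (fun l => (\1_H l * (expR (al l) * Rintegral P D (fun w => cos (be l + l * X w))))%:E).
  apply/funext => l; rewrite integral_indicM.
  have iZ : P.-integrable D (EFin \o (fun w => \1_H l * expR (al l) * cos (be l + l * X w))).
    exact: (integrableZl mD (\1_H l * expR (al l)) (iD l)).
  have -> : \1_H l * (expR (al l) * Rintegral P D (fun w => cos (be l + l * X w))) =
      Rintegral P D (fun w => \1_H l * expR (al l) * cos (be l + l * X w)).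
    by rewrite mulrA RintegralZl.
  rewrite -RintegralE//; apply: eq_integral => w _.
  by rewrite mulrA.
move=> iG ->; rewrite integral_indicM RintegralE//.
have iW := integrableZl mH C (integrable_expRN _ c0).
apply: le_integrable iW => //.
  apply/measurable_EFinP.
  have /measurable_EFinP mG : measurable_fun H (fun l : measurableTypeR R => (\1_H l *
      (expR (al l) * Rintegral P D (fun w => cos (be l + l * X w))))%:E).
    exact: measurable_funTS.
  apply: eq_measurable_fun mG => l Hl.
  by rewrite /= indicE Hl mul1r.
move=> l Hl /=; rewrite lee_fin normrM (ger0_norm (expR_ge0 _)).
apply: (@le_trans _ _ (C * expR (- (c * l)))); last exact: ler_norm.
apply: le_trans (hC _ _); last by move: Hl; rewrite /H /= in_itv/= andbT.
rewrite ler_piMr ?expR_ge0//; apply: Rintegral_cos_le1 => //.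
by apply: measurable_funD => //; exact: measurable_funM.
Qed.

End fubini_trig.

(** * Fourier inversion and the density *)

Section inversion.
Context {R : realType} d {T : measurableType d} (P : probability T R).
Notation mu := (@lebesgue_measure R).
Let H : set R := `[(0 : R), +oo[.
Let mH : measurable (H : set (measurableTypeR R)). Proof. exact: measurable_itv. Qed.
Variables (X : T -> R) (al be : R -> R) (C : R).
Hypothesis mX : measurable_fun setT X.
Hypotheses (cal : continuous al) (cbe : continuous be).
Hypothesis alC : forall l, 0 <= l -> expR (al l) <= C * expR (- (2 * l)).
Hypothesis cosX : forall l, Rintegral P setT (fun w => cos (l * X w)) = expR (al l) * cos (be l).
Hypothesis sinX : forall l, Rintegral P setT (fun w => sin (l * X w)) = expR (al l) * sin (be l).

(** Fourier inversion folded onto the half line: [pi^{-1} Re \int_0^oo e^{al + i be - i l y} dl]. *)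
Definition inv_density (y : R) : R :=
  pi^-1 * Rintegral mu H (fun l => expR (al l) * cos (be l + l * - y)).

Let C0 : 0 <= C.
Proof.
have := alC 0 (lexx _); rewrite mulr0 oppr0 expR0 mulr1.
exact: le_trans (expR_ge0 _).
Qed.

Let mcos (g : T -> R) : measurable_fun setT g -> measurable_fun setT (fun w => cos (g w)).
Proof.
move=> mg; apply: (measurableT_comp (f := cos)) => //.
exact: (measurable_continuous _ _ (@continuous_cos R)).
Qed.

Let msin (g : T -> R) : measurable_fun setT g -> measurable_fun setT (fun w => sin (g w)).
Proof.
move=> mg; apply: (measurableT_comp (f := sin)) => //.
exact: (measurable_continuous _ _ (@continuous_sin R)).
Qed.

Lemma Rintegral_cos_shift (l c : R) :
  Rintegral P setT (fun w => cos (c + l * X w)) = expR (al l) * cos (be l + c).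
Proof.
have ic : P.-integrable setT (EFin \o (fun w => cos (l * X w))).
  apply: (bounded_integrable _ _ _ _ _ _ 1) => //; last by move=> x _; exact: cos_max.
  by apply: mcos; exact: measurable_funM.
have isn : P.-integrable setT (EFin \o (fun w => sin (l * X w))).
  apply: (bounded_integrable _ _ _ _ _ _ 1) => //; last by move=> x _; exact: sin_max.
  by apply: msin; exact: measurable_funM.
have ic' := integrableZl measurableT (cos c) ic.
have is' := integrableZl measurableT (sin c) isn.
transitivity (Rintegral P setT (fun w => cos c * cos (l * X w) - sin c * sin (l * X w))).
  by apply: eq_Rintegral => w _; rewrite cosD.
rewrite RintegralB// RintegralZl// RintegralZl// cosX sinX cosD; ring.
Qed.

(** Before taking expectations [cos (l (X - y))] has no decay in [l]; the damping [e^{-el}] makes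
    Fubini available and turns the inner integral into a Cauchy kernel. *)
Lemma smoothed_inversion (e y : R) : 0 < e ->
  (\int[P]_w (e / (e ^+ 2 + (X w - y) ^+ 2))%:E =
   (Rintegral mu H (fun l => expR (- (e * l)) *
      (expR (al l) * cos (be l + l * - y))))%:E)%E.
Proof.
move=> e0.
have := @Fubini_fourier R _ T P X setT (fun l => - (e * l)) (fun l => l * - y) 1 e
  mX measurableT.
have -> : (fun w => (Rintegral mu `[0, +oo[ (fun l => expR (- (e * l)) * cos (l * - y + l * X w)))%:E)
   = (fun w => (e / (e ^+ 2 + (X w - y) ^+ 2))%:E).
  apply/funext => w; rewrite -Rintegral_cauchy_kernel//; congr EFin.
  by apply: eq_Rintegral => l _; rewrite -mulrDr [- y + _]addrC.
move=> ->//.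
- by congr EFin; apply: eq_Rintegral => l _; rewrite Rintegral_cos_shift.
- by dcont.
- by dcont.
- by move=> l _; rewrite mul1r.
Qed.

Let cint (y : R) : continuous (fun l => expR (al l) * cos (be l + l * - y)).
Proof.
apply: continuous_expcos => //; apply: continuousD_fun => //.
by apply: continuousM_fun => x; [exact: cvg_id|exact: cvg_cst].
Qed.

Let bint (y l : R) : 0 <= l -> `|expR (al l) * cos (be l + l * - y)| <= C * expR (- (2 * l)).
Proof.
move=> l0; apply: le_trans (alC _ l0); rewrite normrM ger0_norm ?expR_ge0//.
by rewrite ler_piMr ?expR_ge0// cos_max.
Qed.

Let le_lexp (l : R) : 0 <= l -> l * expR (- (2 * l)) <= expR (- (1 * l)).
Proof.
move=> l0; rewrite (_ : - (1 * l) = l + - (2 * l)); last by ring.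
rewrite expRD ler_wpM2r ?expR_ge0//.
by have := expR_ge1Dx l; lra.
Qed.

(** Because [l e^{-2l} <= e^{-l}], [K] dominates the first moment in [l] of the integrand. It
    therefore gives both the rate at which damping disappears and the Lipschitz constant of the
    density, up to [pi]. *)
Let K := C * Rintegral mu H (fun l => expR (- (1 * l))).

Let iint (y : R) : mu.-integrable H (EFin \o (fun l => expR (al l) * cos (be l + l * - y))).
Proof. by apply: (integrable_expRN_le _ C 2) => // l l0; exact: bint. Qed.

(** From [1 - e^{-el} <= e l]. The rate is uniform in [y], hence can be integrated over intervals
    later. *)
Lemma smoothed_inversion_bound (e y : R) : 0 < e ->
  `|Rintegral mu H (fun l => expR (- (e * l)) * (expR (al l) * cos (be l + l * - y))) -
    pi * inv_density y| <= e * K.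
Proof.
move=> e0; rewrite /inv_density mulrA mulfV ?gt_eqF ?pi_gt0// mul1r.
have ce : continuous (fun l => expR (- (e * l))) by dcont.
have ei l : 0 <= l -> expR (- (e * l)) <= 1.
  by move=> l0; rewrite expR_le1 oppr_le0 mulr_ge0// ltW.
have i1 : mu.-integrable H (EFin \o (fun l => expR (- (e * l)) * (expR (al l) * cos (be l + l * - y)))).
  apply: (integrable_expRN_le _ C 2) => //; first exact: continuousM_fun.
  move=> l l0; apply: le_trans (bint y l l0); rewrite normrM ger0_norm ?expR_ge0//.
  by rewrite ler_piMl// ei.
rewrite -RintegralB// /K mulrA; apply: Rintegral_expRN_le => //.
  apply: continuousD_fun; first exact: continuousM_fun.
  by apply: continuousN_fun.
move=> l l0; rewrite -[X in _ - X]mul1r -mulrBl normrM.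
have h : `|expR (- (e * l)) - 1| <= e * l.
  rewrite ler0_norm ?subr_le0 ?ei// opprB.
  by have := expR_ge1Dx (- (e * l)); lra.
apply: (@le_trans _ _ (e * l * (C * expR (- (2 * l))))).
  by apply: ler_pM => //; exact: bint.
rewrite (_ : _ * _ = e * C * (l * expR (- (2 * l)))); last by ring.
by rewrite ler_wpM2l ?le_lexp// mulr_ge0// ltW.
Qed.

Lemma inv_density_bound (y : R) : `|inv_density y| <= pi^-1 * K.
Proof.
rewrite /inv_density normrM ger0_norm ?invr_ge0 ?pi_ge0// ler_wpM2l ?invr_ge0 ?pi_ge0//.
apply: Rintegral_expRN_le => // l l0; apply: (le_trans (bint y l l0)).
by rewrite ler_wpM2l// ler_expR lerN2 ler_wpM2r// ler1n.
Qed.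

Lemma inv_density_lip (x y : R) : `|inv_density x - inv_density y| <= pi^-1 * (`|x - y| * K).
Proof.
rewrite /inv_density -mulrBr normrM ger0_norm ?invr_ge0 ?pi_ge0//.
rewrite ler_wpM2l ?invr_ge0 ?pi_ge0// -RintegralB// /K mulrA.
apply: Rintegral_expRN_le => //.
  by apply: continuousD_fun => //; exact: continuousN_fun.
move=> l l0; rewrite -mulrBr normrM (ger0_norm (expR_ge0 _)).
have lip (u v : R) : `|cos u - cos v| <= `|u - v|.
  wlog vu : u v / v <= u.
    by move=> W; have [/W//|/ltW uv] := leP v u; rewrite distrC (distrC u); exact: W.
  have := @deriv1_bound R cos (fun z => - sin z) 1 v u vu (fun z => is_derive_cos z).
  rewrite mul1r (ger0_norm (x := u - v)) ?subr_ge0//; apply => z _.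
  by rewrite normrN sin_max.
apply: (@le_trans _ _ (C * expR (- (2 * l)) * (l * `|x - y|))).
  apply: ler_pM; rewrite ?expR_ge0 ?alC//; apply: (le_trans (lip _ _)).
  rewrite (_ : _ - _ = l * (y - x)); last by ring.
  by rewrite normrM (ger0_norm l0) distrC.
rewrite (_ : C * expR (- (2 * l)) * (l * `|x - y|) = `|x - y| * C * (l * expR (- (2 * l)))); last by ring.
by rewrite ler_wpM2l ?le_lexp// mulr_ge0.
Qed.

Let K0 : 0 <= K.
Proof. by apply: mulr_ge0 => //; apply: Rintegral_ge0 => l _; rewrite expR_ge0. Qed.

Lemma continuous_inv_density : continuous inv_density.
Proof.
move=> x; apply/cvgrPdist_le => /= e e0.
have M0 : 0 < pi^-1 * K + 1 :> R by rewrite ltr_wpDl// mulr_ge0// invr_ge0 pi_ge0.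
near=> y; apply: (le_trans (inv_density_lip x y)).
rewrite mulrCA; apply: (@le_trans _ _ (e / (pi^-1 * K + 1) * (pi^-1 * K + 1))); last first.
  by rewrite divfK// gt_eqF.
apply: ler_pM => //; [by rewrite mulr_ge0// invr_ge0 pi_ge0| |by rewrite lerDl].
near: y; apply: cvgr_dist_le; [exact: cvg_id|exact: divr_gt0].
Unshelve. all: end_near. Qed.

(** The smoothed versions are expectations of a positive kernel, and they converge to [pi] times the
    density as [e] tends to 0. *)
Lemma inv_density_ge0 (y : R) : 0 <= inv_density y.
Proof.
have pos e : 0 < e -> - (e * K) <= pi * inv_density y.
  move=> e0; have := smoothed_inversion_bound e y e0.
  have := smoothed_inversion e y e0; set I := Rintegral _ _ _ => hI.
  have I0 : 0 <= I.
    rewrite -lee_fin -hI; apply: integral_ge0 => w _; rewrite lee_fin.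
    by rewrite divr_ge0 ?addr_ge0 ?sqr_ge0// ltW.
  by rewrite ler_norml => /andP[h1 h2]; lra.
have [//|h] := leP 0 (inv_density y).
have h' : pi * inv_density y < 0 by rewrite pmulr_rlt0 ?pi_gt0.
(* With [z = pi * inv_density y < 0], this choice of [e] gives [e K <= - z / 2], so [- e K <= z]
   fails. The [+ 1] covers [K = 0]. *)
have := pos (- (pi * inv_density y) / (2 * (K + 1))).
have K1 : 0 < K + 1 by rewrite ltr_wpDl.
have -> : 0 < - (pi * inv_density y) / (2 * (K + 1)).
  by rewrite divr_gt0 ?oppr_gt0// mulr_gt0.
move=> /(_ isT); set z := pi * _ in h' *.
have : - z / (2 * (K + 1)) * K <= - z / 2.
  rewrite (_ : _ * K = - z / 2 * (K / (K + 1))); last by field; rewrite gt_eqF.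
  rewrite ler_piMr//; first by rewrite divr_ge0// oppr_ge0 ltW.
  by rewrite ler_pdivrMr// mul1r lerDl.
lra.
Qed.

End inversion.

Lemma bounded_cvg d (T : measurableType d) (R : realType) (P : probability T R)
    (A : set T) (f_ : nat -> T -> R) (f : T -> R) (M : R) :
  measurable A -> (forall n, measurable_fun A (f_ n)) ->
  (forall x, A x -> (fun n => f_ n x) @ \oo --> f x) ->
  (forall n x, A x -> `|f_ n x| <= M) ->
  (fun n => Rintegral P A (f_ n)) @ \oo --> Rintegral P A f.
Proof.
move=> mA mf_ cf fM.
have iM : P.-integrable A (EFin \o cst M).
  by apply: finite_measure_integrable_cst.
have mf : measurable_fun A f.
  by apply: (measurable_fun_cvg mf_).
have i_ n : P.-integrable A (EFin \o f_ n).
  by apply: (bounded_integrable _ _ _ _ _ _ M) => //; exact: fM.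
have cE x : A x -> (fun n => (f_ n x)%:E) @ \oo --> (f x)%:E.
  by move=> Ax; apply: cvg_EFin; [exact: nearW|exact: cf].
have fME x n : A x -> (`|(f_ n x)%:E| <= (EFin \o cst M) x)%E.
  by move=> Ax; rewrite /= lee_fin fM.
have [intf _ cv] := @dominated_convergence _ T R P A mA (fun n x => (f_ n x)%:E)
  (EFin \o f) (EFin \o cst M) (fun n => (measurable_EFinP _ _).2 (mf_ n))
  ((measurable_EFinP _ _).2 mf) (aeW _ cE) iM
  (aeW _ fME).
by rewrite /Rintegral; apply: fine_cvg; rewrite fineK//; exact: integrable_fin_num.
Qed.

(** * Interval probabilities by inversion *)

Section inversion_interval.
Context {R : realType} d {T : measurableType d} (P : probability T R).
Notation mu := (@lebesgue_measure R).
Let H : set R := `[(0 : R), +oo[.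
Variables (X : T -> R) (al be : R -> R) (C : R).
Hypothesis mX : measurable_fun setT X.
Hypotheses (cal : continuous al) (cbe : continuous be).
Hypothesis alC : forall l, 0 <= l -> expR (al l) <= C * expR (- (2 * l)).
Hypothesis cosX : forall l, Rintegral P setT (fun w => cos (l * X w)) = expR (al l) * cos (be l).
Hypothesis sinX : forall l, Rintegral P setT (fun w => sin (l * X w)) = expR (al l) * sin (be l).

Let q (e y : R) := Rintegral mu H (fun l => expR (- (e * l)) *
      (expR (al l) * cos (be l + l * - y))).

(** Damping only lowers the real part of the exponent, so [q e] is [pi] times another inversion
    density. *)
Let continuous_q e : 0 < e -> continuous (q e).
Proof.
move=> e0.
have -> : q e = fun y => pi * inv_density (fun l => - (e * l) + al l) be y.
  apply/funext => y; rewrite /inv_density mulrA mulfV ?gt_eqF ?pi_gt0// mul1r.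
  by apply: eq_Rintegral => l _; rewrite mulrA expRD.
apply: continuousM_fun; first by move=> x; exact: cvg_cst.
apply: (@continuous_inv_density _ _ _ C) => //.
  by apply: continuousD_fun => //; dcont.
move=> l l0; rewrite expRD; apply: le_trans (alC _ l0).
by rewrite ler_piMl ?expR_ge0// expR_le1 oppr_le0 mulr_ge0// ltW.
Qed.

Let cauchy_pos (e z : R) : 0 < e -> 0 < e ^+ 2 + z ^+ 2.
Proof. by move=> e0; rewrite ltr_wpDr ?sqr_ge0// exprn_gt0. Qed.

Let matan (g : T -> R) : measurable_fun setT g -> measurable_fun setT (fun w => atan (g w)).
Proof.
move=> mg; apply: (measurableT_comp (f := atan)) => //.
by apply: measurable_continuous => x; exact: continuous_atan.
Qed.

(** The Cauchy kernel is positive, so Tonelli allows integrating in [y] first; its primitive is an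
    arctangent. *)
Lemma smoothed_interval (e u v : R) : 0 < e -> u < v ->
  Rintegral mu `[u, v] (q e) =
  Rintegral P setT (fun w => atan ((v - X w) / e) - atan ((u - X w) / e)).
Proof.
move=> e0 uv.
pose f (z : T * measurableTypeR R) : \bar R :=
  (\1_(`[u, v]%classic) z.2 * (e / (e ^+ 2 + (X z.1 - z.2) ^+ 2)))%:E.
have f0 z : (0 <= f z)%E.
  rewrite lee_fin mulr_ge0//.
  by rewrite divr_ge0// ltW// cauchy_pos.
have mf : measurable_fun setT f.
  apply/measurable_EFinP; apply: measurable_funM.
    have m1 : measurable_fun setT (\1_(`[u, v]%classic) : measurableTypeR R -> R).
      exact: measurable_indic.
    exact: (measurableT_comp m1 measurable_snd).
  have mh : measurable_fun setT (fun z : R => e / (e ^+ 2 + z ^+ 2)).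
    apply: measurable_continuous => z; apply: cvgM; first exact: cvg_cst.
    apply: cvgV; first by rewrite gt_eqF// cauchy_pos.
    apply: cvgD; [exact: cvg_cst|exact: exprn_continuous].
  have mg : measurable_fun setT (fun z : T * measurableTypeR R => X z.1 - z.2).
    apply: measurable_funB; first exact: (measurableT_comp mX measurable_fst).
    exact: measurable_snd.
  exact: (measurableT_comp mh mg).
have := @fubini_tonelli _ _ T (measurableTypeR R) R P mu f mf f0; rewrite /fubini_F /fubini_G /f /=.
have inner w : (\int[mu]_y (\1_(`[u, v]%classic) y * (e / (e ^+ 2 + (X w - y) ^+ 2)))%:E =
    (atan ((v - X w) / e) - atan ((u - X w) / e))%:E)%E.
  rewrite integral_indicM.
  have dF (y : R) : is_derive y 1 (fun y => atan ((y - X w) / e)) (e / (e ^+ 2 + (X w - y) ^+ 2)).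
    deriv; rewrite -[X w - y]opprB sqrrN; field.
    by rewrite !gt_eqF//= ?cauchy_pos// ltr_wpDr ?sqr_ge0.
  have cF := is_derive_continuous _ _ _ dF.
  rewrite (@continuous_FTC2 R _ (fun y => atan ((y - X w) / e)))//.
  - apply: continuous_subspaceT => y; apply: cvgM; first exact: cvg_cst.
    apply: cvgV; first by rewrite gt_eqF// cauchy_pos.
    apply: cvgD; first exact: cvg_cst.
    apply: (continuous_comp (f := fun y => X w - y) (g := fun z => z ^+ 2)).
      by apply: cvgB; [exact: cvg_cst|exact: cvg_id].
    exact: exprn_continuous.
  - split.
    + by move=> y _; have [] := dF y.
    + by apply: cvg_at_right_filter; exact: cF.
    + by apply: cvg_at_left_filter; exact: cF.
  - by move=> y _; rewrite derive1E; have [_ ->] := dF y.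
under eq_integral do rewrite inner.
move=> h; rewrite {2}/Rintegral h /Rintegral; congr fine.
rewrite -integral_indicM; apply: eq_integral => y _.
rewrite indicE; case: (y \in _).
  under eq_integral do rewrite mul1r.
  by rewrite mul1r (@smoothed_inversion _ _ _ _ _ al be).
under eq_integral do rewrite mul0r.
by rewrite mul0r integral0.
Qed.

Let cvg_atan_sg (c : R) : (fun n : nat => atan (c * n.+1%:R)) @ \oo --> pi / 2 * Num.sg c.
Proof.
have main (k : R) (k0 : 0 < k) : (fun n : nat => atan (k * n.+1%:R)) @ \oo --> (pi / 2 : R).
  have h : atan (k * x) @[x --> +oo] --> (pi / 2 : R).
    have hk : (k * x : R) @[x --> +oo] --> +oo by exact: (@gt0_cvgMry R (pinfty_nbhs R) _ k id k0 cvg_id).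
    exact: (cvg_comp _ _ hk (@cvgy_atan R)).
  have := cvg_comp _ _ cvgr_idn h.
  by rewrite -(cvg_shiftS (fun n : nat => atan (k * n%:R))).
have [c0|c0|->] := ltgtP c 0.
- rewrite (ltr0_sg c0) mulrN1.
  have := main (- c); rewrite oppr_gt0 => /(_ c0) h.
  have -> : (fun n : nat => atan (c * n.+1%:R)) = (fun n : nat => - atan (- c * n.+1%:R)).
    by apply/funext => n; rewrite mulNr atanN opprK.
  exact: cvgN.
- by rewrite (gtr0_sg c0) mulr1; exact: main.
- rewrite sgr0 mulr0; under eq_fun do rewrite mul0r atan0.
  exact: cvg_cst.
Qed.

Let atan_bound (c : R) : `|atan c| <= pi / 2.
Proof. by rewrite ler_norml (ltW (atan_gtNpi2 _)) (ltW (atan_ltpi2 _)). Qed.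

Let K := C * Rintegral mu H (fun l => expR (- (1 * l))).

Lemma integrable_itv_continuous (f : R -> R) (u v : R) : continuous f ->
  mu.-integrable `[u, v] (EFin \o f).
Proof.
move=> cf; apply: continuous_compact_integrable; first exact: segment_compact.
exact: continuous_subspaceT.
Qed.

Lemma Rintegral_itv_le (f : R -> R) (u v M : R) : u <= v -> continuous f ->
  (forall x, `|f x| <= M) -> `|Rintegral mu `[u, v] f| <= M * (v - u).
Proof.
move=> uv cf fM; have mI : measurable (`[u, v]%classic : set (measurableTypeR R)).
  exact: measurable_itv.
apply: (le_trans (le_normr_Rintegral mI (integrable_itv_continuous _ _ _ cf))).
have -> : M * (v - u) = Rintegral mu `[u, v] (cst M).
  have E : lebesgue_measure (`[u, v]%classic : set R) = (v - u)%:E.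
    rewrite lebesgue_measure_itv/= lte_fin; case: ltP => // vu.
    by have -> : v = u by [apply/le_anti/andP]; rewrite subrr.
  by rewrite Rintegral_cst// [X in fine X](_ : _ = (v - u)%:E)//; exact: E.
apply: le_Rintegral => //.
- exact: (integrable_norm (integrable_itv_continuous _ _ _ cf)).
- by apply: integrable_itv_continuous => x; exact: cvg_cst.
Qed.

Lemma integrable_sgB (u v : R) :
  P.-integrable setT (EFin \o (fun w => (Num.sg (v - X w) - Num.sg (u - X w)) / 2)).
Proof.
have pn0 : (pi : R) != 0 by rewrite gt_eqF ?pi_gt0.
(* Measurability of the sign is obtained by writing it as a pointwise limit of arctangents. *)
have msg (c : R) : measurable_fun setT (fun w => pi / 2 * Num.sg (c - X w)).
  apply: (measurable_fun_cvg (h := fun n w => atan ((c - X w) * n.+1%:R))).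
    by move=> n; apply: matan; apply: measurable_funM => //; exact: measurable_funB.
  by move=> w _; exact: cvg_atan_sg.
have -> : (fun w => (Num.sg (v - X w) - Num.sg (u - X w)) / 2) =
    (fun w => pi^-1 * (pi / 2 * Num.sg (v - X w) - pi / 2 * Num.sg (u - X w))).
  apply/funext => w; move: (pi : R) pn0 => p p0; field; exact: p0.
apply: (bounded_integrable _ _ _ _ _ _ 1) => //.
  by apply: measurable_funM => //; exact: measurable_funB.
move=> w _; rewrite (_ : _ * _ = (Num.sg (v - X w) - Num.sg (u - X w)) / 2); last first.
  by move: (pi : R) pn0 => p p0; field; exact: p0.
by rewrite ler_norml; case: sgrP => _; case: sgrP => _; apply/andP; split; lra.
Qed.

(** Both sides, times [pi], are limits of the smoothed integrals as [e = 1 / (n + 1)] tends to 0. As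
    [sg 0 = 0], an atom at an endpoint would count with weight one half. *)
Lemma inversion_interval (u v : R) : u < v ->
  Rintegral mu `[u, v] (inv_density al be) =
  Rintegral P setT (fun w => (Num.sg (v - X w) - Num.sg (u - X w)) / 2).
Proof.
move=> uv.
pose e n : R := n.+1%:R^-1.
have e0 n : 0 < e n by rewrite invr_gt0.
have ci : continuous (inv_density al be) by exact: (continuous_inv_density al be C).
have mI : measurable (`[u, v]%classic : set (measurableTypeR R)) by exact: measurable_itv.
have c1 : (fun n => Rintegral mu `[u, v] (q (e n))) @ \oo -->
    Rintegral mu `[u, v] (fun y => pi * inv_density al be y).
  apply/subr_cvg0; apply: norm_cvg0.
  apply: (@squeeze_cvgr _ _ _ _ (fun=> 0) (fun n : nat => e n * (K * (v - u)))).
  - near=> n; have i1 := integrable_itv_continuous _ u v (continuous_q _ (e0 n)).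
    have i2 : mu.-integrable `[u, v] (EFin \o (fun y => pi * inv_density al be y)).
      by apply: integrable_itv_continuous; apply: continuousM_fun => // x; exact: cvg_cst.
    rewrite normr_ge0/= -RintegralB// mulrA; apply: Rintegral_itv_le; first exact: ltW.
      apply: continuousD_fun; first exact: continuous_q.
      by apply: continuousN_fun; apply: continuousM_fun => // x; exact: cvg_cst.
    move=> y; apply: (smoothed_inversion_bound al be C) => //.
  - exact: cvg_cst.
  - rewrite -[X in _ --> X](mul0r (K * (v - u))); apply: cvgM; last exact: cvg_cst.
    exact: cvg_harmonic.
have c2 : (fun n => Rintegral mu `[u, v] (q (e n))) @ \oo -->
    Rintegral P setT (fun w => pi * ((Num.sg (v - X w) - Num.sg (u - X w)) / 2)).
  have -> : (fun n => Rintegral mu `[u, v] (q (e n))) =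
      (fun n => Rintegral P setT (fun w => atan ((v - X w) / e n) - atan ((u - X w) / e n))).
    by apply/funext => n; rewrite smoothed_interval.
  apply: (bounded_cvg _ _ _ _ _ _ _ pi) => //.
  - by move=> n; apply: measurable_funB; apply: matan;
      apply: measurable_funM => //; exact: measurable_funB.
  - move=> w _; rewrite (_ : pi * _ = pi / 2 * Num.sg (v - X w) - pi / 2 * Num.sg (u - X w)).
      by apply: cvgB; rewrite /e; under eq_fun do rewrite invrK; exact: cvg_atan_sg.
    by field.
  - move=> n w _; apply: (le_trans (ler_normB _ _)).
    by rewrite [leRHS](splitr pi) lerD.
have := cvg_unique (@norm_hausdorff _ _) c1 c2.
rewrite RintegralZl//; last exact: integrable_itv_continuous.
have isg := integrable_sgB u v.
rewrite RintegralZl// => h.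
have pn0 : (pi : R) != 0 by rewrite gt_eqF ?pi_gt0.
exact: (mulfI pn0 (h _)).
Unshelve. all: end_near. Qed.

(** The half difference of signs lies between the indicators of the open and of the closed interval.
    Absence of atoms is not known at this stage, hence two inequalities. *)
Lemma inv_density_interval (u v : R) : u < v ->
  (P [set w | (u < X w < v)%R] <= (Rintegral mu `[u, v] (inv_density al be))%:E <=
   P [set w | (u <= X w <= v)%R])%E.
Proof.
move=> uv; rewrite inversion_interval//.
have m1 : measurable [set w | (u < X w < v)%R].
  have -> : [set w | (u < X w < v)%R] = X @^-1` `]u, v[%classic.
    by apply/seteqP; split => w; rewrite /= in_itv.
  by rewrite -[X in measurable X]setTI; exact: mX.
have m2 : measurable [set w | (u <= X w <= v)%R].
  have -> : [set w | (u <= X w <= v)%R] = X @^-1` `[u, v]%classic.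
    by apply/seteqP; split => w; rewrite /= in_itv.
  by rewrite -[X in measurable X]setTI; exact: mX.
have ind (A : set T) : measurable A -> P A = (Rintegral P setT (\1_A : T -> R))%:E.
  move=> mA; rewrite /Rintegral integral_indic// setIT fineK//.
  exact: fin_num_measure.
have iind (A : set T) : measurable A -> P.-integrable setT (EFin \o (\1_A : T -> R)).
  by move=> mA; exact: integrable_indic.
rewrite (ind _ m1) (ind _ m2) !lee_fin; apply/andP; split.
  apply: le_Rintegral => //; [exact: iind|exact: integrable_sgB|].
  move=> w _; have [|] := boolP (w \in _); rewrite /= ?mulr1n ?mulr0n.
    rewrite inE/= => /andP[uX Xv].
    by rewrite gtr0_sg ?subr_gt0// ltr0_sg ?subr_lt0//; lra.
  move=> _; have [uX|uX|<-] := ltgtP u (X w).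
  - by rewrite (ltr0_sg (x := u - _)) ?subr_lt0//; case: sgrP => _; lra.
  - have Xv : X w < v by exact: lt_trans uv.
    rewrite (gtr0_sg (x := u - _)) ?subr_gt0// (gtr0_sg (x := v - _)) ?subr_gt0//.
  - by rewrite subrr sgr0 gtr0_sg ?subr_gt0// subr0 mul1r.
apply: le_Rintegral => //; [exact: integrable_sgB|exact: iind|].
move=> w _; have [|] := boolP (w \in _); rewrite /= ?mulr1n ?mulr0n.
  by move=> _; case: sgrP => _; case: sgrP => _ /=; lra.
rewrite notin_setE/= => /negP; rewrite negb_and -!ltNge => /orP[Xu|vX].
  have Xv : X w < v by exact: lt_trans uv.
  rewrite (gtr0_sg (x := u - _)) ?subr_gt0// (gtr0_sg (x := v - _)) ?subr_gt0//; lra.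
have uX : u < X w by exact: lt_trans vX.
rewrite (ltr0_sg (x := u - _)) ?subr_lt0// (ltr0_sg (x := v - _)) ?subr_lt0//; lra.
Qed.

End inversion_interval.

(** * From interval probabilities to the law *)

Section density_measure.
Context {R : realType}.
Notation mu := (@lebesgue_measure R).
Variables (p : R -> R) (p0 : forall x, 0 <= p x) (mp : measurable_fun setT p).

(** The proofs are arguments of the definition so that the measure structure can be inferred from
    the term; the same holds for [law_measure]. *)
Definition density_measure (p0 : forall x, 0 <= p x) (mp : measurable_fun setT p)
  (B : set (measurableTypeR R)) : \bar R := (\int[mu]_(x in B) (p x)%:E)%E.

Let dm0 : density_measure p0 mp set0 = 0%E.
Proof. by rewrite /density_measure integral_set0. Qed.

Let dm_ge0 B : (0 <= density_measure p0 mp B)%E.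
Proof. by apply: integral_ge0 => x _; rewrite lee_fin p0. Qed.

Let dm_sigma : semi_sigma_additive (density_measure p0 mp).
Proof.
apply: semi_sigma_additive_nng_induced; last by move=> x; rewrite lee_fin p0.
exact/measurable_EFinP.
Qed.

HB.instance Definition _ := isMeasure.Build _ _ _ (density_measure p0 mp)
  dm0 dm_ge0 dm_sigma.

End density_measure.

Section law_measure.
Context {R : realType} d {T : measurableType d} (P : probability T R).
Variables (X : T -> R) (mX : measurable_fun setT X).

Definition law_measure (mX : measurable_fun setT X) (B : set (measurableTypeR R)) : \bar R :=
  P (X @^-1` B).

Let mXB (B : set (measurableTypeR R)) : measurable B -> measurable (X @^-1` B).
Proof. by move=> mB; rewrite -[X in measurable X]setTI; exact: mX. Qed.

Let lm0 : law_measure mX set0 = 0%E.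
Proof. by rewrite /law_measure preimage_set0 measure0. Qed.

Let lm_ge0 B : (0 <= law_measure mX B)%E.
Proof. exact: measure_ge0. Qed.

Let lm_sigma : semi_sigma_additive (law_measure mX).
Proof.
move=> F mF tF mUF; rewrite /law_measure preimage_bigcup.
apply: measure_semi_sigma_additive.
- by move=> n; exact: mXB.
- apply/trivIsetP => /= i j _ _ ij; rewrite -preimage_setI.
  by move/trivIsetP : tF => /(_ _ _ _ _ ij) ->//; rewrite preimage_set0.
- by rewrite -preimage_bigcup; exact: mXB.
Qed.

HB.instance Definition _ := isMeasure.Build _ _ _ (law_measure mX)
  lm0 lm_ge0 lm_sigma.

End law_measure.

Section density_of_inversion.
Context {R : realType} d {T : measurableType d} (P : probability T R).
Notation mu := (@lebesgue_measure R).
Variables (X : T -> R) (p : R -> R).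
Hypothesis mX : measurable_fun setT X.
Hypothesis cp : continuous p.
Hypothesis p0 : forall x, 0 <= p x.
Variable M : R.
Hypothesis pM : forall x, `|p x| <= M.
Hypothesis sandwich : forall u v, u < v ->
  (P [set w | (u < X w < v)%R] <= (Rintegral mu `[u, v] p)%:E <=
   P [set w | (u <= X w <= v)%R])%E.

Let mXI (i : interval R) : measurable (X @^-1` [set` i]).
Proof. by rewrite -[X in measurable X]setTI; apply: mX => //; exact: measurable_itv. Qed.

Let ooE u v : [set w | (u < X w < v)%R] = X @^-1` `]u, v[%classic.
Proof. by apply/seteqP; split => w; rewrite /= in_itv. Qed.

Let ccE u v : [set w | (u <= X w <= v)%R] = X @^-1` `[u, v]%classic.
Proof. by apply/seteqP; split => w; rewrite /= in_itv. Qed.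

Let atom0 x : P (X @^-1` `[x, x]%classic) = 0%E.
Proof.
apply/eqP; rewrite eq_le measure_ge0 andbT; apply/lee_addgt0Pr => e e0.
(* An interval of half-width [dl] has mass at most [2 dl M], which is below [e]; the [+ 1] covers
   [M = 0]. *)
rewrite add0e; pose dl := e / (2 * (M + 1)).
have M0 : 0 <= M by exact: le_trans (pM 0).
have dl0 : 0 < dl by rewrite divr_gt0// mulr_gt0// ltr_wpDl.
have dlt : x - dl < x + dl by lra.
have /andP[h _] := sandwich _ _ dlt.
apply: (@le_trans _ _ (P (X @^-1` `]x - dl, x + dl[%classic))).
  apply: le_measure; rewrite ?inE//.
  move=> w /=; rewrite !in_itv/= => /andP[h1 h2].
  by apply/andP; split; lra.
rewrite -ooE; apply: (le_trans h); rewrite lee_fin.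
apply: (le_trans (ler_norm _)).
apply: (le_trans (Rintegral_itv_le _ _ _ _ (ltW dlt) cp pM)).
rewrite (_ : _ - _ = e / (M + 1)); last first.
  by rewrite /dl; field; rewrite gt_eqF// ltr_wpDl.
rewrite mulrC -mulrA ler_piMr ?(ltW e0)// ler_pdivrMl ?ltr_wpDl// mulr1 lerDl//.
Qed.

Let PU (A B : set T) : measurable A -> measurable B -> (P (A `|` B) <= P A + P B)%E.
Proof. by move=> mA mB; exact: measureU2. Qed.

(** Endpoints carry no mass by [atom0], which turns the two inequalities of the sandwich into an
    equality. *)
Let occ u v : u < v -> P (X @^-1` `]u, v]%classic) = (\int[mu]_(x in `]u, v]) (p x)%:E)%E.
Proof.
move=> uv; have /andP[h1 h2] := sandwich _ _ uv; move: h1 h2; rewrite ooE ccE => h1 h2.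
have -> : (\int[mu]_(x in `]u, v]) (p x)%:E)%E = (Rintegral mu `[u, v] p)%:E.
  rewrite -RintegralE//; last exact: integrable_itv_continuous.
  by rewrite integral_itv_obnd_cbnd//; apply/measurable_EFinP; exact: measurable_continuous.
apply/eqP; rewrite eq_le; apply/andP; split.
  apply: le_trans h1.
  apply: (@le_trans _ _ (P (X @^-1` `]u, v[%classic `|` X @^-1` `[v, v]%classic))).
    apply: le_measure; rewrite ?inE//; first exact: measurableU.
    move=> w /=; rewrite !in_itv/= => /andP[uX Xv].
    have [->|ne] := eqVneq (X w) v; first by right; rewrite lexx.
    by left; rewrite uX lt_neqAle ne.
  by apply: (le_trans (PU _ _ _ _)) => //; rewrite atom0 adde0.
apply: (le_trans h2).
apply: (@le_trans _ _ (P (X @^-1` `]u, v]%classic `|` X @^-1` `[u, u]%classic))).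
  apply: le_measure; rewrite ?inE//; first exact: measurableU.
  move=> w /=; rewrite !in_itv/= => /andP[uX Xv].
  have [->|ne] := eqVneq (X w) u; first by right; rewrite lexx.
  by left; rewrite Xv lt_neqAle eq_sym ne uX.
by apply: (le_trans (PU _ _ _ _)) => //; rewrite atom0 adde0.
Qed.

(** Half-open intervals form a generating pi-system on which the two measures agree, and the
    intervals []-n, n]] exhaust the line with finite mass. *)
Lemma density_of_sandwich : density_of P X p.
Proof.
have mp : measurable_fun setT p by exact: measurable_continuous.
split; first by []; split; first by [].
move=> B mB.
pose g (n : nat) : set (measurableTypeR R) := `](- n%:R), n%:R]%classic.
have E := @measure_unique _ R (measurableTypeR R) (@ocitv R) g.
have := E _ _ _ _ (@law_measure R d T P X mX) (density_measure p p0 mp) _ _ B mB.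
apply => //.
- exact: ocitvI.
- by move=> n; exists (- n%:R, n%:R).
- rewrite -subTset => x _; have [n xn] : exists n : nat, `|x| < n%:R.
    by exists (Num.truncn `|x|).+1; rewrite truncnS_gt.
  exists n => //; rewrite /g /= in_itv/=.
  by move: xn; rewrite ltr_norml => /andP[-> /ltW ->].
- move=> A /ocitvP[->|[[u v] /= uv ->]].
    by rewrite measure0 measure0.
  exact: occ.
- move=> n; apply: (@le_lt_trans _ _ 1%E); last exact: ltry.
  by apply: probability_le1; exact: mXI.
Qed.

End density_of_inversion.

(** A strict inequality at one point would persist on a small interval and contradict the comparison
    of integrals there. *)
Lemma continuous_le_of_Rintegral (R : realType) (p q : R -> R) : continuous p -> continuous q ->
  (forall u v, u < v -> Rintegral lebesgue_measure `[u, v] p <=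
                        Rintegral lebesgue_measure `[u, v] q) ->
  forall x, p x <= q x.
Proof.
move=> cp cq pq x; rewrite leNgt; apply/negP => qp.
pose f y := p y - q y; have fx : 0 < f x / 2 by rewrite divr_gt0// subr_gt0.
have cf : continuous f by apply: continuousD_fun => //; exact: continuousN_fun.
have : \forall y \near x, f x / 2 < f y.
  apply: (cvgr_gt _ (cf x)); rewrite ltr_pdivrMr// mulr_natr mulr2n ltrDl.
  by rewrite subr_gt0.
move=> /nbhs_ballP[dl /= dl0 hdl].
pose u := x - dl / 2; pose v := x + dl / 2.
have uv : u < v by rewrite /u /v; lra.
have mI : measurable (`[u, v]%classic : set (measurableTypeR R)) by exact: measurable_itv.
have ip := integrable_itv_continuous p u v cp.
have iq := integrable_itv_continuous q u v cq.
have := pq _ _ uv; rewrite -subr_le0 -RintegralB// leNgt => /negP; apply.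
apply: (@lt_le_trans _ _ (Rintegral lebesgue_measure `[u, v] (fun=> f x / 2))).
  have E : lebesgue_measure (`[u, v]%classic : set R) = (v - u)%:E.
    by rewrite lebesgue_measure_itv/= lte_fin uv.
  rewrite Rintegral_cst// [X in fine X](_ : _ = (v - u)%:E); last exact: E.
  by rewrite mulr_gt0// subr_gt0.
apply: le_Rintegral => //.
- by apply: integrable_itv_continuous => y; exact: cvg_cst.
- exact: (integrable_itv_continuous f u v cf).
- move=> y; rewrite /= in_itv/= /u /v => /andP[h1 h2]; apply/ltW/hdl.
  by rewrite /ball/= ltr_norml; apply/andP; split; lra.
Qed.

(** This reduces the martingale claim for an arbitrary continuous density to the one given by
    inversion. *)
Lemma density_unique d (T : measurableType d) (R : realType) (P : probability T R)
    (X : T -> R) (p q : R -> R) : continuous p -> continuous q ->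
  density_of P X p -> density_of P X q -> p = q.
Proof.
move=> cp cq [mp [p0 dp]] [mq [q0 dq]].
have E u v : Rintegral lebesgue_measure `[u, v] p = Rintegral lebesgue_measure `[u, v] q.
  have mI : measurable (`[u, v]%classic : set R) by exact: measurable_itv.
  by have := dp _ mI; rewrite (dq _ mI) /Rintegral => <-.
by apply/funext => x; apply/le_anti/andP; split;
  apply: continuous_le_of_Rintegral => // u v _; rewrite E.
Qed.

(* Layer cake: an identity [E[Y; A] = E[Z; A]] for the events [A = {c < G}]
   extends to [E[G Y] = E[G Z]]. *)
Section layer_cake.
Context {R : realType} d {T : measurableType d} (P : probability T R).
Notation mu := (@lebesgue_measure R).

Lemma layer_cakeE (G : T -> R) (Y : T -> \bar R) :
  measurable_fun setT G -> (forall w, 0 <= G w) ->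
  measurable_fun setT Y -> (forall w, (0 <= Y w)%E) ->
  (\int[P]_w ((G w)%:E * Y w) =
   \int[mu]_(c in `[0%R, +oo[) \int[P]_(w in [set w | (c < G w)%R]) Y w)%E.
Proof.
move=> mG G0 mY Y0.
pose S : set (T * measurableTypeR R) := [set z | 0 <= z.2 < G z.1].
have mS : measurable S.
  have m2 : measurable_fun setT (fun z : T * measurableTypeR R => (z.2 : R)).
    exact: measurable_snd.
  have m1 : measurable_fun setT (fun z : T * measurableTypeR R => G z.1 - z.2).
    apply: measurable_funB => //; exact: (measurableT_comp mG measurable_fst).
  have -> : S = [set z | 0 <= z.2] `&` [set z | 0 < G z.1 - z.2].
    by apply/seteqP; split => z /=; rewrite subr_gt0 => /andP.
  apply: measurableI.
    rewrite -[X in measurable X]setTI (_ : [set z : T * measurableTypeR R | 0 <= z.2] = (fun z : T * measurableTypeR R => (z.2 : R)) @^-1` `[0, +oo[%classic).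
      by apply: m2 => //; exact: measurable_itv.
    by apply/seteqP; split => z /=; rewrite in_itv/= andbT.
  rewrite -[X in measurable X]setTI (_ : [set z : T * measurableTypeR R | 0 < G z.1 - z.2] = (fun z : T * measurableTypeR R => G z.1 - z.2) @^-1` `]0, +oo[%classic).
    by apply: m1 => //; exact: measurable_itv.
  by apply/seteqP; split => z /=; rewrite in_itv/= andbT.
pose f (z : T * measurableTypeR R) : \bar R := ((\1_S z)%:E * Y z.1)%E.
have f0 z : (0 <= f z)%E by rewrite /f mule_ge0.
have mf : measurable_fun setT f.
  apply: emeasurable_funM.
    by apply/measurable_EFinP; exact: measurable_indic.
  exact: (measurableT_comp mY measurable_fst).
have := @fubini_tonelli _ _ T (measurableTypeR R) R P mu f mf f0.
rewrite /fubini_F /fubini_G => h.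
transitivity (\int[P]_x \int[mu]_y f (x, y))%E.
  apply: eq_integral => w _; rewrite /f /=.
  have mw : measurable_fun setT (fun y : measurableTypeR R => (\1_S (w, y) : R)%:E).
    apply/measurable_EFinP.
    have m1 : measurable_fun setT (\1_S : T * measurableTypeR R -> R) by exact: measurable_indic.
    exact: (measurableT_comp m1 (measurable_pair1 w)).
  rewrite ge0_integralZr//.
  have mI : measurable (`[0, G w[%classic : set (measurableTypeR R)) by exact: measurable_itv.
  congr (_ * _)%E; rewrite [RHS](_ : _ = (\int[mu]_y (\1_(`[0, G w[%classic) y : R)%:E))%E.
    rewrite integral_indic// setIT.
    have E : lebesgue_measure (`[0, G w[%classic : set R) = (G w)%:E.
      rewrite lebesgue_measure_itv/= lte_fin; case: ltP => Gw; first by rewrite -EFinB subr0.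
      by congr EFin; apply/le_anti; rewrite Gw G0.
    by symmetry; exact: E.
  apply: eq_integral => y _; rewrite !indicE.
  have -> // : ((w, y) \in S) = (y \in `[0, G w[%classic).
  by apply/idP/idP; rewrite !inE /S /= ?in_itv.
rewrite h [RHS]integral_mkcond; apply: eq_integral => c _.
rewrite patchE; case: ifPn => hc; last first.
  rewrite integral0_eq// => w _; rewrite /f indicE.
  have -> : ((w, c) \in S) = false.
    apply/negbTE; move: hc; apply: contra; rewrite !inE /S /= in_itv/= => /andP[->] //.
  by rewrite mul0e.
rewrite /f [RHS]integral_mkcond; apply: eq_integral => w _ /=.
have c0 : 0 <= c by move: hc; rewrite inE /= in_itv/= andbT.
rewrite patchE indicE (_ : ((w, c) \in S) = (w \in [set w | c < G w])).
  by case: ifP => _; rewrite ?mul1e ?mul0e.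
by apply/idP/idP; rewrite !inE /S /= c0.
Qed.

Lemma layer_cake_eq (G : T -> R) (Y Z : T -> \bar R) :
  measurable_fun setT G -> (forall w, 0 <= G w) ->
  measurable_fun setT Y -> (forall w, (0 <= Y w)%E) ->
  measurable_fun setT Z -> (forall w, (0 <= Z w)%E) ->
  (forall c : R, (0 <= c)%R -> \int[P]_(w in [set w | (c < G w)%R]) Y w =
                        \int[P]_(w in [set w | (c < G w)%R]) Z w)%E ->
  (\int[P]_w ((G w)%:E * Y w) = \int[P]_w ((G w)%:E * Z w))%E.
Proof.
move=> mG G0 mY Y0 mZ Z0 YZ; rewrite !layer_cakeE//.
by apply: eq_integral => c; rewrite inE/= in_itv/= andbT; exact: YZ.
Qed.

End layer_cake.

(** * Monotone class arguments and cylinder events *)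

Section dynkin_integral.
Context {R : realType} d {T : measurableType d} (P : probability T R).

(** The pi-lambda argument for integrals. Equality of the total integrals is a separate hypothesis,
    used for complements, because [G] is not assumed to contain the whole space. *)
Lemma dynkin_integral (Y Z : T -> R) (G : set (set T)) :
  P.-integrable setT (EFin \o Y) -> P.-integrable setT (EFin \o Z) ->
  setI_closed G -> (forall A, G A -> measurable A) ->
  (\int[P]_w (Y w)%:E = \int[P]_w (Z w)%:E)%E ->
  (forall A, G A -> \int[P]_(w in A) (Y w)%:E = \int[P]_(w in A) (Z w)%:E)%E ->
  forall A, <<s G >> A -> measurable A /\
    (\int[P]_(w in A) (Y w)%:E = \int[P]_(w in A) (Z w)%:E)%E.
Proof.
move=> iY iZ GI mG YZT YZ A.
rewrite -(setI_closed_g_dynkin_g_sigma_algebra GI).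
pose S : set (set T) := [set A | measurable A /\
    (\int[P]_(w in A) (Y w)%:E = \int[P]_(w in A) (Z w)%:E)%E].
suff dS : dynkin S.
  have GS : G `<=` S by move=> B GB; split; [exact: mG|exact: YZ].
  by move/(smallest_sub dS GS).
split.
- by split.
- move=> B [mB hB]; split; first exact: measurableC.
  have dec (W : T -> R) : P.-integrable setT (EFin \o W) ->
      (\int[P]_(w in ~` B) (W w)%:E =
       \int[P]_w (W w)%:E - \int[P]_(w in B) (W w)%:E)%E.
    move=> iW; have mW := measurable_int _ iW.
    have iB : (\int[P]_(w in B) (W w)%:E)%E \is a fin_num.
      by apply: integrable_fin_num => //; exact: integrableS iW.
    rewrite -(setUv B) integral_setU//; last 3 first.
    - exact: measurableC.
    - by rewrite setUv.
    - by apply/disj_setPCl.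
    by rewrite addeAC subee// add0e.
  by rewrite dec// dec// YZT hB.
- move=> F tF hF.
  have mF k : measurable (F k) by have [] := hF k.
  have mU : measurable (\bigcup_k F k) by exact: bigcup_measurable.
  split => //.
  rewrite !integral_bigcup//; first last.
  + exact: integrableS iY.
  + exact: integrableS iZ.
  by apply: eq_eseriesr => k _; have [] := hF k.
Qed.

End dynkin_integral.

Definition gen_events {R : realType} {T : Type} {d'} {V : measurableType d'}
    (X : R -> T -> V) (I : set R) : set (set T) :=
  [set A | exists u B, [/\ I u, measurable B & A = X u @^-1` B]].

(** Finite intersections are given inductively, so that closure under intersection and the indexed
    form [fin_cap_genP] are inductions. *)
Inductive fin_cap {T : Type} (G : set (set T)) : set T -> Prop :=
| FinCapT : fin_cap G setT
| FinCapI A B : G A -> fin_cap G B -> fin_cap G (A `&` B).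

Lemma fin_cap_setI {T : Type} (G : set (set T)) : setI_closed (fin_cap G).
Proof.
move=> A B; elim=> [|A1 A2 GA1 _ IH] GB; first by rewrite setTI.
by rewrite -setIA; apply: FinCapI => //; exact: IH.
Qed.

Lemma sub_fin_cap {T : Type} (G : set (set T)) : <<s G >> `<=` <<s fin_cap G >>.
Proof.
apply: smallest_sub => [|A GA]; first exact: smallest_sigma_algebra.
by apply: sub_gen_smallest; rewrite -(setIT A); apply: FinCapI => //; exact: FinCapT.
Qed.

(** * Independence of increments from the past *)

Section independence.
Context {R : realType} d {T : measurableType d} (P : probability T R).

Lemma fin_cap_measurable (G : set (set T)) :
  (forall A, G A -> measurable A) -> forall A, fin_cap G A -> measurable A.
Proof.
move=> mG A; elim=> [|A1 A2 GA1 _ mA2]; first exact: measurableT.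
by apply: measurableI => //; exact: mG.
Qed.

Lemma gen_events_measurable {d'} {V : measurableType d'} (X : R -> T -> V) (I : set R) :
  (forall t, I t -> measurable_fun setT (X t)) ->
  forall A, gen_events X I A -> measurable A.
Proof.
move=> mX A [u [B [Iu mB ->]]]; rewrite -[X in measurable X]setTI.
exact: mX.
Qed.

Lemma fin_cap_genP (X : R -> T -> R) (I : set R) (i0 : R) (A : set T) : I i0 ->
  fin_cap (gen_events X I) A -> exists (n : nat) (ts : nat -> R) (B : nat -> set R),
    [/\ (forall k, I (ts k)), (forall k, measurable (B k)) &
        A = \bigcap_(k < n) [set w | B k (X (ts k) w)]].
Proof.
move=> Ii0; elim=> [|A1 A2 [u [B [Iu mB ->]]] _ [n [ts [Bs [Its mBs ->]]]]].
  (* Even for the empty intersection all times have to lie in [I]; [i0] is the default. *)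
  exists 0%N, (fun=> i0), (fun=> setT); split=> //.
  by rewrite (_ : `I_0 = set0) ?bigcap_set0//; apply/seteqP; split.
exists n.+1, (fun k => if k is k'.+1 then ts k' else u),
  (fun k => if k is k'.+1 then Bs k' else B); split.
- by case.
- by case.
apply/seteqP; split => w /=.
  by move=> [Bu h] [|k] /= kn //; exact: h.
move=> h; split; first exact: (h 0%N).
by move=> k kn; exact: (h k.+1).
Qed.

(** [P (E \cap A)] and [P E * P A] are the integrals over [A] of the indicator of [E] and of the
    constant [P E], so [dynkin_integral] applies. *)
Lemma indep_sigma_algebra (E : set T) (G : set (set T)) : measurable E ->
  setI_closed G -> (forall A, G A -> measurable A) ->
  (forall A, G A -> P (E `&` A) = (P E * P A)%E) ->
  forall A, <<s G >> A -> measurable A /\ P (E `&` A) = (P E * P A)%E.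
Proof.
move=> mE GI mG h A sA.
have iE : P.-integrable setT (EFin \o (\1_E : T -> R)) by exact: integrable_indic.
have ic : P.-integrable setT (EFin \o (cst (fine (P E)) : T -> R)).
  by apply: finite_measure_integrable_cst.
have fE : (fine (P E))%:E = P E by rewrite fineK//; exact: fin_num_measure.
have e1 B : measurable B -> (\int[P]_(w in B) (\1_E w : R)%:E = P (E `&` B))%E.
  by move=> mB; rewrite integral_indic.
have e2 B : measurable B -> (\int[P]_(w in B) (cst (fine (P E)) w)%:E = P E * P B)%E.
  move=> mB; transitivity ((fine (P E))%:E * P B)%E; last by rewrite fE.
  by rewrite -integral_cst.
have [|B GB|mA h2] := dynkin_integral _ P _ _ _ iE ic GI mG _ _ A sA.
- by rewrite e1// e2// setIT [P setT]probability_setT mule1.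
- by rewrite e1 ?e2 ?h//; exact: mG.
- by split => //; rewrite -e1// h2 e2.
Qed.

End independence.

(** Independence of increments is stated along ordered times, whereas events of the past involve
    times in any order. All of them are placed on one grid whose last two points frame the future
    increment. *)
Lemma sorted_grid (R : realType) (n : nat) (ts : nat -> R) (r s : R) : 0 <= r -> 0 <= s ->
  (forall k, 0 <= ts k <= r) ->
  exists (m : nat) (g : nat -> R),
    [/\ g 0%N = 0, (forall k, g k <= g k.+1), g m = r, g m.+1 = r + s &
        forall k, (k < n)%N -> exists2 j, (j <= m)%N & ts k = g j].
Proof.
move=> r0 s0 tsr; pose u := sort <=%R [seq ts k | k <- iota 0 n].
pose l := 0 :: u; pose m := size l.
(* The sorted times preceded by 0, then [r] at index [m], then [r + s] forever: monotonicity is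
   required for every index. *)
pose g k := if (k < m)%N then nth 0 l k else if k == m then r else r + s.
have lP x : x \in l -> 0 <= x <= r.
  rewrite inE => /orP[/eqP ->|]; first by rewrite lexx.
  by rewrite mem_sort => /mapP[k _ ->].
have pu : path <=%R 0 u.
  rewrite path_min_sorted ?sort_le_sorted//.
  apply/allP => x xu; have xl : x \in l by rewrite inE xu orbT.
  by have /andP[] := lP x xl.
exists m, g; split => //.
- move=> k; rewrite /g; have [km|mk] := ltnP k.+1 m.
    by rewrite (ltnW km); exact: (pathP 0 pu).
  have [km|mk'] := ltnP k m.
    have -> : k.+1 = m by apply/eqP; rewrite eqn_leq mk km.
    by rewrite eqxx; have /andP[] := lP (nth 0 l k) (mem_nth _ km).
  have -> : (k.+1 == m) = false by rewrite gtn_eqF// ltnS.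
  by case: eqP => _; rewrite ?lexx// lerDl.
- by rewrite /g ltnn eqxx.
- have -> : g m.+1 = (if m.+1 == m then r else r + s) by rewrite /g ltnNge leqnSn.
  by rewrite gtn_eqF.
- move=> k kn; have tk : ts k \in l.
    by rewrite inE mem_sort map_f ?orbT// mem_iota.
  exists (index (ts k) l); first by rewrite ltnW// index_mem.
  by rewrite /g index_mem tk nth_index.
Qed.

Section levy_increments.
Context {R : realType} d {T : measurableType d} (P : probability T R).
Variable tau : R -> T -> R.
Hypothesis LP : levy_process P tau.

Let mtau t : measurable_fun setT (tau t). Proof. by have [] := LP. Qed.

(** As [tau 0 = 0], the values on the grid are partial sums of increments. Events of the past thus
    belong to the sigma-algebra of the first [m] increments, and the increment number [m] is the one
    from [r] to [r + s]. *)
Lemma levy_incr_indep (r s : R) (B : set R) (A : set T) : 0 <= r -> 0 <= s ->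
  measurable B -> <<s gen_events tau `[0, r]%classic >> A ->
  measurable A /\
  P ([set w | B (tau (r + s) w - tau r w)] `&` A) =
    (P [set w | B (tau (r + s) w - tau r w)%R] * P A)%E.
Proof.
move=> r0 s0 mB /sub_fin_cap; apply: indep_sigma_algebra.
- have mDl : measurable_fun setT (fun w => tau (r + s) w - tau r w) by exact: measurable_funB.
  by rewrite -[X in measurable X]setTI; exact: mDl.
- exact: fin_cap_setI.
- by apply: fin_cap_measurable; apply: gen_events_measurable.
move=> {}A; have r0i : `[0, r]%classic 0 by rewrite /= in_itv/= lexx.
move=> /(fin_cap_genP _ _ _ _ _ r0i) [n [ts [Bs [Its mBs ->]]]].
have tsr k : 0 <= ts k <= r by have := Its k; rewrite /= in_itv.
have [m [g [g0 gS gm gm1 gts]]] := sorted_grid _ n ts r s r0 s0 tsr.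
pose D k w := tau (g k.+1) w - tau (g k) w.
have mD k : measurable_fun setT (D k) by exact: measurable_funB.
(* The pi-system of cylinders over the first [m] increments, where independence holds by definition
   of a Levy process. *)
pose G2 : set (set T) := [set A | exists C : nat -> set R, (forall k, measurable (C k)) /\
   A = \bigcap_(k < m) [set w | C k (D k w)]].
have mG2 A' : G2 A' -> measurable A'.
  move=> [C [mC ->]]; apply: bigcap_measurableType => k _.
  by rewrite -[X in measurable X]setTI; exact: mD.
have [_ _ indep _ _] := LP.
have g00 : 0 <= g 0%N by rewrite g0.
have mE : measurable [set w | B (tau (r + s) w - tau r w)].
  by rewrite -gm1 -gm -[X in measurable X]setTI; exact: (mD m).
apply: (indep_sigma_algebra _ P _ G2 mE _ mG2 _ _ _).2.
- move=> A1 A2 [C1 [mC1 ->]] [C2 [mC2 ->]]; exists (fun k => C1 k `&` C2 k); split.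
    by move=> k; exact: measurableI.
  by rewrite -bigcapI.
- move=> A' [C [mC ->]].
  (* The event of the future increment is put in slot [m], so the product for [m + 1] increments is
     the product for [m] times one factor. *)
  pose C' k := if (k < m)%N then C k else B.
  have mC' k : measurable (C' k) by rewrite /C'; case: ifP.
  have h1 := indep m.+1 g C' g00 gS mC'.
  have h2 := indep m g C g00 gS mC.
  rewrite big_ord_recr/= in h1.
  have e1 : \bigcap_(k < m.+1) [set w | C' k (tau (g k.+1) w - tau (g k) w)] =
      [set w | B (tau (r + s) w - tau r w)] `&` \bigcap_(k < m) [set w | C k (D k w)].
    rewrite -gm1 -gm; apply/seteqP; split => w /=.
      move=> h; split; first by have := h m (ltnSn m); rewrite /C' ltnn.
      by move=> k /= km; have := h k (ltnW km); rewrite /C' km.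
    move=> [Bw h] k /=; rewrite ltnS leq_eqVlt => /orP[/eqP ->|km].
      by rewrite /C' ltnn.
    by rewrite /C' km; exact: (h k km).
  have CmB : C' m = B by rewrite /C' ltnn.
  rewrite -e1 h1 CmB gm1 gm muleC; congr (_ * _)%E.
  rewrite h2; apply: eq_bigr => k _; rewrite /C'.
  by rewrite ltn_ord.
(* With this sigma-algebra, measurability of the partial sums is an induction on the grid index. *)
pose T' := g_sigma_algebraType G2.
have mD' k : (k < m)%N -> measurable_fun setT (D k : T' -> R).
  move=> km _ C mC; rewrite setTI; apply: sub_gen_smallest.
  exists (fun j => if j == k then C else setT); split.
    by move=> j; case: ifP.
  apply/seteqP; split => w /=.
    by move=> Cw j /= jm; case: eqP => [->|].
  by move=> h; have := h k km; rewrite eqxx.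
have mtau' j : (j <= m)%N -> measurable_fun setT (tau (g j) : T' -> R).
  elim: j => [_|j IH jm].
    have -> : tau (g 0%N) = cst 0.
      by apply/funext => w; rewrite g0; have [_ ->] := LP.
    exact: measurable_cst.
  have -> : tau (g j.+1) = (fun w => tau (g j) w + D j w).
    by apply/funext => w; rewrite /D addrC subrK.
  by apply: measurable_funD; [exact: IH (ltnW jm)|exact: mD'].
suff : measurable (\bigcap_(k < n) [set w | Bs k (tau (ts k) w)] : set T') by [].
apply: bigcap_measurableType => k /= kn.
have [j jm ->] := gts k kn.
by have := mtau' j jm measurableT _ (mBs k); rewrite setTI.
Qed.

End levy_increments.

(** * From identities of probabilities to identities of expectations *)

Section expectation_indep.
Context {R : realType} d {T : measurableType d} (P : probability T R).

Lemma Rintegral1 (A : set T) : measurable A -> Rintegral P A (fun=> 1) = fine (P A).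
Proof. by move=> mA; rewrite Rintegral_cst// mul1r. Qed.

Lemma Rintegral1T : Rintegral P setT (fun=> 1) = 1.
Proof. by rewrite Rintegral1//; have := @probability_setT _ _ _ P => ->. Qed.

Let mgt (F : T -> R) (c : R) : measurable_fun setT F -> measurable [set w | c < F w].
Proof.
move=> mF; rewrite (_ : [set w | c < F w] = F @^-1` `]c, +oo[%classic).
  by rewrite -[X in measurable X]setTI; apply: mF => //; exact: measurable_itv.
by apply/seteqP; split => w; rewrite /= in_itv/= andbT.
Qed.

Let ind_int (D A : set T) : measurable D -> measurable A ->
  (\int[P]_(w in A) (\1_D w : R)%:E = P (D `&` A))%E.
Proof. by move=> mD mA; rewrite integral_indic. Qed.

Let mul_ind (D : set T) (F : T -> R) :
  (\int[P]_w ((F w)%:E * (\1_D w : R)%:E) = \int[P]_(w in D) (F w)%:E)%E.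
Proof. by rewrite -[RHS]integral_indicM; apply: eq_integral => w _; rewrite -EFinM mulrC. Qed.

(** Superlevel sets are preimages of half lines, so the layer cake formula reduces the claim to the
    hypothesis on preimages. *)
Lemma ge0_integral_scale (D1 D2 : set T) (k : R) (F1 F2 : T -> R) :
  measurable D1 -> measurable D2 -> 0 <= k ->
  measurable_fun setT F1 -> (forall w, 0 <= F1 w) ->
  measurable_fun setT F2 -> (forall w, 0 <= F2 w) ->
  (forall B, measurable B -> P (D1 `&` F1 @^-1` B) = (k%:E * P (D2 `&` F2 @^-1` B))%E) ->
  (\int[P]_(w in D1) (F1 w)%:E = k%:E * \int[P]_(w in D2) (F2 w)%:E)%E.
Proof.
move=> mD1 mD2 k0 mF1 F10 mF2 F20 h.
have mi (D : set T) : measurable D -> measurable_fun setT (fun w => (\1_D w : R)%:E).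
  by move=> mD; apply/measurable_EFinP; exact: measurable_indic.
have mk : measurable_fun setT (fun w => (k%:E * (\1_D2 w : R)%:E)%E).
  by apply: emeasurable_funM => //; exact: mi.
have -> : (k%:E * \int[P]_(w in D2) (F2 w)%:E =
    \int[P]_w ((F2 w)%:E * (k%:E * (\1_D2 w : R)%:E)))%E.
  under [RHS]eq_integral do rewrite muleCA.
  rewrite ge0_integralZl//.
  + by rewrite mul_ind.
  + by apply: emeasurable_funM; [exact/measurable_EFinP|exact: mi].
  + by move=> w _; rewrite mule_ge0// lee_fin.
rewrite -mul_ind !layer_cakeE//.
- apply: eq_integral => c _; have mc1 := mgt F1 c mF1; have mc2 := mgt F2 c mF2.
  rewrite ge0_integralZl//; last exact: measurable_funTS (mi _ mD2).
  rewrite !ind_int//.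
  have E F : [set w | c < F w] = F @^-1` `]c, +oo[%classic.
    by apply/seteqP; split => w; rewrite /= in_itv/= andbT.
  by rewrite !E; apply: h; exact: measurable_itv.
- by move=> w; rewrite mule_ge0// lee_fin.
- exact: mi.
Qed.

(** Applied to [1 + F1] and [1 + F2], which are nonnegative; the case [B = setT] then removes the
    constant. *)
Lemma bounded_Rintegral_scale (D1 D2 : set T) (k : R) (F1 F2 : T -> R) :
  measurable D1 -> measurable D2 -> 0 <= k ->
  measurable_fun setT F1 -> (forall w, `|F1 w| <= 1) ->
  measurable_fun setT F2 -> (forall w, `|F2 w| <= 1) ->
  (forall B, measurable B -> P (D1 `&` F1 @^-1` B) = (k%:E * P (D2 `&` F2 @^-1` B))%E) ->
  Rintegral P D1 F1 = k * Rintegral P D2 F2.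
Proof.
move=> mD1 mD2 k0 mF1 F11 mF2 F21 h.
have iF (F : T -> R) (D : set T) : measurable_fun setT F -> (forall w, `|F w| <= 1) ->
    measurable D -> P.-integrable D (EFin \o F).
  move=> mF bF mD; apply: (bounded_integrable _ _ _ _ _ _ 1) => //.
  exact: measurable_funTS.
have i1 (D : set T) : measurable D -> P.-integrable D (EFin \o (fun=> 1)).
  by move=> mD; apply: (bounded_integrable _ _ _ _ _ _ 1) => // x _; rewrite normr1.
have e1 : fine (P D1) = k * fine (P D2).
  have := h setT measurableT; rewrite !preimage_setT !setIT => ->.
  by rewrite fineM// fin_num_measure.
have F0 (F : T -> R) w : (forall w, `|F w| <= 1) -> 0 <= 1 + F w.
  by move=> bF; have := bF w; rewrite ler_norml => /andP[]; lra.
have : (\int[P]_(w in D1) (1 + F1 w)%:E = k%:E * \int[P]_(w in D2) (1 + F2 w)%:E)%E.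
  apply: ge0_integral_scale => //.
  - exact: measurable_funD.
  - by move=> w; exact: F0.
  - exact: measurable_funD.
  - by move=> w; exact: F0.
  - move=> B mB; have E (F : T -> R) : (fun w => 1 + F w) @^-1` B = F @^-1` ((fun x => 1 + x) @^-1` B) by [].
    rewrite !E; apply: h; rewrite -[X in measurable X]setTI.
    have m1 : measurable_fun setT (fun x : R => 1 + x) by exact: measurable_funD.
    exact: m1.
have iD (F : T -> R) (D : set T) : measurable_fun setT F -> (forall w, `|F w| <= 1) ->
    measurable D -> P.-integrable D (EFin \o (fun w => 1 + F w)).
  by move=> mF bF mD; exact: (integrableD mD (i1 _ mD) (iF _ _ mF bF mD)).
rewrite !RintegralE//; [|exact: iD|exact: iD].
rewrite -EFinM => -[]; rewrite !RintegralD//; try exact: i1; try exact: iF.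
rewrite !Rintegral1// e1 mulrDr; exact: addrI.
Qed.

(** Both functions are raised by 1 to become nonnegative. The layer cake is taken with respect to
    [1 + F], and on each of its superlevel sets the integral of [1 + G] factors by [scale1]. *)
Lemma bounded_Rintegral_indep (D : set T) (F G : T -> R) :
  measurable D -> measurable_fun setT F -> measurable_fun setT G ->
  (forall w, `|F w| <= 1) -> (forall w, `|G w| <= 1) ->
  (forall B B', measurable B -> measurable B' ->
    P (D `&` F @^-1` B `&` G @^-1` B') = (P (D `&` F @^-1` B) * P (G @^-1` B'))%E) ->
  Rintegral P D (fun w => F w * G w) = Rintegral P D F * Rintegral P setT G.
Proof.
move=> mD mF mG F1 G1 h.
have mFB B : measurable B -> measurable (F @^-1` B).
  by move=> mB; rewrite -[X in measurable X]setTI; exact: mF.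
have iG (A : set T) : measurable A -> P.-integrable A (EFin \o G).
  by move=> mA; apply: (bounded_integrable _ _ _ _ _ _ 1) => //; exact: measurable_funTS.
have iF (A : set T) : measurable A -> P.-integrable A (EFin \o F).
  by move=> mA; apply: (bounded_integrable _ _ _ _ _ _ 1) => //; exact: measurable_funTS.
have i1 (A : set T) : measurable A -> P.-integrable A (EFin \o (fun=> 1)).
  by move=> mA; apply: (bounded_integrable _ _ _ _ _ _ 1) => // x _; rewrite normr1.
have i1G (A : set T) : measurable A -> P.-integrable A (EFin \o (fun w => 1 + G w)).
  by move=> mA; exact: (integrableD mA (i1 _ mA) (iG _ mA)).
have i1F (A : set T) : measurable A -> P.-integrable A (EFin \o (fun w => 1 + F w)).
  by move=> mA; exact: (integrableD mA (i1 _ mA) (iF _ mA)).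
have F0 w : 0 <= 1 + F w by have := F1 w; rewrite ler_norml => /andP[]; lra.
have G0 w : 0 <= 1 + G w by have := G1 w; rewrite ler_norml => /andP[]; lra.
have m1F : measurable_fun setT (fun w => 1 + F w) by exact: measurable_funD.
have m1G : measurable_fun setT (fun w => 1 + G w) by exact: measurable_funD.
have iFG (A : set T) : measurable A -> P.-integrable A (EFin \o (fun w => F w * (1 + G w))).
  move=> mA; apply: (bounded_integrable _ _ _ _ _ _ 2) => //.
    by apply: measurable_funTS; exact: measurable_funM.
  move=> w _; rewrite normrM -[leRHS]mul1r ler_pM//.
  by have := G1 w; rewrite !ler_norml => /andP[? ?]; apply/andP; split; lra.
pose k := Rintegral P setT (fun w => 1 + G w).
have k0 : 0 <= k by apply: Rintegral_ge0 => w _.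
have scale B : measurable B -> Rintegral P (D `&` F @^-1` B) G =
    fine (P (D `&` F @^-1` B)) * Rintegral P setT G.
  move=> mB; have mDB : measurable (D `&` F @^-1` B) by apply: measurableI => //; exact: mFB.
  apply: bounded_Rintegral_scale => //.
  - exact: fine_ge0.
  - by move=> B' mB'; rewrite h// setTI fineK//; exact: fin_num_measure.
have scale1 B : measurable B -> (\int[P]_(w in D `&` F @^-1` B) (1 + G w)%:E =
    P (D `&` F @^-1` B) * k%:E)%E.
  move=> mB; have mDB : measurable (D `&` F @^-1` B) by apply: measurableI => //; exact: mFB.
  rewrite RintegralE//; last exact: i1G.
  rewrite /k !RintegralD//; try exact: i1; try exact: iG.
  rewrite scale// Rintegral1T Rintegral1//.
  rewrite -[X in (X * _)%E]fineK; last exact: fin_num_measure.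
  by rewrite -EFinM; congr EFin; rewrite /=; ring.
have : (\int[P]_(w in D) ((1 + F w) * (1 + G w))%:E = k%:E * \int[P]_(w in D) (1 + F w)%:E)%E.
  have mi : measurable_fun setT (fun w => (\1_D w * (1 + G w))%:E).
    apply/measurable_EFinP; apply: measurable_funM => //; exact: measurable_indic.
  have mi' : measurable_fun setT (fun w => (k%:E * (\1_D w : R)%:E)%E).
    apply: emeasurable_funM => //; apply/measurable_EFinP; exact: measurable_indic.
  have := @layer_cake_eq R _ T P (fun w => 1 + F w) (fun w => (\1_D w * (1 + G w))%:E)
    (fun w => (k%:E * (\1_D w : R)%:E)%E) m1F F0 mi _ mi' _ _.
  move=> hh; rewrite -[LHS]integral_indicM.
  transitivity (\int[P]_w ((1 + F w)%:E * (\1_D w * (1 + G w))%:E))%E.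
    by apply: eq_integral => w _; rewrite -EFinM; congr EFin; ring.
  rewrite hh.
  - under eq_integral do rewrite muleCA.
    rewrite ge0_integralZl//.
    + by rewrite mul_ind.
    + apply: emeasurable_funM; first exact/measurable_EFinP.
      by apply/measurable_EFinP; exact: measurable_indic.
    + by move=> w _; rewrite mule_ge0// lee_fin.
  - by move=> w; rewrite lee_fin mulr_ge0.
  - by move=> w; rewrite mule_ge0// lee_fin.
  - move=> c c0.
    have E : [set w | c < 1 + F w] = F @^-1` `]c - 1, +oo[%classic.
      by apply/seteqP; split => w; rewrite /= in_itv/= andbT ltrBlDl.
    have mC : measurable (F @^-1` `]c - 1, +oo[%classic) by apply: mFB; exact: measurable_itv.
    rewrite E ge0_integralZl//; last first.
      by apply: measurable_funTS; apply/measurable_EFinP; exact: measurable_indic.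
    have mcI : measurable (`]c - 1, +oo[%classic : set R) by exact: measurable_itv.
    rewrite ind_int// muleC -(scale1 _ mcI).
    by rewrite setIC [RHS]integral_mkcondr; apply: eq_integral => w _; rewrite patchE indicE; case: ifP => _; rewrite ?mul1r ?mul0r.
rewrite [X in (_ * X)%E]RintegralE//; last exact: i1F.
rewrite -EFinM.
have -> : (fun w => ((1 + F w) * (1 + G w))%:E) = (EFin \o (fun w => 1 + G w + F w * (1 + G w))).
  by apply/funext => w /=; congr EFin; ring.
rewrite RintegralE//; last exact: (integrableD mD (i1G _ mD) (iFG _ mD)).
move=> -[]; rewrite RintegralD//; try exact: i1G; try exact: iFG.
have := scale setT measurableT; rewrite preimage_setT setIT => sD.
have eFG : Rintegral P D (fun w => F w * (1 + G w)) = Rintegral P D F + Rintegral P D (fun w => F w * G w).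
  rewrite -RintegralD//; first by apply: eq_Rintegral => w _; ring.
    exact: iF.
  apply: (bounded_integrable _ _ _ _ _ _ 1) => //.
    by apply: measurable_funTS; exact: measurable_funM.
  by move=> w _; rewrite normrM -[leRHS]mul1r ler_pM.
rewrite eFG /k !RintegralD//; try exact: i1; try exact: iF; try exact: iG.
rewrite sD Rintegral1T Rintegral1//.
by move=> ht; lra.
Qed.

End expectation_indep.

(** * The killed subordinator *)

Section killed.
Context {R : realType} d {T : measurableType d} (P : probability T R).
Variables (a : R) (sigma : R -> T -> \bar R) (tau : R -> T -> R) (e : T -> \bar R).
Hypothesis sub_tau : subordinator P tau.
Hypothesis me : measurable_fun setT e.
Hypothesis exp_e : forall t : R, 0 <= t -> P [set w | (t%:E < e w)%E] = (expR (- (a * t)))%:E.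
Hypothesis indep_e : forall (n : nat) (ts : nat -> R) (B : nat -> set R) (C : set \bar R),
  (forall k, 0 <= ts k) -> (forall k, measurable (B k)) -> measurable C ->
  P ([set w | C (e w)] `&` \bigcap_(k < n) [set w | B k (tau (ts k) w)]) =
  (P [set w | C (e w)] * P (\bigcap_(k < n) [set w | B k (tau (ts k) w)]))%E.
Hypothesis sigmaE : forall (t : R) (w : T), 0 <= t ->
  sigma t w = if (t%:E < e w)%E then (tau t w)%:E else +oo%E.

Let LP : levy_process P tau. Proof. by have [] := sub_tau. Qed.
Let mtau t : measurable_fun setT (tau t). Proof. by have [] := LP. Qed.

Definition alive (t : R) : set T := [set w | sigma t w \is a fin_num].

Lemma aliveE t : 0 <= t -> alive t = [set w | (t%:E < e w)%E].
Proof.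
by move=> t0; apply/seteqP; split => w; rewrite /alive/= sigmaE//; case: ifP.
Qed.

Lemma sigma_alive t w : 0 <= t -> alive t w -> fine (sigma t w) = tau t w.
Proof. by move=> t0; rewrite aliveE//= => te; rewrite sigmaE// te. Qed.

Lemma alive_le s t : 0 <= s -> s <= t -> alive t `<=` alive s.
Proof.
move=> s0 st w; rewrite !aliveE//= ?(le_trans s0)//; apply: le_lt_trans.
by rewrite lee_fin.
Qed.

Let mlt t : measurable [set x : \bar R | (t%:E < x)%E].
Proof. by rewrite -[X in measurable X]setTI; exact: (emeasurable_fun_o_infty measurableT). Qed.

Lemma measurable_alive t : 0 <= t -> measurable (alive t).
Proof.
by move=> t0; rewrite aliveE// -[X in measurable X]setTI; exact: (me measurableT _ (mlt t)).
Qed.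

Lemma measurable_sigma t : 0 <= t -> measurable_fun setT (sigma t).
Proof.
move=> t0; rewrite (_ : sigma t = fun w => if (t%:E < e w)%E then (tau t w)%:E else +oo%E).
  apply: measurable_fun_ifT => //; last exact/measurable_EFinP.
  exact: measurable_fun_lte.
by apply/funext => w; rewrite sigmaE.
Qed.

Lemma indep_e_tau (C : set \bar R) (A : set T) : measurable C ->
  <<s gen_events tau `[0, +oo[%classic >> A ->
  measurable A /\ P ([set w | C (e w)] `&` A) = (P [set w | C (e w)] * P A)%E.
Proof.
move=> mC /sub_fin_cap; apply: indep_sigma_algebra.
- by rewrite -[X in measurable X]setTI; exact: me.
- exact: fin_cap_setI.
- by apply: fin_cap_measurable; apply: gen_events_measurable.
move=> {}A; have r0i : `[0:R, +oo[%classic 0 by rewrite /= in_itv/= lexx.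
move=> /(fin_cap_genP _ _ _ _ _ r0i) [n [ts [Bs [Its mBs ->]]]].
by apply: indep_e => // k; have := Its k; rewrite /= in_itv/= andbT.
Qed.

Lemma gen_tau_measurable (J : set R) (t : R) (B : set R) : J t -> measurable B ->
  <<s gen_events tau J >> (tau t @^-1` B).
Proof. by move=> Jt mB; apply: sub_gen_smallest; exists t, B. Qed.

Let T' := g_sigma_algebraType (gen_events tau `[0, +oo[%classic).

Let mtau' t : 0 <= t -> measurable_fun setT (tau t : T' -> R).
Proof.
move=> t0 _ B mB; rewrite setTI; apply: sub_gen_smallest; exists t, B; split=> //.
by rewrite /= in_itv/= andbT.
Qed.

Lemma gen_tau_sub r : <<s gen_events tau `[0, r]%classic >> `<=`
  <<s gen_events tau `[0, +oo[%classic >>.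
Proof.
apply: smallest_sub => [|A [u [B [Iu mB ->]]]]; first exact: smallest_sigma_algebra.
apply: gen_tau_measurable => //.
by move: Iu; rewrite /= !in_itv/= andbT => /andP[].
Qed.

(** The killing time is independent of the whole path of [tau], in particular of past and increment
    jointly; [levy_incr_indep] then separates these two. *)
Lemma indep_triple (r s : R) (C : set \bar R) (B : set R) (A : set T) : 0 <= r -> 0 <= s ->
  measurable C -> measurable B -> <<s gen_events tau `[0, r]%classic >> A ->
  P ([set w | C (e w)] `&` A `&` [set w | B (tau (r + s) w - tau r w)]) =
  (P ([set w | C (e w)] `&` A) * P [set w | B (tau (r + s) w - tau r w)%R])%E.
Proof.
move=> r0 s0 mC mB sA.
have [mA h] := levy_incr_indep _ P tau LP r s B A r0 s0 mB sA.
have [_ h1] := indep_e_tau C A mC (gen_tau_sub r _ sA).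
have m1 : measurable (A : set T') by exact: (gen_tau_sub r).
have mD : measurable_fun setT ((fun w => tau (r + s) w - tau r w) : T' -> R).
  by apply: measurable_funB; apply: mtau' => //; exact: addr_ge0.
have mAD : measurable (A `&` [set w | B (tau (r + s) w - tau r w)] : set T').
  by apply: measurableI => //; have := mD measurableT _ mB; rewrite setTI.
have [_ h2] := indep_e_tau C _ mC mAD.
by rewrite -setIA h2 [A `&` _]setIC h h1 -muleA; congr (_ * _)%E; exact: muleC.
Qed.

(** On survival up to [r] the paths of [sigma] and [tau] agree on [[0, r]]. Every integral below is
    restricted to survival, so the past of [sigma] may be replaced by that of [tau]. *)
Lemma filtration_trace (r : R) (A : set T) : 0 <= r -> natural_filtration sigma r A ->
  exists A', <<s gen_events tau `[0, r]%classic >> A' /\ A `&` alive r = A' `&` alive r.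
Proof.
move=> r0; pose S : set (set T) := [set A | exists A',
  <<s gen_events tau `[0, r]%classic >> A' /\ A `&` alive r = A' `&` alive r].
suff sS : sigma_algebra setT S.
  apply: (smallest_sub sS) => B [u [C [u0 ur mC ->]]].
  exists (tau u @^-1` (EFin @^-1` C)); split.
    apply: gen_tau_measurable; first by rewrite /= in_itv/= u0.
    have mE : measurable_fun setT (EFin \o (@id R)) by apply/measurable_EFinP.
    by rewrite -[X in measurable X]setTI; exact: (mE measurableT _ mC).
  apply/seteqP; split => w [h al]; split => //; move: h; rewrite /= sigmaE//;
    by have := alive_le _ _ u0 ur _ al; rewrite aliveE//= => ->.
have [h0 hC hU] : sigma_algebra setT <<s gen_events tau `[0, r]%classic >>.
  exact: smallest_sigma_algebra.
split.
- by exists set0.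
- move=> B [B' [sB' hB]]; exists (setT `\` B'); split; first exact: hC.
  have {}hB w : alive r w -> B w <-> B' w.
    move=> al; have : (B `&` alive r) w <-> (B' `&` alive r) w by rewrite hB.
    by move=> [h1 h2]; split => h; [have [] := h1 (conj h al)|have [] := h2 (conj h al)].
  by apply/seteqP; split => w [[_ nB] al]; split => //; split => // /(hB _ al).
- move=> F hF; have /choice[F' hF'] : forall n, exists A',
     <<s gen_events tau `[0, r]%classic >> A' /\ F n `&` alive r = A' `&` alive r.
    exact: hF.
  exists (\bigcup_k F' k); split; first by apply: hU => k; have [] := hF' k.
  rewrite !setI_bigcupl; apply: eq_bigcup => // k _.
  by have [] := hF' k.
Qed.

Lemma law_increment (r s : R) (B : set R) : 0 <= r -> 0 <= s -> measurable B ->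
  P [set w | B (tau (r + s) w - tau r w)] = P (tau s @^-1` B).
Proof.
move=> r0 s0 mB; have [_ _ _ st _] := LP.
by rewrite st// ?lerDl// addrAC subrr add0r.
Qed.

Variables (sal sbe : R -> R).
Hypothesis char_cos : forall t l, 0 <= t ->
  Rintegral P (alive t) (fun w => cos (l * fine (sigma t w))) = expR (t * sal l) * cos (t * sbe l).
Hypothesis char_sin : forall t l, 0 <= t ->
  Rintegral P (alive t) (fun w => sin (l * fine (sigma t w))) = expR (t * sal l) * sin (t * sbe l).

Let mtrig (f : R -> R) (g : T -> R) : continuous f -> measurable_fun setT g ->
  measurable_fun setT (fun w => f (g w)).
Proof.
move=> cf mg; have mf : measurable_fun setT f by exact: measurable_continuous.
exact: (measurableT_comp mf mg).
Qed.

(* Independence of the killing time and stationarity of the increments of [tau]. *)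
Let char_tau (f : R -> R) (r s l : R) : continuous f -> (forall x, `|f x| <= 1) ->
  0 <= r -> 0 <= s ->
  Rintegral P (alive s) (fun w => f (l * fine (sigma s w))) =
  expR (- (a * s)) * Rintegral P setT (fun w => f (l * (tau (r + s) w - tau r w))).
Proof.
move=> cf f1 r0 s0.
have ml t : measurable_fun setT (fun w => l * tau t w) by exact: measurable_funM.
have mD : measurable_fun setT (fun w => l * (tau (r + s) w - tau r w)).
  by apply: measurable_funM => //; exact: measurable_funB.
have mls : measurable_fun setT (fun x : R => l * x) by exact: measurable_funM.
have mfl B : measurable B -> measurable ((fun x => f (l * x)) @^-1` B).
  move=> mB; have mf : measurable_fun setT f by exact: measurable_continuous.
  by rewrite -[X in measurable X]setTI; exact: (measurableT_comp mf mls measurableT).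
have -> : Rintegral P (alive s) (fun w => f (l * fine (sigma s w))) =
          Rintegral P (alive s) (fun w => f (l * tau s w)).
  by apply: eq_Rintegral => w; rewrite inE => al; rewrite sigma_alive.
apply: bounded_Rintegral_scale => //.
- exact: measurable_alive.
- exact: mtrig.
- exact: mtrig.
- move=> B mB; rewrite aliveE// setTI -exp_e//.
  have E1 : (fun w => f (l * tau s w)) @^-1` B = tau s @^-1` ((fun x => f (l * x)) @^-1` B) by [].
  have g1 : <<s gen_events tau `[0, +oo[%classic >> ((fun w => f (l * tau s w)) @^-1` B).
    rewrite E1; apply: gen_tau_measurable; last exact: mfl.
    by rewrite /= in_itv/= s0.
  have [_ ->] := indep_e_tau [set x | (s%:E < x)%E] _ (mlt s) g1.
  congr (_ * _)%E; rewrite E1 -(law_increment r s _ r0 s0)//; exact: mfl.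
Qed.

(** Addition formulas split the cosine into past and increment. Extending survival from [r] to
    [r + s] costs [e^{-as}], which is exactly the factor by which the characteristic function of the
    increment of [tau] differs from that of the killed [sigma_s]. *)
Lemma one_step (r s be l : R) (A : set T) : 0 <= r -> 0 <= s -> natural_filtration sigma r A ->
  Rintegral P (A `&` alive (r + s)) (fun w => cos (be + l * fine (sigma (r + s) w))) =
  expR (s * sal l) * Rintegral P (A `&` alive r) (fun w => cos (be + s * sbe l + l * fine (sigma r w))).
Proof.
move=> r0 s0 sA; have rs0 : 0 <= r + s by exact: addr_ge0.
have rrs : r <= r + s by rewrite lerDl.
have [A' [sA' AA']] := filtration_trace r A r0 sA.
have [mA' _] := indep_e_tau setT A' measurableT (gen_tau_sub r _ sA').
pose D := A' `&` alive (r + s).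
have mal t : 0 <= t -> measurable (alive t) by exact: measurable_alive.
have mD : measurable D by apply: measurableI => //; exact: mal.
have AD : A `&` alive (r + s) = D.
  have alr : alive (r + s) = alive r `&` alive (r + s).
    by apply/seteqP; split => [w al|w []//]; split => //; exact: (alive_le _ _ r0 rrs).
  by rewrite /D alr !setIA AA'.
have md t : measurable_fun setT (fun w => l * tau t w) by exact: measurable_funM.
have mb t b : measurable_fun setT (fun w => b + l * tau t w) by exact: measurable_funD.
have mdl : measurable_fun setT (fun w => l * (tau (r + s) w - tau r w)).
  by apply: measurable_funM => //; exact: measurable_funB.
(* Memorylessness of the killing time, combined with its independence of the past. *)
have shrink (f : R -> R) b : continuous f -> (forall x, `|f x| <= 1) ->
    Rintegral P D (fun w => f (b + l * tau r w)) =
    expR (- (a * s)) * Rintegral P (A' `&` alive r) (fun w => f (b + l * tau r w)).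
  move=> cf f1; apply: bounded_Rintegral_scale => //.
  - by apply: measurableI => //; exact: mal.
  - exact: mtrig.
  - exact: mtrig.
  - move=> B mB; set E := (fun w => _) @^-1` B.
    have sE : <<s gen_events tau `[0, r]%classic >> (A' `&` E).
      have m1 : measurable (A' : set (g_sigma_algebraType (gen_events tau `[0, r]%classic))) by [].
      have m2 : measurable (E : set (g_sigma_algebraType (gen_events tau `[0, r]%classic))).
        have -> : E = tau r @^-1` ((fun x => f (b + l * x)) @^-1` B) by [].
        apply: gen_tau_measurable; first by rewrite /= in_itv/= r0 lexx.
        have mf : measurable_fun setT f by exact: measurable_continuous.
        have mls : measurable_fun setT (fun x : R => b + l * x).
          by apply: measurable_funD => //; exact: measurable_funM.
        by rewrite -[X in measurable X]setTI; exact: (measurableT_comp mf mls measurableT).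
      exact: (measurableI _ _ m1 m2).
    have key t : 0 <= t -> P (A' `&` alive t `&` E) = ((expR (- (a * t)))%:E * P (A' `&` E))%E.
      move=> t0; rewrite -setIA [alive t `&` E]setIC setIA setIC aliveE//.
      have [_ ->] := indep_e_tau [set x | (t%:E < x)%E] _ (mlt t) (gen_tau_sub r _ sE).
      by rewrite -exp_e.
    rewrite key// key// muleA -EFinM -expRD; congr ((expR _)%:E * _)%E; ring.
(* [D] only involves the past of [tau] and the killing time, hence is independent of the
   increment. *)
have indepD (f g : R -> R) b : continuous f -> (forall x, `|f x| <= 1) ->
    continuous g -> (forall x, `|g x| <= 1) ->
    Rintegral P D (fun w => f (b + l * tau r w) * g (l * (tau (r + s) w - tau r w))) =
    Rintegral P D (fun w => f (b + l * tau r w)) *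
    Rintegral P setT (fun w => g (l * (tau (r + s) w - tau r w))).
  move=> cf f1 cg g1; apply: bounded_Rintegral_indep => //; [exact: mtrig|exact: mtrig|].
  move=> B B' mB mB'; set E := (fun w => _) @^-1` B; set E' := (fun w => _) @^-1` B'.
  have sE : <<s gen_events tau `[0, r]%classic >> (A' `&` E).
    have m1 : measurable (A' : set (g_sigma_algebraType (gen_events tau `[0, r]%classic))) by [].
    have m2 : measurable (E : set (g_sigma_algebraType (gen_events tau `[0, r]%classic))).
      have -> : E = tau r @^-1` ((fun x => f (b + l * x)) @^-1` B) by [].
      apply: gen_tau_measurable; first by rewrite /= in_itv/= r0 lexx.
      have mf : measurable_fun setT f by exact: measurable_continuous.
      have mls : measurable_fun setT (fun x : R => b + l * x).
        by apply: measurable_funD => //; exact: measurable_funM.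
      by rewrite -[X in measurable X]setTI; exact: (measurableT_comp mf mls measurableT).
    exact: (measurableI _ _ m1 m2).
  have mC : measurable ((fun x => g (l * x)) @^-1` B').
    have mg : measurable_fun setT g by exact: measurable_continuous.
    have mls : measurable_fun setT (fun x : R => l * x) by exact: measurable_funM.
    by rewrite -[X in measurable X]setTI; exact: (measurableT_comp mg mls measurableT).
  have := indep_triple r s [set x | ((r + s)%:E < x)%E] _ _ r0 s0 (mlt _) mC sE.
  have -> : [set w | [set x | ((r + s)%:E < x)%E] (e w)] `&` (A' `&` E) = D `&` E.
    by rewrite /D aliveE// setIA [_ `&` A']setIC.
  exact.
have alr0 : A `&` alive r = A' `&` alive r by [].
have -> : Rintegral P (A `&` alive (r + s)) (fun w => cos (be + l * fine (sigma (r + s) w))) =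
    Rintegral P D (fun w => cos (be + l * tau r w) * cos (l * (tau (r + s) w - tau r w)) -
                          sin (be + l * tau r w) * sin (l * (tau (r + s) w - tau r w))).
  rewrite AD; apply: eq_Rintegral => w; rewrite inE => -[_ al].
  rewrite sigma_alive// -cosD; congr cos; ring.
have -> : Rintegral P (A `&` alive r) (fun w => cos (be + s * sbe l + l * fine (sigma r w))) =
    Rintegral P (A' `&` alive r) (fun w => cos (s * sbe l) * cos (be + l * tau r w) -
                          sin (s * sbe l) * sin (be + l * tau r w)).
  rewrite AA'; apply: eq_Rintegral => w; rewrite inE => -[_ al].
  by rewrite sigma_alive// -cosD; congr cos; ring.
have ibd (B : set T) (F : T -> R) : measurable B -> measurable_fun setT F ->
    (forall w, `|F w| <= 1) -> P.-integrable B (EFin \o F).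
  by move=> mB mF F1; apply: (bounded_integrable _ _ _ _ _ _ 1) => //; exact: measurable_funTS.
have ccos := @continuous_cos R; have csin := @continuous_sin R.
have mAr : measurable (A' `&` alive r) by apply: measurableI => //; exact: mal.
have mc t b := mtrig cos _ ccos (mb t b); have ms t b := mtrig sin _ csin (mb t b).
have ic b : P.-integrable (A' `&` alive r) (EFin \o (fun w => cos (b + l * tau r w))).
  by apply: ibd => // w; exact: cos_max.
have is' b : P.-integrable (A' `&` alive r) (EFin \o (fun w => sin (b + l * tau r w))).
  by apply: ibd => // w; exact: sin_max.
rewrite RintegralB//; last 2 first.
- apply: ibd => //; first by apply: measurable_funM => //; exact: mtrig.
  by move=> w; rewrite normrM -[leRHS]mul1r ler_pM// cos_max.
- apply: ibd => //; first by apply: measurable_funM => //; exact: mtrig.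
  by move=> w; rewrite normrM -[leRHS]mul1r ler_pM// sin_max.
rewrite (indepD cos cos)//; [|exact: cos_max|exact: cos_max].
rewrite (indepD sin sin)//; [|exact: sin_max|exact: sin_max].
rewrite (shrink cos)//; last exact: cos_max.
rewrite (shrink sin)//; last exact: sin_max.
rewrite RintegralB//; last 2 first.
- exact: (integrableZl mAr (cos (s * sbe l)) (ic be)).
- exact: (integrableZl mAr (sin (s * sbe l)) (is' be)).
rewrite !RintegralZl//.
have := char_tau cos r s l ccos (@cos_max R) r0 s0; rewrite char_cos// => hc.
have := char_tau sin r s l csin (@sin_max R) r0 s0; rewrite char_sin// => hs.
move: hc hs; set k := expR (- (a * s)); set x := Rintegral P setT _; set y := Rintegral P setT _.
move=> hc hs; set u := Rintegral P (A' `&` alive r) _; set v := Rintegral P (A' `&` alive r) _.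
rewrite mulrBr !mulrA hc hs; ring.
Qed.

End killed.

(** The generators of [natural_filtration], named in order to form a measurable type at each time
    and express adaptedness as measurability. *)
Definition filtration_events {R : realType} {T : Type} (sigma : R -> T -> \bar R) (t : R) :
    set (set T) :=
  [set A | exists u (B : set \bar R),
     [/\ 0 <= u, u <= t, measurable B & A = sigma u @^-1` B]].

(** * Passing to the limit along a time grid *)

Section multi_step.
Context {R : realType} d {T : measurableType d} (P : probability T R).
Variable sigma : R -> T -> \bar R.
Let al t : set T := [set w | sigma t w \is a fin_num].
Let FT t := g_sigma_algebraType (filtration_events sigma t).
Hypothesis msig : forall t, 0 <= t -> measurable_fun setT (sigma t).
Variables (GA GB PG QG : R -> R -> R).
Hypothesis holoG : holo_exp GA GB PG QG.
Hypothesis decG : forall A s, 0 <= s -> decays A -> decays (fun l u => A l u + s * GA l u).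
Hypothesis OS : forall (r s be l : R) (A : set T), 0 <= r -> 0 <= s ->
  natural_filtration sigma r A ->
  Rintegral P (A `&` al (r + s)) (fun w => cos (be + l * fine (sigma (r + s) w))) =
  expR (s * GA l 0) * Rintegral P (A `&` al r) (fun w => cos (be + s * GB l 0 + l * fine (sigma r w))).
Hypothesis al0 : P (al 0) = 1%E.
Hypothesis sig0 : forall w, al 0 w -> fine (sigma 0 w) = 0.

Lemma filtration_measurable t (A : set T) : 0 <= t -> natural_filtration sigma t A -> measurable A.
Proof.
move=> t0; apply: smallest_sub => [|B [u [C [u0 _ mC ->]]]].
  exact: sigma_algebra_measurable.
by rewrite -[X in measurable X]setTI; exact: msig.
Qed.

Lemma filtration_le s t : s <= t -> natural_filtration sigma s `<=` natural_filtration sigma t.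
Proof.
move=> st; apply: smallest_sub => [|B [u [C [u0 us mC ->]]]].
  exact: smallest_sigma_algebra.
by apply: sub_gen_smallest; exists u, C; split => //; exact: le_trans st.
Qed.

Lemma fmeas_sigma s t : 0 <= s -> s <= t -> measurable_fun setT (sigma s : FT t -> \bar R).
Proof.
move=> s0 st _ B mB; rewrite setTI; apply: sub_gen_smallest.
by exists s, B.
Qed.

Lemma fmeas_fine s t : 0 <= s -> s <= t -> measurable_fun setT ((fun w => fine (sigma s w)) : FT t -> R).
Proof. by move=> s0 st; exact: (measurableT_comp (@fine_measurable R _ measurableT) (fmeas_sigma _ _ s0 st)). Qed.

Lemma fmeas_alive s t : 0 <= s -> s <= t -> natural_filtration sigma t (al s).
Proof.
move=> s0 st; apply: sub_gen_smallest; exists s, [set x | x \is a fin_num]; split => //.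
have := @emeasurable_fin_num _ _ R setT id measurableT (@measurable_id _ _ setT).
by rewrite setTI.
Qed.

Lemma fmeas_measurable t (f : T -> R) : 0 <= t -> measurable_fun setT (f : FT t -> R) ->
  measurable_fun setT f.
Proof.
move=> t0 mf _ B mB; rewrite setTI; apply: (filtration_measurable t) => //.
by have := mf measurableT B mB; rewrite setTI.
Qed.

Lemma fmeas_le s t (f : T -> R) : s <= t -> measurable_fun setT (f : FT s -> R) ->
  measurable_fun setT (f : FT t -> R).
Proof.
move=> st mf _ B mB; rewrite setTI; apply: (filtration_le s t st).
by have := mf measurableT B mB; rewrite setTI.
Qed.

Let mal t : 0 <= t -> measurable (al t).
Proof. by move=> t0; exact: (filtration_measurable t _ t0 (fmeas_alive _ _ t0 (lexx _))). Qed.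

(** Fubini moves the expectation inside the Fourier integral, where [one_step] applies frequency by
    frequency. *)
Lemma one_step_hfour (r s : R) (D : set T) (A B PA QA : R -> R -> R) : 0 <= r -> 0 <= s ->
  natural_filtration sigma r D -> holo_exp A B PA QA -> decays A ->
  (\int[P]_(w in D `&` al (r + s)) (hfour A B (fine (sigma (r + s) w)))%:E =
   \int[P]_(w in D `&` al r) (hfour (fun l u => A l u + s * GA l u)%R
      (fun l u => B l u + s * GB l u)%R (fine (sigma r w)))%:E)%E.
Proof.
move=> r0 s0 sD hol dA; have rs0 : 0 <= r + s by exact: addr_ge0.
have mD := filtration_measurable r D r0 sD.
have hol' := holo_addZ _ _ _ _ _ _ _ _ s hol holoG.
have dA' := decG _ _ s0 dA.
have mf t : 0 <= t -> measurable_fun setT (fun w => fine (sigma t w)).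
  by move=> t0; exact: (measurableT_comp (@fine_measurable R _ measurableT) (msig t t0)).
have [cA cB] := continuous_holo _ _ _ _ 0 hol.
have [cA' cB'] := continuous_holo _ _ _ _ 0 hol'.
have bd (A0 : R -> R -> R) : decays A0 -> exists C, forall l, 0 <= l -> expR (A0 l 0) <= C * expR (- (2 * l)).
  move=> dA0; have [C HC] := dA0 0; exists (expR C) => l l0.
  by rewrite -expRD ler_expR HC// normr0.
have [C HC] := bd _ dA; have [C' HC'] := bd _ dA'.
have mD1 : measurable (D `&` al (r + s)) by apply: measurableI => //; exact: mal.
have mD2 : measurable (D `&` al r) by apply: measurableI => //; exact: mal.
have c2 : 0 < 2 :> R by [].
rewrite (Fubini_fourier _ P _ _ _ _ C 2 (mf _ rs0) mD1 cA cB c2 HC).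
rewrite (Fubini_fourier _ P _ _ _ _ C' 2 (mf _ r0) mD2 cA' cB' c2 HC').
congr EFin; apply: eq_Rintegral => l _.
by rewrite OS// expRD -!mulrA.
Qed.

Let FTT t : natural_filtration sigma t setT.
Proof. exact: (@measurableT _ (FT t)). Qed.

Lemma decays_linear (A : R -> R -> R) (x : R) : decays A -> decays (fun l u => A l u + x * - u).
Proof.
move=> dA U; have [C HC] := dA U; exists (C + `|x| * `|U|) => l v l0 vU.
have h : x * - v <= `|x| * `|U|.
  apply: (le_trans (ler_norm _)); rewrite normrM normrN ler_wpM2l//.
  by apply: (le_trans vU); exact: ler_norm.
have := HC l v l0 vU; lra.
Qed.

(** Start the step at time 0, where [sigma = 0], after translating by [x] through [holo_linear]: the
    new transform at [x] is the expectation of [hfour A B (x + sigma_s)] on survival. *)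
Lemma hfour_step_ge0 (A B PA QA : R -> R -> R) (s : R) : 0 <= s -> holo_exp A B PA QA -> decays A ->
  (forall x, 0 <= hfour A B x) ->
  forall x, 0 <= hfour (fun l u => A l u + s * GA l u) (fun l u => B l u + s * GB l u) x.
Proof.
move=> s0 hol dA h0 x.
have hol1 := holo_addZ _ _ _ _ _ _ _ _ x hol holo_linear.
have dA1 := decays_linear A x dA.
have := one_step_hfour 0 s setT _ _ _ _ (lexx _) s0 (FTT 0) hol1 dA1.
rewrite add0r !setTI.
have -> : (\int[P]_(w in al 0) (hfour (fun l u => (A l u + x * - u)%R + s * GA l u)%R
      (fun l u => (B l u + x * l)%R + s * GB l u)%R (fine (sigma 0 w)))%:E)%E =
    (hfour (fun l u => A l u + s * GA l u) (fun l u => B l u + s * GB l u) x)%:E.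
  rewrite -[RHS]mule1 -al0 -integral_cst//; last exact: mal.
  apply: eq_integral => w; rewrite inE => /sig0 ->; congr EFin.
  apply: eq_Rintegral => l _; rewrite oppr0 !mulr0 !addr0; congr (_ * cos _); ring.
rewrite -lee_fin => <-; apply: integral_ge0 => w _; rewrite lee_fin.
have -> // : hfour (fun l u => A l u + x * - u) (fun l u => B l u + x * l) (fine (sigma s w)) =
   hfour A B (x + fine (sigma s w)).
apply: eq_Rintegral => l _; rewrite oppr0 mulr0 addr0; congr (_ * cos _); ring.
Qed.

Let V (h : R -> R) t (w : T) : R := \1_(al t) w * h (fine (sigma t w)).

Let fine_meas t : 0 <= t -> measurable_fun setT (fun w => fine (sigma t w)).
Proof. by move=> t0; exact: (measurableT_comp (@fine_measurable R _ measurableT) (msig t t0)). Qed.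

Let mV (h : R -> R) t : 0 <= t -> continuous h -> measurable_fun setT (V h t).
Proof.
move=> t0 ch; apply: measurable_funM; first by apply: measurable_indic; exact: mal.
have mh : measurable_fun setT h by exact: measurable_continuous.
exact: (measurableT_comp mh (fine_meas t t0)).
Qed.

Lemma continuous_hfour (A B PA QA : R -> R -> R) : holo_exp A B PA QA -> decays A ->
  continuous (hfour A B).
Proof.
move=> hol dA; have [cA cB] := continuous_holo _ _ _ _ 0 hol.
have [C HC] := dA 0.
have hC l : 0 <= l -> expR (A l 0) <= expR C * expR (- (2 * l)).
  by move=> l0; rewrite -expRD ler_expR HC// normr0.
have ci := continuous_inv_density _ _ _ cA cB hC.
have -> : hfour A B = fun x => pi * inv_density (fun l => A l 0) (fun l => B l 0) (- x).
  apply/funext => x; rewrite /inv_density mulrA mulfV ?gt_eqF ?pi_gt0// mul1r.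
  by apply: eq_Rintegral => l _; rewrite opprK.
apply: continuousM_fun; first by move=> x; exact: cvg_cst.
move=> x; apply: (continuous_comp (f := fun x => - x) (g := inv_density _ _)); last exact: ci.
by apply: cvgN; exact: cvg_id.
Qed.

(** The layer cake passes from events of the past to nonnegative weights measurable at time [r]. *)
Lemma one_step_weighted (r s : R) (G : T -> R) (A B PA QA : R -> R -> R) : 0 <= r -> 0 <= s ->
  holo_exp A B PA QA -> decays A -> (forall x, 0 <= hfour A B x) ->
  measurable_fun setT (G : FT r -> R) -> (forall w, 0 <= G w) ->
  (\int[P]_w ((G w)%:E * (V (hfour A B) (r + s) w)%:E) =
   \int[P]_w ((G w)%:E * (V (hfour (fun l u => A l u + s * GA l u)%R
      (fun l u => B l u + s * GB l u)%R) r w)%:E))%E.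
Proof.
move=> r0 s0 hol dA h0 mG G0; have rs0 : 0 <= r + s by exact: addr_ge0.
have hol' := holo_addZ _ _ _ _ _ _ _ _ s hol holoG.
have dA' := decG _ _ s0 dA.
have h0' := hfour_step_ge0 _ _ _ _ s s0 hol dA h0.
have c1 := continuous_hfour _ _ _ _ hol dA.
have c2 := continuous_hfour _ _ _ _ hol' dA'.
have V0 h t w : (forall x, 0 <= h x) -> (0 <= (V h t w)%:E)%E.
  by move=> hh; rewrite lee_fin mulr_ge0.
apply: layer_cake_eq => //.
- exact: (fmeas_measurable r).
- by apply/measurable_EFinP; exact: mV.
- by move=> w; exact: V0.
- by apply/measurable_EFinP; exact: mV.
- by move=> w; exact: V0.
- move=> c c0.
  have sD : natural_filtration sigma r [set w | c < G w].
    have -> : [set w | c < G w] = G @^-1` `]c, +oo[%classic.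
      by apply/seteqP; split => w; rewrite /= in_itv/= andbT.
    by have := mG measurableT _ (measurable_itv `]c, +oo[); rewrite setTI.
  have E h t : (\int[P]_(w in [set w | (c < G w)%R]) (V h t w)%:E =
      \int[P]_(w in [set w | (c < G w)%R] `&` al t) (h (fine (sigma t w)))%:E)%E.
    rewrite [RHS]integral_mkcondr; apply: eq_integral => w _.
    by rewrite /V patchE indicE; case: ifP => _; rewrite ?mul1r ?mul0r.
  by rewrite !E; exact: (one_step_hfour r s _ _ _ _ _ r0 s0 sD hol dA).
Qed.

(* The weight [e^{s sigma}] shifts the contour by [i s], and conditioning on the past
   adds [- s Psi_sigma] to the exponent. *)
Definition step_exp (s : R) (G A : R -> R -> R) (l u : R) : R := A l (u + s) + s * G l u.

(** The last grid point is treated first: its factor [e^{s sigma}] is absorbed by [hfour_shift], and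
    the remaining product is a weight measurable at the previous grid point. The induction therefore
    generalizes the exponent. *)
Lemma multi_step (s : R) (n : nat) (r : R) (G : T -> R) (A B PA QA : R -> R -> R) :
  0 <= s -> 0 <= r ->
  holo_exp A B PA QA -> decays A -> (forall x, 0 <= hfour A B x) ->
  measurable_fun setT (G : FT r -> R) -> (forall w, 0 <= G w) ->
  (\int[P]_w ((G w * expR (\sum_(j < n) s * fine (sigma (r + j.+1%:R * s) w)))%:E *
     (V (hfour A B) (r + n%:R * s) w)%:E) =
   \int[P]_w ((G w)%:E * (V (hfour (iter n (step_exp s GA) A) (iter n (step_exp s GB) B)) r w)%:E))%E.
Proof.
move=> s0; elim: n => [|n IH] in A B PA QA G * => r0 hol dA h0 mG G0.
  apply: eq_integral => w _; rewrite big_ord0 expR0 mulr1 mul0r addr0.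
  by [].
have ns0 : 0 <= n%:R * s by rewrite mulr_ge0.
have rn0 : 0 <= r + n%:R * s by exact: addr_ge0.
have holS := holo_shift _ _ _ _ s hol.
have dAS := decays_shift _ s dA.
have hS0 x : 0 <= hfour (fun l v => A l (v + s)) (fun l v => B l (v + s)) x.
  by rewrite -(hfour_shift _ _ _ _ _ _ hol dA) mulr_ge0 ?expR_ge0.
pose E w := expR (\sum_(j < n) s * fine (sigma (r + j.+1%:R * s) w)).
have rS : r + n.+1%:R * s = r + n%:R * s + s by rewrite -natr1; ring.
transitivity (\int[P]_w ((G w * E w)%:E *
    (V (hfour (fun l v => A l (v + s))%R (fun l v => B l (v + s))%R) (r + n%:R * s + s) w)%:E))%E.
  apply: eq_integral => w _; rewrite -!EFinM; congr EFin.
  rewrite big_ord_recr/= expRD -/(E w) -rS /V -(hfour_shift _ _ _ _ _ _ hol dA); ring.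
have holS' := holo_addZ _ _ _ _ _ _ _ _ s holS holoG.
rewrite (one_step_weighted (r + n%:R * s) s (fun w => G w * E w) _ _ _ _ rn0 s0 holS dAS hS0).
- have := IH _ _ _ _ G r0 holS' (decG _ _ s0 dAS)
    (hfour_step_ge0 _ _ _ _ s s0 holS dAS hS0) mG G0.
  by rewrite -!iterSr; exact.
- apply: measurable_funM; first by apply: (fmeas_le r) => //; rewrite lerDl.
  apply: (measurableT_comp (f := expR)) => //.
  apply: measurable_sum => j; apply: measurable_funM => //.
  apply: fmeas_fine; first by rewrite addr_ge0// mulr_ge0.
  by rewrite lerD2l ler_wpM2r// ler_nat.
- by move=> w; rewrite mulr_ge0 ?expR_ge0.
Qed.

End multi_step.

(** * Riemann sums of a nondecreasing path *)

Section riemann_sums.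
Context {R : realType}.
Notation mu := (@lebesgue_measure R).
Variable x : R -> R.
Hypothesis nd_x : forall s t, 0 <= s -> s <= t -> x s <= x t.
Hypothesis x0 : x 0 = 0.

(** [x] is monotone only on the half line; extending it by its value at 0 gives a function monotone,
    hence measurable, on the whole line. *)
Let y s := x (Num.max 0 s).

Let nd_y : {homo y : s t / s <= t}.
Proof.
move=> s t st; apply: nd_x; first by rewrite le_max lexx.
by rewrite ge_max !le_max lexx/= st orbT.
Qed.

Let my (A : set (measurableTypeR R)) : measurable A -> measurable_fun A y.
Proof. by move=> mA; exact: nondecreasing_measurable. Qed.

Let integrable_y (u v : R) : mu.-integrable `[u, v] (EFin \o y).
Proof.
have mI : measurable (`[u, v]%classic : set (measurableTypeR R)) by exact: measurable_itv.
have [uv|vu] := leP u v; last by rewrite set_itv_ge ?bnd_simp -?ltNge//; exact: integrable_set0.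
apply: (le_integrable mI _ _ (integrable_itv_continuous (fun=> `|y u| + `|y v|) u v _)).
- by apply/measurable_EFinP; exact: my.
- move=> s /=; rewrite in_itv/= => /andP[us sv]; rewrite lee_fin.
  rewrite [leRHS]ger0_norm ?addr_ge0// ler_norml; apply/andP; split.
    apply: (@le_trans _ _ (y u)); last exact: nd_y.
    have := ler_norm (- y u); rewrite normrN; have := normr_ge0 (y v); lra.
  apply: (@le_trans _ _ (y v)); first exact: nd_y.
  have := ler_norm (y v); have := normr_ge0 (y u); lra.
- by move=> s; exact: cvg_cst.
Qed.

Let yE u v : 0 <= u -> Rintegral mu `[u, v] y = Rintegral mu `[u, v] x.
Proof.
move=> u0; apply: eq_Rintegral => s; rewrite inE/= in_itv/= => /andP[us _].
by rewrite /y max_r// (le_trans u0).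
Qed.

Let cell (u v : R) : u <= v -> y u * (v - u) <= Rintegral mu `[u, v] y <= y v * (v - u).
Proof.
move=> uv; have mI : measurable (`[u, v]%classic : set (measurableTypeR R)) by exact: measurable_itv.
have cE (c : R) : Rintegral mu `[u, v] (fun=> c) = c * (v - u).
  have E : lebesgue_measure (`[u, v]%classic : set R) = (v - u)%:E.
    rewrite lebesgue_measure_itv/= lte_fin; case: ltP => // vu.
    by have -> : v = u by [apply/le_anti/andP]; rewrite subrr.
  by rewrite Rintegral_cst// [X in fine X](_ : _ = (v - u)%:E)//; exact: E.
have ic (c : R) : mu.-integrable `[u, v] (EFin \o (fun=> c)).
  by apply: integrable_itv_continuous => s; exact: cvg_cst.
rewrite -!cE; apply/andP; split; apply: le_Rintegral => //; try exact: ic; try exact: integrable_y.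
  by move=> s; rewrite /= in_itv/= => /andP[us _]; exact: nd_y.
by move=> s; rewrite /= in_itv/= => /andP[_ sv]; exact: nd_y.
Qed.

Let chasles (u v w : R) : u <= v -> v <= w ->
  Rintegral mu `[u, w] y = Rintegral mu `[u, v] y + Rintegral mu `[v, w] y.
Proof.
move=> uv vw.
have i2 : mu.-integrable `]v, w] (EFin \o y).
  apply: (integrableS _ _ _ (integrable_y v w)) => //; try exact: measurable_itv.
  exact: subset_itv_oc_cc.
have := @Rintegral_itvB R y (BLeft u) (BRight w) v (integrable_y u w).
by rewrite !bnd_simp (Rintegral_itv_obnd_cbnd i2) => /(_ uv vw) <-; ring.
Qed.

Lemma Rintegral_path_ge0 (t : R) : 0 <= t -> 0 <= Rintegral mu `[0, t] x <= t * x t.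
Proof.
move=> t0; rewrite -yE//; have /andP[h1 h2] := cell _ _ t0; apply/andP; split.
  by apply: le_trans h1; rewrite /y maxxx x0 mul0r.
by apply: (le_trans h2); rewrite subr0 /y max_r// mulrC.
Qed.

(** On each cell the right-endpoint value exceeds the mean by at most the increment of [x], and
    these increments telescope. *)
Lemma riemann_sum_bound (r s : R) (n : nat) : 0 <= r -> 0 <= s ->
  `|\sum_(j < n) s * x (r + j.+1%:R * s) -
    (Rintegral mu `[0, r + n%:R * s] x - Rintegral mu `[0, r] x)| <=
  s * (x (r + n%:R * s) - x r).
Proof.
move=> r0 s0.
have g0 k : 0 <= r + k%:R * s by rewrite addr_ge0 ?mulr_ge0.
have rg k : r <= r + k%:R * s by rewrite lerDl mulr_ge0.
have xy k : x (r + k%:R * s) = y (r + k%:R * s) by rewrite /y max_r.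
rewrite -!yE// (chasles 0 r _ r0 (rg n)) addrAC subrr add0r.
have main : \sum_(j < n) s * x (r + j.+1%:R * s) - s * (x (r + n%:R * s) - x r) <=
    Rintegral mu `[r, r + n%:R * s] y <= \sum_(j < n) s * x (r + j.+1%:R * s).
  elim: n => [|n /andP[IH1 IH2]].
    by have := cell _ _ (rg 0%N); rewrite !big_ord0 mul0r addr0 !subrr !mulr0 subr0.
  have gS : r + n%:R * s <= r + n.+1%:R * s by rewrite lerD2l ler_wpM2r// ler_nat.
  have /andP[c1 c2] := cell _ _ gS.
  have dE : r + n.+1%:R * s - (r + n%:R * s) = s by rewrite -natr1; ring.
  rewrite dE -!xy in c1 c2.
  rewrite (chasles _ _ _ (rg n) gS) !big_ord_recr/=.
  move: IH1 IH2 c1 c2; set S := \sum_(i < n) _; set X1 := x (r + n%:R * s).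
  set X2 := x (r + n.+1%:R * s); set I1 := Rintegral _ _ _; set I2 := Rintegral _ _ _.
  by move=> h1 h2 h3 h4; apply/andP; split; lra.
by move: main => /andP[h1 h2]; rewrite ger0_norm; lra.
Qed.

End riemann_sums.

Lemma cosB_le_norm (R : realType) (x y : R) : `|cos x - cos y| <= `|x - y|.
Proof.
wlog xy : x y / y <= x.
  move=> H; have [/H//|/ltW/H] := leP y x; by rewrite distrC [leRHS]distrC.
have /= := deriv1_bound _ cos (fun z => - sin z) 1 y x xy (fun z => is_derive_cos z).
rewrite mul1r (ger0_norm (_ : 0 <= x - y)) ?subr_ge0//; apply => z _.
by rewrite normrN sin_max.
Qed.

(** The error keeps the factor [e^a], so the decay of the unperturbed integrand makes it integrable;
    [D] bounds the perturbations uniformly. *)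
Lemma expcosB_le (R : realType) (a a' b b' del D : R) : 0 <= del -> del <= D ->
  `|a' - a| <= del -> `|b' - b| <= del ->
  `|expR a' * cos b' - expR a * cos b| <= expR a * (del * (expR D + 1)).
Proof.
move=> d0 dD ha hb.
have ea := expR_ge0 a.
rewrite (_ : _ - _ = expR a * ((expR (a' - a) - 1) * cos b' + (cos b' - cos b))); last first.
  by have -> : expR a' = expR a * expR (a' - a); [rewrite -expRD; congr expR; ring|ring].
rewrite normrM (ger0_norm ea) ler_wpM2l//; apply: (le_trans (ler_normD _ _)).
rewrite mulrDr mulr1; apply: lerD; last exact: le_trans (cosB_le_norm _ _ _) hb.
rewrite normrM; apply: (@le_trans _ _ `|expR (a' - a) - 1|); first by rewrite ler_piMr ?cos_max.
apply: (le_trans (expRB1_le _ _)); apply: ler_pM => //.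
by rewrite ler_expR; exact: le_trans dD.
Qed.

(** * Convergence of the iterated exponents *)

Section iterates.
Context {R : realType}.
Notation mu := (@lebesgue_measure R).
Let H : set R := `[(0 : R), +oo[.

(** Each step evaluates the previous iterate [s] higher, so the induction is over all heights [u]
    and the one-step errors add up. *)
Lemma iter_step_exp_close (G A : R -> R -> R) (s U eps : R) (n : nat) (l u : R) :
  0 <= s ->
  (forall u, 0 <= u -> u + s <= U -> `|A l (u + s) - A l u + s * G l u| <= eps) ->
  0 <= u -> u + n%:R * s <= U ->
  `|iter n (step_exp s G) A l u - A l u| <= n%:R * eps.
Proof.
move=> s0 hA; elim: n u => [|n IH] u u0 uU; first by rewrite subrr normr0 mul0r.
have ns : 0 <= n%:R * s by rewrite mulr_ge0.
rewrite iterS /step_exp -/(step_exp s G) -natr1 mulrDl mul1r.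
have E : u + n.+1%:R * s = u + s + n%:R * s by rewrite -natr1; ring.
rewrite E in uU.
rewrite (_ : _ - _ = iter n (step_exp s G) A l (u + s) - A l (u + s) +
   (A l (u + s) - A l u + s * G l u)); last by ring.
apply: (le_trans (ler_normD _ _)); apply: lerD; last by apply: hA => //; lra.
by apply: IH => //; rewrite addr_ge0.
Qed.

Variables (GA GB PG QG A B PA QA : R -> R -> R).
Hypothesis holoG : holo_exp GA GB PG QG.
Hypothesis decG : forall A s, 0 <= s -> decays A -> decays (fun l u => A l u + s * GA l u).
Hypotheses (hol : holo_exp A B PA QA) (dA : decays A).

Lemma iter_step_exp_holo (s : R) (n : nat) : 0 <= s ->
  (exists P Q, holo_exp (iter n (step_exp s GA) A) (iter n (step_exp s GB) B) P Q) /\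
  decays (iter n (step_exp s GA) A).
Proof.
move=> s0; elim: n => [|n [[P [Q IH]] IHd]]; first by split => //; exists PA, QA.
split; last exact: (decG _ _ s0 (decays_shift _ s IHd)).
have h := holo_addZ _ _ _ _ _ _ _ _ s (holo_shift _ _ _ _ s IH) holoG.
by eexists; eexists; exact: h.
Qed.

Let clin (F : R -> R) (x : R) : continuous F -> continuous (fun l => F l + l * x).
Proof.
move=> cF; apply: continuousD_fun => //; apply: continuousM_fun => l; first exact: cvg_id.
exact: cvg_cst.
Qed.

(** After the shift to height [r], the factor [e^{rx}] is gone and the integrand is dominated
    independently of [x]. This bounds the martingale. *)
Lemma hfour_shift_bounded (U : R) :
  exists D, 0 <= D /\ forall r x, `|r| <= U -> `|expR (r * x) * hfour A B x| <= D.
Proof.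
have [C [C0 HC]] := exp_cos_decay _ _ _ _ U hol dA.
exists (C * Rintegral mu H (fun l => expR (- (2 * l)))); split.
  by rewrite mulr_ge0//; apply: Rintegral_ge0 => l _; exact: expR_ge0.
move=> r x rU; rewrite (hfour_shift _ _ _ _ _ _ hol dA).
have [cA cB] := continuous_holo _ _ _ _ r hol.
apply: (Rintegral_expRN_le _ _ 2) => //.
  by rewrite add0r; apply: continuous_expcos => //; exact: clin.
move=> l l0; rewrite add0r.
rewrite normrM ger0_norm ?expR_ge0//; apply: le_trans (proj1 (HC l r l0 rU)).
by rewrite ler_piMr ?expR_ge0// cos_max.
Qed.

Hypothesis incr : forall U, exists C, 0 <= C /\ forall l u s : R, 0 <= u -> 0 <= s -> u + s <= U ->
  `|A l (u + s) - A l u + s * GA l u| <= C * s ^+ 2 /\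
  `|B l (u + s) - B l u + s * GB l u| <= C * s ^+ 2.

(** The contour is shifted to height [r] on both sides before comparing, so the bound holds
    uniformly in [x] with the weight [e^{rx}] included. *)
Lemma hfour_iterates_close (r t : R) : 0 <= r -> r <= t -> exists D, 0 <= D /\ forall n s x,
  s = (t - r) / n.+1%:R ->
  `|expR (r * x) * hfour (iter n.+1 (step_exp s GA) A) (iter n.+1 (step_exp s GB) B) x -
    expR (r * x) * hfour A B x| <= D * n.+1%:R^-1.
Proof.
move=> r0 rt.
have [C1 [C10 HC1]] := exp_cos_decay _ _ _ _ r hol dA.
have [C [C0 HC]] := incr t.
pose J := Rintegral mu H (fun l => expR (- (2 * l))).
(* [N = n + 1] steps of length [(t - r) / N] with error [C s^2] each give a total of [W / N]. *)
pose W : R := C * (t - r) ^+ 2.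
have W0 : 0 <= W by rewrite mulr_ge0// sqr_ge0.
have J0 : 0 <= J by apply: Rintegral_ge0 => l _; exact: expR_ge0.
exists (C1 * W * (expR W + 1) * J); split.
  by rewrite mulr_ge0// mulr_ge0 ?addr_ge0 ?expR_ge0// mulr_ge0.
move=> n s x sE; pose N : R := n.+1%:R.
have N0 : 0 < N by rewrite ltr0n.
have s0 : 0 <= s by rewrite sE divr_ge0// subr_ge0.
have Ns : N * s = t - r by rewrite sE mulrC divfK// gt_eqF.
have [[P [Q holn]] dn] := iter_step_exp_holo s n.+1 s0.
set An := iter _ _ _ in holn dn *; set Bn := iter _ _ _ in holn *.
rewrite (hfour_shift _ _ _ _ _ _ hol dA) (hfour_shift _ _ _ _ _ _ holn dn).
pose del : R := W / N.
have del0 : 0 <= del by rewrite divr_ge0// ltW.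
have N1 : 1 <= N by rewrite ler1n.
have delW : del <= W by rewrite ler_pdivrMr// ler_peMr.
have delE : N * (C * s ^+ 2) = del.
  have key (M : R) : 0 < M -> M * (C * s ^+ 2) = C * (M * s) ^+ 2 / M by move=> M0; field; exact: lt0r_neq0.
  by rewrite /del /W -Ns; exact: key.
have uU : r + n.+1%:R * s <= t by rewrite -/N Ns; lra.
have cA_ l : `|An l r - A l r| <= del.
  rewrite -delE; apply: (iter_step_exp_close _ _ _ t) => // u u0 ut.
  by have [] := HC l u s u0 s0 ut.
have cB_ l : `|Bn l r - B l r| <= del.
  rewrite -delE; apply: (iter_step_exp_close _ _ _ t) => // u u0 ut.
  by have [] := HC l u s u0 s0 ut.
have [c1 c2] := continuous_holo _ _ _ _ r hol.
have [c3 c4] := continuous_holo _ _ _ _ r holn.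
have k1 : continuous (fun l => expR (A l (0 + r)) * cos (B l (0 + r) + l * x)).
  by rewrite add0r; apply: continuous_expcos => //; exact: clin.
have k2 : continuous (fun l => expR (An l (0 + r)) * cos (Bn l (0 + r) + l * x)).
  by rewrite add0r; apply: continuous_expcos => //; exact: clin.
have [C2 [_ HC2]] := exp_cos_decay _ _ _ _ r holn dn.
have rr : `|r| <= r by rewrite ger0_norm.
have i1 : mu.-integrable H (EFin \o (fun l => expR (A l (0 + r)) * cos (B l (0 + r) + l * x))).
  apply: (integrable_expRN_le _ C1 2) => // l l0.
  rewrite add0r normrM ger0_norm ?expR_ge0//; apply: le_trans (proj1 (HC1 l r l0 rr)).
  by rewrite ler_piMr ?expR_ge0// cos_max.
have i2 : mu.-integrable H (EFin \o (fun l => expR (An l (0 + r)) * cos (Bn l (0 + r) + l * x))).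
  apply: (integrable_expRN_le _ C2 2) => // l l0.
  rewrite add0r normrM ger0_norm ?expR_ge0//; apply: le_trans (proj1 (HC2 l r l0 rr)).
  by rewrite ler_piMr ?expR_ge0// cos_max.
rewrite /hfour -RintegralB//.
rewrite (_ : _ * _ * J * _ = C1 * (del * (expR W + 1)) * J); last by rewrite /del -/N; ring.
apply: (Rintegral_expRN_le _ _ 2) => //.
  have kN := continuousN_fun _ _ k1.
  exact: (continuousD_fun _ _ _ k2 kN).
move=> l l0; rewrite add0r.
apply: (le_trans (expcosB_le _ _ _ _ _ _ _ del0 delW (cA_ l) _)).
  by rewrite (_ : _ - _ = Bn l r - B l r) ?cB_//; ring.
rewrite [leRHS](_ : _ = C1 * expR (- (2 * l)) * (del * (expR W + 1))); last by ring.
rewrite ler_wpM2r//; first by rewrite mulr_ge0// addr_ge0 ?expR_ge0.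
exact: (proj1 (HC1 l r l0 rr)).
Qed.

End iterates.

Lemma cvg_harmonic_bound (R : realType) (u : nat -> R) (l D : R) :
  (forall n, `|u n - l| <= D * n.+1%:R^-1) -> u @ \oo --> l.
Proof.
move=> h; apply/subr_cvg0; apply: norm_cvg0.
have c : (fun n => D * n.+1%:R^-1 : R) @ \oo --> (0 : R).
  by rewrite -(mulr0 D); apply: cvgM; [exact: cvg_cst|exact: cvg_harmonic].
apply: (@squeeze_cvgr _ _ _ _ (fun=> 0) (fun n : nat => D * n.+1%:R^-1)) => //.
  by near=> n; rewrite normr_ge0/= h.
exact: cvg_cst.
Unshelve. all: by end_near.
Qed.

(** * The martingale property in the limit *)

Section martingale_limit.
Context {R : realType} d {T : measurableType d} (P : probability T R).
Notation mu := (@lebesgue_measure R).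
Variable sigma : R -> T -> \bar R.
Let al t : set T := [set w | sigma t w \is a fin_num].
Let FT t := g_sigma_algebraType (filtration_events sigma t).
Hypothesis msig : forall t, 0 <= t -> measurable_fun setT (sigma t).
Variables (GA GB PG QG A B PA QA : R -> R -> R).
Hypothesis holoG : holo_exp GA GB PG QG.
Hypothesis decG : forall A s, 0 <= s -> decays A -> decays (fun l u => A l u + s * GA l u).
Hypothesis OS : forall (r s be l : R) (A : set T), 0 <= r -> 0 <= s ->
  natural_filtration sigma r A ->
  Rintegral P (A `&` al (r + s)) (fun w => cos (be + l * fine (sigma (r + s) w))) =
  expR (s * GA l 0) * Rintegral P (A `&` al r) (fun w => cos (be + s * GB l 0 + l * fine (sigma r w))).
Hypothesis al_le : forall s t, 0 <= s -> s <= t -> al t `<=` al s.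
Hypothesis al0 : P (al 0) = 1%E.
Hypothesis sig0 : forall w, al 0 w -> fine (sigma 0 w) = 0.
Hypothesis nd_sig : forall s t w, 0 <= s -> s <= t -> al t w -> fine (sigma s w) <= fine (sigma t w).
Hypotheses (hol : holo_exp A B PA QA) (dA : decays A) (h0 : forall x, 0 <= hfour A B x).
Hypothesis incr : forall U, exists C, 0 <= C /\ forall l u s : R, 0 <= u -> 0 <= s -> u + s <= U ->
  `|A l (u + s) - A l u + s * GA l u| <= C * s ^+ 2 /\
  `|B l (u + s) - B l u + s * GB l u| <= C * s ^+ 2.

Let I t w := Rintegral mu `[0, t] (fun s => fine (sigma s w)).
Let S r s n w := \sum_(j < n) s * fine (sigma (r + j.+1%:R * s) w).
Let K t w : R := \1_(al t) w * expR (I t w).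

(** After killing, [fine] sends [+oo] to 0 and the path is no longer monotone. Freezing it at time
    [t] gives a nondecreasing path with the same integrals up to [t]. *)
Let I_path t w : al t w -> forall u, 0 <= u -> u <= t ->
  I u w = Rintegral mu `[0, u] (fun s => fine (sigma (Num.min s t) w)).
Proof.
move=> aw u u0 ut; apply: eq_Rintegral => s; rewrite inE/= in_itv/= => /andP[_ su].
by rewrite min_l// (le_trans su).
Qed.

Let path_nd t w : 0 <= t -> al t w -> forall s s' : R, 0 <= s -> s <= s' ->
  fine (sigma (Num.min s t) w) <= fine (sigma (Num.min s' t) w).
Proof.
move=> t0 aw s s' s0 ss'; have s't : Num.min s' t <= t by rewrite ge_min lexx orbT.
have s'0 : 0 <= s' by exact: le_trans ss'.
apply: nd_sig; first by rewrite le_min s0.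
  by rewrite le_min !ge_min ss' lexx orbT.
by apply: (al_le _ _ _ s't) => //; rewrite le_min s'0.
Qed.

Let I_bound t w : 0 <= t -> al t w -> 0 <= I t w <= t * fine (sigma t w).
Proof.
move=> t0 aw; rewrite (I_path _ _ aw _ t0 (lexx t)).
have := Rintegral_path_ge0 _ (path_nd _ _ t0 aw) _ t t0; rewrite minxx; apply.
by rewrite min_l//; apply: sig0; exact: (al_le _ _ (lexx _) t0 _ aw).
Qed.

Let S_cvg r t w : 0 <= r -> r <= t -> al t w ->
  (fun n => S r ((t - r) / n.+1%:R) n.+1 w) @ \oo --> I t w - I r w.
Proof.
move=> r0 rt aw; have t0 : 0 <= t by exact: le_trans rt.
apply: (@cvg_harmonic_bound _ _ _ ((t - r) * (fine (sigma t w) - fine (sigma r w)))) => n.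
pose s := (t - r) / n.+1%:R.
have s0 : 0 <= s by rewrite divr_ge0// subr_ge0.
have ns : r + n.+1%:R * s = t by rewrite /s mulrC divfK ?pnatr_eq0//; ring.
have := riemann_sum_bound _ (path_nd _ _ t0 aw) r s n.+1 r0 s0.
rewrite ns minxx (min_l rt) -(I_path _ _ aw _ t0 (lexx t)) -(I_path _ _ aw _ r0 rt).
rewrite -[leRHS]/(s * (fine (sigma t w) - fine (sigma r w))).
rewrite (_ : s * _ = (t - r) * (fine (sigma t w) - fine (sigma r w)) * n.+1%:R^-1); last first.
  by rewrite /s; ring.
rewrite (eq_bigr (fun j : 'I_n.+1 => s * fine (sigma (r + j.+1%:R * s) w)))// => j _.
have jn : r + j.+1%:R * s <= t.
  by rewrite -[leRHS]ns lerD2l ler_wpM2r// ler_nat; exact: ltn_ord.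
by rewrite (min_l jn).
Qed.

Let S_le r t w n : 0 <= r -> r <= t -> al t w ->
  S r ((t - r) / n.+1%:R) n.+1 w <= (t - r) * fine (sigma t w).
Proof.
move=> r0 rt aw; have t0 : 0 <= t by exact: le_trans rt.
pose s := (t - r) / n.+1%:R.
have s0 : 0 <= s by rewrite divr_ge0// subr_ge0.
have ns : n.+1%:R * s = t - r by rewrite /s mulrC divfK ?pnatr_eq0.
apply: (@le_trans _ _ (\sum_(j < n.+1) s * fine (sigma t w))); last first.
  by rewrite sumr_const card_ord -mulr_natl mulrA ns.
apply: ler_sum => j _; rewrite ler_wpM2l//; apply: nd_sig => //.
  by rewrite addr_ge0// mulr_ge0.
apply: (@le_trans _ _ (r + n.+1%:R * s)); last by rewrite ns; lra.
by rewrite lerD2l ler_wpM2r// ler_nat; exact: ltn_ord.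
Qed.

Let FS r t s n : 0 <= r -> 0 <= s -> r + n%:R * s <= t ->
  measurable_fun setT (S r s n : FT t -> R).
Proof.
move=> r0 s0 rt; apply: measurable_sum => j; apply: measurable_funM => //.
apply: fmeas_fine; first by rewrite addr_ge0// mulr_ge0.
by apply: le_trans rt; rewrite lerD2l ler_wpM2r// ler_nat; exact: ltn_ord.
Qed.

(** The path integral is adapted, as a limit of Riemann sums that only use times in [[0, t]]. *)
Let FK t : 0 <= t -> measurable_fun setT (K t : FT t -> R).
Proof.
move=> t0.
apply: (@measurable_fun_cvg _ (FT t) R setT
  (fun n w => \1_(al t) w * expR (S 0 (t / n.+1%:R) n.+1 w)) (K t)).
  move=> n; apply: measurable_funM.
    apply: measurable_indic; exact: (fmeas_alive _ sigma t t t0 (lexx t)).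
  apply: (measurableT_comp (f := expR)) => //; apply: FS => //; first by rewrite divr_ge0.
  by rewrite add0r mulrC divfK// pnatr_eq0.
move=> w _; rewrite /K indicE; case: (boolP (w \in al t)) => [|_]; last first.
  rewrite mul0r; under eq_fun do rewrite mul0r; exact: cvg_cst.
rewrite inE => aw; apply: cvgM; first exact: cvg_cst.
apply: continuous_cvg; first exact: continuous_expR.
have := S_cvg 0 t w (lexx _) t0 aw.
rewrite subr0 (_ : I 0 w = 0) ?subr0//.
by rewrite /I set_itv1 Rintegral_set1.
Qed.

Let h := hfour A B.
Let N t w : R := K t w * h (fine (sigma t w)).

Let ch : continuous h. Proof. exact: continuous_hfour hol dA. Qed.

Let mh : measurable_fun setT h. Proof. exact: measurable_continuous. Qed.

Let K_le t w : 0 <= t -> K t w <= \1_(al t) w * expR (t * fine (sigma t w)).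
Proof.
move=> t0; rewrite /K indicE; case: (boolP (w \in al t)); rewrite ?mul0r// inE => aw.
by rewrite !mul1r ler_expR; have /andP[] := I_bound t w t0 aw.
Qed.

Lemma fmeas_weighted t : 0 <= t -> measurable_fun setT (N t : FT t -> R).
Proof.
move=> t0; apply: measurable_funM; first exact: FK.
exact: (measurableT_comp mh (fmeas_fine _ sigma t t t0 (lexx t))).
Qed.

Lemma weighted_bounded t : 0 <= t -> exists D, 0 <= D /\ forall w, 0 <= N t w <= D.
Proof.
move=> t0; have [D [D0 HD]] := hfour_shift_bounded _ _ _ _ hol dA t.
exists D; split => // w; apply/andP; split.
  by rewrite mulr_ge0// mulr_ge0 ?expR_ge0.
apply: (@le_trans _ _ (\1_(al t) w * expR (t * fine (sigma t w)) * h (fine (sigma t w)))).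
  by rewrite ler_wpM2r// K_le.
rewrite indicE; case: (_ \in _); rewrite ?mul0r// mul1r.
by apply: (le_trans (ler_norm _)); apply: HD; rewrite ger0_norm.
Qed.

Let alE t w : \1_(al t) w = (w \in al t)%:R :> R. Proof. by rewrite indicE. Qed.

Let mF r (C : set T) : 0 <= r -> natural_filtration sigma r C -> measurable C.
Proof. exact: (filtration_measurable _ _ msig). Qed.

Let mfine t : 0 <= t -> measurable_fun setT (fun w => fine (sigma t w)).
Proof. by move=> t0; exact: (measurableT_comp (@fine_measurable R _ measurableT) (msig t t0)). Qed.

Let mal t : 0 <= t -> measurable (al t).
Proof. by move=> t0; exact: (mF t _ t0 (fmeas_alive _ sigma t t t0 (lexx t))). Qed.

Let hn r t n := hfour (iter n.+1 (step_exp ((t - r) / n.+1%:R) GA) A)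
                      (iter n.+1 (step_exp ((t - r) / n.+1%:R) GB) B).

Let lhs_cvg r t (C : set T) : 0 <= r -> r <= t -> measurable C ->
  (fun n => Rintegral P setT (fun w => \1_C w * K r w * expR (S r ((t - r) / n.+1%:R) n.+1 w) *
     (\1_(al t) w * h (fine (sigma t w))))) @ \oo -->
  Rintegral P setT (fun w => \1_C w * N t w).
Proof.
move=> r0 rt mC; have t0 : 0 <= t by exact: le_trans rt.
have [D [D0 HD]] := hfour_shift_bounded _ _ _ _ hol dA t.
have mK : measurable_fun setT (K r) by exact: (fmeas_measurable _ sigma msig r (K r) r0 (FK r r0)).
apply: (bounded_cvg _ _ _ _ _ _ _ D) => //.
- move=> n; apply: measurable_funM; first apply: measurable_funM; first apply: measurable_funM => //.
    apply: (measurableT_comp (f := expR)) => //.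
    apply: (fmeas_measurable _ sigma msig t _ t0); apply: FS => //.
      by rewrite divr_ge0// subr_ge0.
    by rewrite mulrC divfK ?pnatr_eq0//; lra.
  apply: measurable_funM; first by apply: measurable_indic; exact: mal.
  exact: (measurableT_comp mh (mfine t t0)).
- move=> w _; rewrite /N /K (alE t); case: (boolP (w \in al t)); last first.
    by move=> _; rewrite !mul0r mulr0; under eq_fun do rewrite mulr0; exact: cvg_cst.
  rewrite inE => aw; have ar : al r w by exact: (al_le _ _ r0 rt).
  rewrite (alE r) (mem_set ar) !mul1r.
  rewrite mulrA; apply: cvgM; last exact: cvg_cst.
  rewrite (_ : expR (I t w) = expR (I r w) * expR (I t w - I r w)); last first.
    by rewrite -expRD; congr expR; ring.
  under eq_fun do rewrite -mulrA; apply: cvgM; first exact: cvg_cst.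
  apply: cvgM; first exact: cvg_cst.
  by apply: continuous_cvg; [exact: continuous_expR|exact: S_cvg].
- move=> n w _; rewrite (alE t); case: (boolP (w \in al t)); last first.
    by move=> _; rewrite mul0r mulr0 normr0.
  rewrite inE => aw; have ar : al r w by exact: (al_le _ _ r0 rt).
  rewrite mul1r normrM (ger0_norm (h0 _)) ger0_norm; last first.
    by rewrite !mulr_ge0 ?expR_ge0.
  apply: le_trans (HD t (fine (sigma t w)) _); last by rewrite ger0_norm.
  rewrite normrM (ger0_norm (h0 _)) ler_wpM2r// ger0_norm ?expR_ge0// /K (alE r) (mem_set ar) mul1r.
  rewrite -mulrA -expRD; apply: (@le_trans _ _ (1 * expR (I r w + S r ((t - r) / n.+1%:R) n.+1 w))).
    by rewrite ler_wpM2r ?expR_ge0// indicE; case: (_ \in _).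
  (* The total exponent is at most [r sigma_r + (t - r) sigma_t <= t sigma_t], the weight covered by
     [hfour_shift_bounded]. *)
  rewrite mul1r ler_expR; have /andP[_ h1] := I_bound _ _ r0 ar; have h2 := S_le r t w n r0 rt aw.
  have h3 : r * fine (sigma r w) <= r * fine (sigma t w) by rewrite ler_wpM2l//; exact: nd_sig.
  lra.
Qed.

Let rhs_cvg r t (C : set T) : 0 <= r -> r <= t -> measurable C ->
  (fun n => Rintegral P setT (fun w => \1_C w * K r w *
     (\1_(al r) w * hn r t n (fine (sigma r w))))) @ \oo -->
  Rintegral P setT (fun w => \1_C w * N r w).
Proof.
move=> r0 rt mC.
have [D [D0 HD]] := hfour_iterates_close _ _ _ _ _ _ _ _ holoG decG hol dA incr r t r0 rt.
have [D1 [D10 HD1]] := hfour_shift_bounded _ _ _ _ hol dA r.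
have mK : measurable_fun setT (K r) by exact: (fmeas_measurable _ sigma msig r (K r) r0 (FK r r0)).
have s0 n : 0 <= (t - r) / n.+1%:R by rewrite divr_ge0// subr_ge0.
apply: (bounded_cvg _ _ _ _ _ _ _ (D1 + D)) => //.
- move=> n; apply: measurable_funM; first exact: measurable_funM.
  apply: measurable_funM; first by apply: measurable_indic; exact: mal.
  have [[P' [Q' ho]] de] := iter_step_exp_holo _ _ _ _ _ _ _ _ holoG decG hol dA _ n.+1 (s0 n).
  have mhn : measurable_fun setT (hn r t n).
    by apply: measurable_continuous; exact: continuous_hfour ho de.
  exact: (measurableT_comp mhn (mfine r r0)).
- move=> w _; rewrite /N [X in _ --> X]mulrA (alE r); case: (boolP (w \in al r)) => [_|/negbTE wr]; last first.
    rewrite /K (alE r) wr !mul0r !mulr0 mul0r; under eq_fun do rewrite mul0r; exact: cvg_cst.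
  under eq_fun do rewrite mul1r; apply: cvgM; first exact: cvg_cst.
  (* For fixed [w] the estimate may be divided by [e^{r y}]: only pointwise convergence is claimed
     here. *)
  set y := fine _; have ey := expR_gt0 (r * y).
  apply: (@cvg_harmonic_bound _ _ _ (D / expR (r * y))) => n.
  have := HD n _ y erefl; rewrite -mulrBr normrM gtr0_norm// mulrC -ler_pdivlMr// => le1.
  by apply: (le_trans le1); rewrite mulrAC.
(* The past weight is at most [e^{r y}], the factor built into both estimates: [D1] bounds the limit
   and [D] the difference, as [1 / (n + 1) <= 1]. *)
- move=> n w _; rewrite (alE r); case: (boolP (w \in al r)) => [wr|_]; last first.
    by rewrite mul0r mulr0 normr0 addr_ge0.
  rewrite mul1r normrM; set y := fine _.
  have k1 : `|\1_C w * K r w| <= expR (r * y).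
    rewrite normrM (_ : `|K r w| = K r w); last by rewrite ger0_norm// mulr_ge0 ?expR_ge0.
    apply: (@le_trans _ _ (1 * K r w)).
      rewrite ler_wpM2r ?mulr_ge0 ?expR_ge0//.
      by rewrite indicE; case: (_ \in _); rewrite ?normr1 ?normr0.
    by rewrite mul1r; apply: (le_trans (K_le _ _ r0)); rewrite (alE r) wr mul1r.
  apply: (@le_trans _ _ (expR (r * y) * `|hn r t n y|)); first by rewrite ler_wpM2r.
  have e1 := HD n _ y erefl; have e2 := HD1 r y; rewrite (ger0_norm r0) in e2.
  rewrite -[X in X * _](ger0_norm (expR_ge0 (r * y))) -normrM.
  rewrite (_ : _ * hn r t n y = expR (r * y) * h y + (expR (r * y) * hn r t n y - expR (r * y) * h y)); last by ring.
  apply: (le_trans (ler_normD _ _)); apply: lerD; first exact: e2.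
  by apply: (le_trans e1); rewrite ler_piMr// invf_le1// ler1n.
Qed.

(** For each [n], [multi_step] with the weight [1_C K_r] equates the sequences of [lhs_cvg] and
    [rhs_cvg]; their limits are the two integrals. *)
Lemma weighted_martingale r t (C : set T) : 0 <= r -> r <= t -> natural_filtration sigma r C ->
  (\int[P]_(w in C) (N t w)%:E = \int[P]_(w in C) (N r w)%:E)%E.
Proof.
move=> r0 rt FC; have t0 : 0 <= t by exact: le_trans rt.
have mC := mF _ _ r0 FC.
have iN u : 0 <= u -> P.-integrable C (EFin \o N u).
  move=> u0; have [D [D0 HD]] := weighted_bounded u u0.
  apply: (bounded_integrable _ _ _ _ _ _ D) => //.
    apply: measurable_funTS; exact: (fmeas_measurable _ sigma msig u (N u) u0 (fmeas_weighted u u0)).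
  by move=> w _; have /andP[n0 nD] := HD w; rewrite ger0_norm.
rewrite (RintegralE _ _ _ P C (N t) mC (iN t t0)) (RintegralE _ _ _ P C (N r) mC (iN r r0)).
rewrite -(Rintegral_indicM _ _ _ P C (N t)) -(Rintegral_indicM _ _ _ P C (N r)); congr EFin.
have lc := lhs_cvg r t C r0 rt mC; have rc := rhs_cvg r t C r0 rt mC.
suff E : (fun n => Rintegral P setT (fun w => \1_C w * K r w * expR (S r ((t - r) / n.+1%:R) n.+1 w) *
     (\1_(al t) w * h (fine (sigma t w))))) = (fun n => Rintegral P setT (fun w => \1_C w * K r w *
     (\1_(al r) w * hn r t n (fine (sigma r w))))).
  by rewrite E in lc; exact: (cvg_unique (@norm_hausdorff _ _) lc rc).
apply/funext => n; pose s := (t - r) / n.+1%:R.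
have s0 : 0 <= s by rewrite divr_ge0// subr_ge0.
have ns : r + n.+1%:R * s = t by rewrite /s mulrC divfK ?pnatr_eq0//; ring.
have mG : measurable_fun setT ((fun w => \1_C w * K r w) : FT r -> R).
  by apply: measurable_funM; [apply: measurable_indic; exact: FC|exact: FK].
have G0 w : 0 <= \1_C w * K r w by rewrite !mulr_ge0 ?expR_ge0.
have := multi_step _ P sigma msig GA GB PG QG holoG decG OS al0 sig0 s n.+1 r _ A B PA QA
  s0 r0 hol dA h0 mG G0.
by rewrite ns /Rintegral => /(congr1 fine) ->.
Qed.

End martingale_limit.

(** * The density and the exponential martingale *)

Theorem theorem2p1 (R : realType) (a b : R) (nu : {measure set R -> \bar R})
  (d1 : measure_display) (T1 : measurableType d1) (P1 : probability T1 R)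
  (L : R -> T1 -> R)
  (d2 : measure_display) (T2 : measurableType d2) (P2 : probability T2 R)
  (sigma : R -> T2 -> \bar R) :
  0 <= a -> 0 <= b ->
  (\int[nu]_(x in `](0%R : R), +oo[) (Order.min x (x ^+ 2))%R%:E < +oo)%E ->
  levy_process P1 L ->
  (forall t l, 0 <= t ->
     charfun_is P1 (L t) l (t * PsiL_re b nu l) (t * PsiL_im a nu l)) ->
  killed_subordinator P2 a sigma ->
  (forall t l, 0 <= t ->
     charfun_killed_is P2 (sigma t) l (t * Psis_re a nu l) (t * Psis_im b nu l)) ->
  (forall u : R,
     (\int[nu]_(x in `](0%R : R), +oo[) (expR (u * x) - 1 - u * x)%R%:E < +oo)%E) ->
  (forall M : R, exists K : R, forall l : R,
     K < `|l| -> M < PsiL_re b nu l / `|l|) ->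
  (exists p : R -> R, continuous p /\ density_of P1 (L 1) p) /\
  (forall p : R -> R, continuous p -> density_of P1 (L 1) p ->
     (forall t w, 0 <= t -> 0 <= Mproc sigma p t w) /\
     martingale P2 (natural_filtration sigma) (Mproc sigma p)).
Proof.
move=> a0 _ _ levyL charL killed charS nu_exp reL.
pose A := GLA nu a b; pose B := GLB nu a b; pose GA := GSA nu a b; pose GB := GSB nu b.
have hol := holo_GL nu nu_exp a b a0; have holG := holo_GS nu nu_exp a b.
have dA := decays_GL nu nu_exp a b a0 reL.
have decG := decays_addGS nu nu_exp a b.
have incr := GL_increment nu nu_exp a b a0.
have [cA cB] := continuous_holo _ _ _ _ 0 hol.
have [C HC] := dA 0.
have alC l : 0 <= l -> expR (A l 0) <= expR C * expR (- (2 * l)).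
  by move=> l0; rewrite -expRD ler_expR HC// normr0.
have mL : measurable_fun setT (L 1) by have [] := levyL.
have cosL l : Rintegral P1 setT (fun w => cos (l * L 1 w)) = expR (A l 0) * cos (B l 0).
  have [/(congr1 fine)] := charL 1 l ler01; rewrite -[LHS]/(Rintegral _ _ _) => -> _.
  by rewrite /= !mul1r (PsiL_reE nu a b) (PsiL_imE nu a b) opprK cosN.
have sinL l : Rintegral P1 setT (fun w => sin (l * L 1 w)) = expR (A l 0) * sin (B l 0).
  have [_ /(congr1 fine)] := charL 1 l ler01; rewrite -[LHS]/(Rintegral _ _ _) => ->.
  by rewrite /= !mul1r (PsiL_reE nu a b) (PsiL_imE nu a b) opprK sinN mulrN opprK.
pose q := inv_density (fun l => A l 0) (fun l => B l 0).
have cq : continuous q := continuous_inv_density _ _ _ cA cB alC.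
have q0 : forall x, 0 <= q x := inv_density_ge0 _ P1 _ _ _ _ mL cA cB alC cosL sinL.
have dq : density_of P1 (L 1) q.
  apply: (density_of_sandwich _ P1 _ _ mL cq q0 _ (inv_density_bound _ _ _ cA cB alC)).
  exact: (inv_density_interval _ P1 _ _ _ _ mL cA cB alC cosL sinL).
split; first by exists q.
(* Any continuous density is the inversion density [q], whose Fourier formula is available. *)
move=> p cp dp; rewrite (density_unique _ _ _ P1 _ _ _ cp cq dp dq) {p cp dp}.
have [tau [e [sub_tau me exp_e indep_e sigmaE]]] := killed.
pose al t : set T2 := [set w | sigma t w \is a fin_num].
(* Evaluating at [- x] turns the phase [- l y] of inversion into [+ l x], the sign in the
   characteristic function of [sigma]. *)
have qE x : q (- x) = pi^-1 * hfour A B x.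
  by congr (_ * _); apply: eq_Rintegral => l _; rewrite opprK.
have h0 x : 0 <= hfour A B x.
  by have := q0 (- x); rewrite qE pmulr_rge0// invr_gt0 pi_gt0.
have charc t l : 0 <= t -> Rintegral P2 (al t) (fun w => cos (l * fine (sigma t w))) =
    expR (t * GA l 0) * cos (t * GB l 0).
  move=> t0; have [/(congr1 fine)] := charS t l t0; rewrite -[LHS]/(Rintegral _ _ _) => -> _.
  by rewrite /= (Psis_reE nu a b) (Psis_imE nu b) !mulrN opprK cosN.
have chars t l : 0 <= t -> Rintegral P2 (al t) (fun w => sin (l * fine (sigma t w))) =
    expR (t * GA l 0) * sin (t * GB l 0).
  move=> t0; have [_ /(congr1 fine)] := charS t l t0; rewrite -[LHS]/(Rintegral _ _ _) => ->.
  by rewrite /= (Psis_reE nu a b) (Psis_imE nu b) !mulrN opprK sinN mulrN opprK.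
have OS := one_step _ P2 a sigma tau e sub_tau me exp_e indep_e sigmaE (GA^~ 0) (GB^~ 0) charc chars.
have msig : forall t, 0 <= t -> measurable_fun setT (sigma t).
  by move=> t t0; apply: (measurable_sigma _ P2 sigma tau e).
have alle := alive_le _ sigma tau e sigmaE.
have al0 : P2 (al 0) = 1%E.
  by rewrite [al 0](aliveE _ sigma tau e sigmaE)// exp_e// mulr0 oppr0 expR0.
have sigt t w : 0 <= t -> al t w -> fine (sigma t w) = tau t w.
  exact: (sigma_alive _ sigma tau e sigmaE).
have sig0 w : al 0 w -> fine (sigma 0 w) = 0.
  by move=> aw; rewrite sigt//; have [[_ ->]] := sub_tau.
have nd_sig s t w : 0 <= s -> s <= t -> al t w -> fine (sigma s w) <= fine (sigma t w).
  move=> s0 st aw; rewrite !sigt//; first by have [_] := sub_tau; apply.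
    exact: le_trans st.
  exact: (alle s t).
pose N t w := (\1_(al t) w * expR (Rintegral lebesgue_measure `[0, t] (fun s => fine (sigma s w)))) *
  hfour A B (fine (sigma t w)).
(* The case distinction on survival becomes the indicator in [N], and only the constant [pi^{-1}]
   separates the two processes. *)
have ME t : Mproc sigma q t = fun w => pi^-1 * N t w.
  apply/funext => w; rewrite /Mproc /N indicE; case: ifP => aw.
    by rewrite mem_set// mul1r qE mulrCA.
  by rewrite memNset ?mul0r ?mulr0//= /al/= aw.
have N0 t w : 0 <= N t w by rewrite mulr_ge0// mulr_ge0 ?expR_ge0.
have pi0 : 0 <= pi^-1 :> R by rewrite invr_ge0 pi_ge0.
have mN t (t0 : 0 <= t) := fmeas_weighted _ sigma A B _ _ alle nd_sig hol dA t t0.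
split; first by move=> t w t0; rewrite ME mulr_ge0.
split.
- move=> t D t0 mD; rewrite ME.
  have m1 : measurable_fun setT ((fun w => pi^-1 * N t w) : g_sigma_algebraType (filtration_events sigma t) -> R).
    by apply: measurable_funM => //; exact: mN.
  by have := m1 measurableT _ mD; rewrite setTI.
- move=> t t0; have [D [D0 HD]] := weighted_bounded _ sigma A B _ _ alle sig0 nd_sig hol dA h0 t t0.
  rewrite ME; apply: (bounded_integrable _ _ _ _ _ _ (pi^-1 * D)) => //.
    by apply: measurable_funM => //; exact: (fmeas_measurable _ sigma msig t (N t) t0 (mN t t0)).
  move=> w _; have /andP[_ nD] := HD w.
  by rewrite ger0_norm ?mulr_ge0// ler_wpM2l.
- move=> s t D s0 st FD; rewrite !ME.
  have key := weighted_martingale _ P2 sigma msig GA GB _ _ A B _ _ holG decG OS alle al0 sig0 nd_sig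
    hol dA h0 incr s t D s0 st FD.
  have zE u : 0 <= u -> (\int[P2]_(w in D) (pi^-1 * N u w)%:E =
      (pi^-1)%:E * \int[P2]_(w in D) (N u w)%:E)%E.
    move=> u0.
    have mD := filtration_measurable _ sigma msig s D s0 FD.
    have mNu : measurable_fun D (EFin \o N u).
      apply/measurable_EFinP; apply: measurable_funTS.
      exact: (fmeas_measurable _ sigma msig u (N u) u0 (mN u u0)).
    have Nu0 w : D w -> (0 <= (EFin \o N u) w)%E by move=> _; rewrite lee_fin.
    exact: (ge0_integralZl_EFin P2 mD Nu0 mNu pi0).
  by rewrite (zE t (le_trans s0 st)) (zE s s0) key.
Qed.
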